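(* Let $P\subseteq\{3,4,\ldots,\omega\}$ and let $\mathcal{F}_P$ be the class of finite $\mathcal{L}_P$-structures described in the context. Then there exists a class $\mathcal{F}^*_P$ of finite structures in a language $\mathcal{L}^*\supseteq\mathcal{L}_P$, with $\mathcal{L}^*\setminus\mathcal{L}_P$ relational, such that $\mathcal{F}^*_P$ is a Fraïssé-HP family, it is an expansion of $\mathcal{F}_P$, this expansion is reasonable, has the relative HP with respect to $\mathcal{F}_P$, has the expansion property relative to $\mathcal{F}_P$, and $\mathcal{F}^*_P$ is a Ramsey class. Moreover, if $P$ is finite, then this expansion $\mathcal{F}^*_P$ is also precompact.
   Context: Conventions: $\omega$ denotes a countably infinite order and is regarded as larger than every natural number. A tree is a finite acyclic connected graph; the degree of a vertex is the number of edges containing it. For vertices $a,b$ of a tree, $ab$ denotes the unique path joining them (a single vertex if $a=b$). Let $\mathcal{L}_P$ be the language consisting of a 4-ary relation symbol $D$ and unary relation symbols $K_p$, $p\in P$. $\mathcal{F}_P$ is the class of all finite $\mathcal{L}_P$-structures $A$ whose universe is the vertex set of a finite tree in which no vertex has degree $2$, such that $D^A(a,b,c,d)$ holds iff the paths $ab$ and $cd$ share no vertex, and such that each $a\in A$ satisfies $K^A_p(a)$ for exactly one $p\in P$ and, for that $p$, the degree of $a$ is at most $p$. An embedding between structures is an injective map $f$ with $R(\bar a)\iff R(f(\bar a))$ for every relation symbol $R$. $A\le B$ means $A$ embeds into $B$; $\binom{B}{A}$ is the set of embeddings of $A$ into $B$. A Fraïssé-HP family is a class of finite structures in a countable language, closed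 under isomorphism, with countably many isomorphism types, having the joint embedding property and the amalgamation property (the hereditary property is not required). Let $\mathcal{G}$ be a class of $\mathcal{L}$-structures and $\mathcal{G}^*$ a class of $\mathcal{L}^*$-structures with $\mathcal{L}^*\supseteq\mathcal{L}$, $\mathcal{L}^*\setminus\mathcal{L}$ relational. $\mathcal{G}^*$ is an expansion of $\mathcal{G}$ if $A^*\mapsto A^*\restriction\mathcal{L}$ maps $\mathcal{G}^*$ onto $\mathcal{G}$. It is reasonable if for all $A,B\in\mathcal{G}$, every embedding $\alpha\colon A\to B$ and every expansion $A^*\in\mathcal{G}^*$ of $A$, there is an expansion $B^*\in\mathcal{G}^*$ of $B$ with $\alpha\colon A^*\to B^*$ an embedding. It is precompact if each $A\in\mathcal{G}$ has only finitely many expansions in $\mathcal{G}^*$. It has the relative HP with respect to $\mathcal{G}$ if whenever $A,B\in\mathcal{G}$, $A$ is a substructure of $B$ and $B^*\in\mathcal{G}^*$ expands $B$, then $B^*\restriction A\in\mathcal{G}^*$. It has the expansion property relative to $\mathcal{G}$ if for every $A^*\in\mathcal{G}^*$ there is $B\in\mathcal{G}$ such that $A^*$ embeds into every expansion $B^*\in\mathcal{G}^*$ of $B$. A class $\mathcal{G}$ is a Ramsey class if for all $A,B\in\mathcal{G}$ with $A\le B$ and every $r\ge 2$ there is $C\in\mathcal{G}$ such that for every coloring $c\colon\binom{C}{A}\to\{1,\ldots,r\}$ there is $h\in\binom{C}{B}$ with $\{h\circ f: f\in\binom{B}{A}\}$ monochromatic. *)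

(* Defs.v *)
From mathcomp Require Import all_boot.
From mathcomp Require Import boolp classical_sets functions cardinality.

Set Implicit Arguments.
Unset Strict Implicit.
Unset Printing Implicit Defensive.

Local Open Scope classical_set_scope.

Record language := Language {
  sym : Type;
  arity : sym -> nat;
  arity_gt0 : forall R, 0 < arity R }.

Definition interpretation (L : language) (T : Type) :=
  forall R : sym L, set ((arity R).-tuple T).

Record structure (L : language) := Structure {
  carrier :> finType;
  interp : interpretation L carrier }.

Definition is_embedding (L : language) (A B : structure L) (f : A -> B) : Prop :=
  injective f /\
  forall (R : sym L) (t : (arity R).-tuple A),
    interp t <-> interp (map_tuple f t).

Record embedding (L : language) (A B : structure L) := Embedding {
  emb_fun :> A -> B;
  emb_funP : is_embedding emb_fun }.

Definition embeds (L : language) (A B : structure L) : Prop :=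
  exists f : A -> B, is_embedding f.

Lemma is_embedding_comp (L : language) (A B C : structure L)
    (h : embedding B C) (f : embedding A B) :
  @is_embedding L A C (h \o f).
Proof.
case: h f => [h [h_inj hP]] [f [f_inj fP]]; split=> [|R t] /=.
  exact: inj_comp.
rewrite fP hP (_ : map_tuple h _ = map_tuple (h \o f) t) //.
by apply: val_inj; rewrite /= map_comp.
Qed.

Definition emb_comp (L : language) (A B C : structure L)
    (h : embedding B C) (f : embedding A B) : embedding A C :=
  Embedding (is_embedding_comp h f).

Definition isomorphic (L : language) (A B : structure L) : Prop :=
  exists f : A -> B, is_embedding f /\ bijective f.

(* The substructure of B with universe S (the language is relational, so every
   subset is the universe of a substructure). *)
Definition substructure (L : language) (B : structure L) (S : {set B}) :
    structure L :=
  @Structure L {x : B | x \in S} (fun R t => interp (map_tuple val t)).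

(* Not [set (structure L)]: the universe of [set] is below that of [finType]. *)
Definition class (L : language) := structure L -> Prop.

Definition joint_embedding (L : language) (G : class L) : Prop :=
  forall A B, G A -> G B -> exists C, [/\ G C, embeds A C & embeds B C].

Definition amalgamation (L : language) (G : class L) : Prop :=
  forall (A B C : structure L) (f : embedding A B) (g : embedding A C),
    G A -> G B -> G C ->
    exists (D : structure L) (r : embedding B D) (s : embedding C D),
      G D /\ forall a : A, r (f a) = s (g a).

Record Fraisse_HP (L : language) (G : class L) : Prop := FraisseHP {
  fraisse_language : countable [set: sym L];
  fraisse_iso : forall A B, isomorphic A B -> G A -> G B;
  fraisse_countable : exists E : nat -> structure L,
    forall A, G A -> exists n, isomorphic A (E n);
  fraisse_joint_embedding : joint_embedding G;
  fraisse_amalgamation : amalgamation G }.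

Definition Ramsey_class (L : language) (G : class L) : Prop :=
  forall A B : structure L, G A -> G B -> embeds A B ->
  forall r : nat, 2 <= r ->
  exists2 C : structure L, G C &
    forall c : embedding A C -> 'I_r,
    exists (h : embedding B C) (k : 'I_r),
      forall f : embedding A B, c (emb_comp h f) = k.

(* A relational extension of L is the disjoint union of L with a further
   relational language L'. An expansion of A is then the same thing as an
   interpretation, on the universe of A, of the symbols of L'. *)
Definition lang_union (L L' : language) : language :=
  @Language (sym L + sym L')
    (fun R => match R with inl R1 => arity R1 | inr R2 => arity R2 end)
    (fun R => match R with inl R1 => arity_gt0 R1 | inr R2 => arity_gt0 R2 end).

Definition reduct (L L' : language) (A : structure (lang_union L L')) :
    structure L :=
  @Structure L A (fun R => @interp _ A (inl R)).

Definition expand (L L' : language) (A : structure L)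
    (i : interpretation L' A) : structure (lang_union L L') :=
  @Structure (lang_union L L') A
    (fun R => match R with inl R1 => @interp _ A R1 | inr R2 => i R2 end).

Section Expansions.
Variables (L L' : language).
Variables (G : class L) (Gs : class (lang_union L L')).

Definition is_expansion : Prop :=
  (forall As, Gs As -> G (reduct As)) /\
  (forall A, G A -> exists i : interpretation L' A, Gs (expand i)).

Definition reasonable : Prop :=
  forall (A B : structure L) (alpha : embedding A B), G A -> G B ->
  forall i : interpretation L' A, Gs (expand i) ->
  exists2 j : interpretation L' B, Gs (expand j) &
    @is_embedding _ (expand i) (expand j) alpha.

Definition precompact : Prop :=
  forall A : structure L, G A ->
    finite_set [set i : interpretation L' A | Gs (expand i)].

Definition relative_HP : Prop :=
  forall (B : structure L) (S : {set B}), G B -> G (substructure S) ->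
  forall j : interpretation L' B, Gs (expand j) ->
    Gs (@substructure _ (expand j) S).

Definition expansion_property : Prop :=
  forall As, Gs As ->
  exists2 B : structure L, G B &
    forall j : interpretation L' B, Gs (expand j) -> embeds As (expand j).

End Expansions.

Record is_tree (T : finType) (e : rel T) : Prop := IsTree {
  tree_sym : symmetric e;
  tree_irr : irreflexive e;
  tree_nonempty : 0 < #|T|;
  tree_connected : forall x y, connect e x y;
  tree_acyclic : forall c : seq T, 2 < size c -> ~ ucycle e c }.

Definition degree (T : finType) (e : rel T) (x : T) : nat := #|[pred y | e x y]|.

Definition on_path (T : finType) (e : rel T) (a b v : T) : Prop :=
  exists p : seq T,
    [/\ path e a p, last a p = b, uniq (a :: p) & v \in a :: p].

(* Elements of {0, 1, 2, ...} together with omega, where omega is [None]. *)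
Definition le_bound (n : nat) (p : option nat) : bool :=
  if p is Some k then n <= k else true.

Inductive LP_sym (P : set (option nat)) := symD | symK of set_type P.
Arguments symD {P}.

Definition LP_arity (P : set (option nat)) (R : LP_sym P) : nat :=
  if R is symD then 4 else 1.

Lemma LP_arity_gt0 (P : set (option nat)) (R : LP_sym P) : 0 < LP_arity R.
Proof. by case: R. Qed.

Definition LP (P : set (option nat)) : language := Language (@LP_arity_gt0 P).

Definition relD (P : set (option nat)) (A : structure (LP P)) (a b c d : A) :
  Prop := @interp _ A symD [tuple a; b; c; d].

Definition relK (P : set (option nat)) (A : structure (LP P)) (p : set_type P)
  (a : A) : Prop := @interp _ A (symK p) [tuple a].

Definition FP (P : set (option nat)) : class (LP P) := fun A =>
  exists e : rel A,
    [/\ is_tree e,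
        forall a : A, degree e a <> 2,
        forall a b c d : A, relD a b c d <->
          ~ (exists v : A, on_path e a b v /\ on_path e c d v) &
        forall a : A, exists p : set_type P,
          [/\ relK p a, forall q : set_type P, relK q a -> q = p &
              le_bound (degree e a) (val p)]].

(* Main.v *)
(* Fix a root of a tree outside its vertices, name the directions at a vertex of
   finite label p other than the one to the root by 0, ..., p - 2, and order them
   linearly at a vertex of label omega. Vertices then become words over the
   naturals (the sequence of directions which leads to them), the tree order is
   the prefix order and meets are longest common prefixes. The expansion records
   for each pair of vertices the label of their meet and their directions there.
   The universal objects are the homogeneous trees, in which the label of a vertex
   depends on its level only and all directions are present.

   Ramsey property: a copy of a pattern in a homogeneous tree is a choice of its
   root, of directions at the root, and of copies of smaller patterns in these
   directions. By induction on the size of the pattern, the product Ramsey theorem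
   in each cone, applied from the root upwards, makes a colouring depend on the
   root of the copy only (with Ramsey's theorem for the directions at a vertex of
   label omega); a pigeonhole argument for vertices concludes. Amalgamation follows
   from joint embedding and the Ramsey property.

   Reasonability: an extension of an expanded tree is rooted compatibly, if
   necessary inside an edge, and the directions are completed injectively.
   Expansion property: in a homogeneous tree some cone is disjoint from the root of
   any given expansion, and permuting the children of each of its vertices makes
   the expansion of this cone standard. *)

Require Import Defs.
From mathcomp Require Import all_boot.
From mathcomp Require Import boolp classical_sets functions cardinality.
From mathcomp Require Import zify.

Set Implicit Arguments.
Unset Strict Implicit.
Unset Printing Implicit Defensive.

(** With [p - 1] names for the directions at a vertex of label [p], one edge is reserved for the way
    to the root; a root on a vertex would leave [p] directions there and spoil homogeneity. Hence
    the root is virtual, and the difficulty of reasonability is to find an edge that can hold it. At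
    label omega names would break the expansion property: the directions of a finite tree can be
    renamed so as to avoid any given name. Only their order is kept, with a finite cut-off [N] for
    their number.

    Binary types do not determine a pattern: for three leaves they may leave open which two meet
    highest. The missing ternary information sits in [D]. Members of the class contain medians, and
    [D] with equal last arguments is the negation of betweenness, so every embedding sends medians
    to medians, and these show how the three meets compare. This is why copies of patterns account
    for all embeddings.

    That labels are at least 3 enters as the existence of two directions at every vertex: it
    excludes degree 2, gives the virtual root its two sides, and leaves a cone which the root of a
    given expansion misses. *)

Notation word := (seq nat).

(** * Words under the prefix order: meets, betweenness, medians *)

Fixpoint lcp (x y : word) : word :=
  match x, y with
  | i :: x', j :: y' => if i == j then i :: lcp x' y' else [::]
  | _, _ => [::]
  end.

Lemma lcpC x y : lcp x y = lcp y x.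
Proof.
elim: x y => [|i x IH] [|j y] //=; rewrite eq_sym; case: eqP => // ->.
by rewrite IH.
Qed.

Lemma lcpxx x : lcp x x = x.
Proof. by elim: x => //= i x ->; rewrite eqxx. Qed.

Lemma lcps0 x : lcp x [::] = [::]. Proof. by case: x. Qed.

Lemma prefix_lcp z x y : prefix z (lcp x y) = prefix z x && prefix z y.
Proof.
elim: z x y => [|k z IH] x y; first by rewrite !prefix0s.
case: x y => [|i x] [|j y] //=; rewrite ?andbF //.
case: (eqVneq i j) => [<-|nij] /=; first by rewrite IH; case: eqP.
by case: eqP => //= ->; rewrite (negbTE nij) andbF.
Qed.

Lemma lcp_prefixl x y : prefix (lcp x y) x.
Proof. by have := prefix_refl (lcp x y); rewrite prefix_lcp => /andP[]. Qed.

Lemma lcp_prefixr x y : prefix (lcp x y) y.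
Proof. by have := prefix_refl (lcp x y); rewrite prefix_lcp => /andP[]. Qed.

Lemma prefix_anti (x y : word) : prefix x y -> prefix y x -> x = y.
Proof.
move=> /prefixP[u ->] /size_prefix; rewrite size_cat -{2}[size x]addn0 leq_add2l.
by rewrite leqn0 => /nilP ->; rewrite cats0.
Qed.

Lemma lcp_idPl (x y : word) : prefix x y -> lcp x y = x.
Proof.
by move=> xy; apply: prefix_anti; [apply: lcp_prefixl|rewrite prefix_lcp prefix_refl].
Qed.

Lemma lcp_idPr (x y : word) : prefix x y -> lcp y x = x.
Proof. by rewrite lcpC; apply: lcp_idPl. Qed.

Lemma prefix_take_size (x y : word) : prefix x y -> take (size x) y = x.
Proof. by rewrite prefixE => /eqP. Qed.

Lemma prefix_comparable (u v x : word) :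
  prefix u x -> prefix v x -> size u <= size v -> prefix u v.
Proof.
move=> /prefix_take_size ux /prefix_take_size vx h.
by rewrite prefixE -vx take_takel // ux.
Qed.

Lemma prefix_total (u v x : word) : prefix u x -> prefix v x -> prefix u v \/ prefix v u.
Proof.
move=> hu hv; case/orP: (leq_total (size u) (size v)) => h; [left|right];
by apply: prefix_comparable h; eassumption.
Qed.

Lemma lcp_cat z x y : lcp (z ++ x) (z ++ y) = z ++ lcp x y.
Proof. by elim: z => //= i z ->; rewrite eqxx. Qed.

Lemma prefix_rcons_nth (x y : word) :
  prefix x y -> x != y -> prefix (rcons x (nth 0 y (size x))) y.
Proof.
case/prefixP=> -[|i u ->]; first by rewrite cats0 => ->; rewrite eqxx.
by move=> _; rewrite nth_cat ltnn subnn /= -cat_rcons prefix_prefix.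
Qed.

Lemma prefix_decomp (x y : word) :
  prefix x y -> x != y -> y = x ++ nth 0 y (size x) :: drop (size x).+1 y.
Proof.
case/prefixP=> -[|i u ->]; first by rewrite cats0 => ->; rewrite eqxx.
move=> _; rewrite nth_cat ltnn subnn /=; congr (_ ++ _ :: _).
by rewrite drop_cat ltnNge leqW //= subSnn /= drop0.
Qed.

Lemma prefix_rconsE (x y : word) i :
  prefix (rcons x i) y = [&& prefix x y, x != y & nth 0 y (size x) == i].
Proof.
apply/idP/and3P => [/prefixP[u ->]|[xy nxy /eqP <-]].
  rewrite cat_rcons prefix_prefix nth_cat ltnn subnn eqxx; split=> //.
  by apply/eqP=> /(congr1 size); rewrite size_cat /=; lia.
exact: prefix_rcons_nth.
Qed.

Lemma prefix_lcp_rcons (z x y : word) i j :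
  prefix (rcons z i) x -> prefix (rcons z j) y -> i != j -> lcp x y = z.
Proof.
move=> /prefixP[u ->] /prefixP[v ->] /negbTE nij.
by rewrite !cat_rcons lcp_cat /= nij cats0.
Qed.

Lemma lcp_eqE (z x y : word) : prefix z x -> z != x -> prefix z y -> z != y ->
  (lcp x y == z) = (nth 0 x (size z) != nth 0 y (size z)).
Proof.
move=> zx nx zy ny.
rewrite (prefix_decomp zx nx) (prefix_decomp zy ny).
move: (nth 0 x _) (nth 0 y _) (drop _ x) (drop _ y) => i j u v.
rewrite lcp_cat !nth_cat ltnn subnn /=.
case: (eqVneq i j) => [_|_] /=; last by rewrite cats0 eqxx.
by apply/negbTE/eqP => /(congr1 size); rewrite size_cat /=; lia.
Qed.

Definition par (u : word) : word := take (size u).-1 u.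

Lemma par_rcons u i : par (rcons u i) = u.
Proof. by rewrite /par size_rcons /= -cats1 take_size_cat. Qed.

Lemma size_par u : size (par u) = (size u).-1.
Proof. by rewrite size_take_min; lia. Qed.

Lemma rcons_par u : u != [::] -> u = rcons (par u) (last 0 u).
Proof. by case: (lastP u) => // v i _; rewrite par_rcons last_rcons. Qed.

Lemma prefix_par u : prefix (par u) u.
Proof. exact: prefix_take. Qed.

(** The path from [x] to [y] descends to their meet and climbs again; [z] is one of its vertices. *)
Definition betw (x z y : word) : bool :=
  prefix (lcp x y) z && (prefix z x || prefix z y).

Lemma betwC x z y : betw x z y = betw y z x.
Proof. by rewrite /betw lcpC orbC. Qed.

(** Two of the three pairwise meets coincide and the third is at least as long; the median is the
    longest. *)
Definition med (x y z : word) : word :=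
  if prefix (lcp x y) z then (if prefix (lcp y z) x then lcp x z else lcp y z)
  else lcp x y.

Definition separated (x y z w : word) : bool :=
  ~~ (betw z (lcp x y) w || betw x (lcp z w) y).

Lemma separated_cc x y z : separated x y z z = ~~ betw x z y.
Proof.
rewrite /separated lcpxx; congr (~~ _); rewrite orbC.
case: (boolP (betw x z y)) => //= nb.
apply/negbTE/negP; rewrite /betw lcpxx orbb => /andP[h1 h2].
by move/negP: nb; apply; rewrite /betw h2 (prefix_trans h1 (lcp_prefixl _ _)).
Qed.

(** Both meets are prefixes of any common vertex, hence comparable, and the longer one lies on the
    other path. So testing the two meets detects every intersection. *)
Lemma separatedP x y z w :
  reflect (exists v, betw x v y /\ betw z v w) (~~ separated x y z w).
Proof.
rewrite negbK; apply/(iffP orP) => [[h|h]|[v [/andP[h1 h2] /andP[h3 h4]]]].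
- by exists (lcp x y); rewrite h /betw prefix_refl lcp_prefixl.
- by exists (lcp z w); rewrite h /betw prefix_refl lcp_prefixl.
have [h|h] := prefix_total h1 h3.
- right; rewrite /betw h /=.
  by case/orP: h2 => h2; rewrite (prefix_trans h3 h2) ?orbT.
- left; rewrite /betw h /=.
  by case/orP: h4 => h4; rewrite (prefix_trans h1 h4) ?orbT.
Qed.

(** * Homogeneous trees *)

Notation levels := (seq (option nat)).

(* One of the [p] directions at a vertex of label [p] leads to the root. *)
Definition width (N : nat) (q : option nat) : nat :=
  if q is Some p then p.-1 else N.

(** The homogeneous tree with level labels [s]. The cut-off [N] for label omega keeps it finite. *)
Fixpoint node (N : nat) (s : levels) (w : word) : bool :=
  match s, w with
  | [::], _ => false
  | _ :: _, [::] => true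
  | q :: s', i :: w' => (i < width N q) && node N s' w'
  end.

Definition lab (s : levels) (w : word) : option nat := nth None s (size w).

(** Only a comparison survives at label omega. Strictly increasing renamings then go unnoticed, as
    Ramsey's theorem requires, and finitely many codes remain, as precompactness requires. *)
Definition rank_code (b a : option nat) : option nat :=
  omap (fun i => if b is Some j then (j < i : nat) else 0) a.

Definition norm (q a b : option nat) : option nat * option nat * option nat :=
  if q is Some _ then (q, a, b) else (q, rank_code b a, rank_code a b).

(* The label of the meet of [x] and [y], and the directions of [x] and [y] there
   ([None] for the meet itself), which are only compared when the label is
   omega. *)
Definition tp2 (s : levels) (x y : word) : option nat * option nat * option nat :=
  let m := lcp x y in norm (lab s m) (onth x (size m)) (onth y (size m)).

(** Meets are preserved as vertices, which equality of binary types does not ensure at label omega;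
    betweenness and [separated] are then preserved too. *)
Record emb (s : levels) (N : nat) (s' : levels) (N' : nat) (h : word -> word) :
    Prop := Emb {
  emb_node : forall x, node N s x -> node N' s' (h x);
  emb_lcp : forall x y, node N s x -> node N s y -> h (lcp x y) = lcp (h x) (h y);
  emb_tp2 : forall x y, node N s x -> node N s y ->
    tp2 s' (h x) (h y) = tp2 s x y }.

Lemma norm1 q a b : (norm q a b).1.1 = q. Proof. by case: q. Qed.

Lemma norm2 q a b : ((norm q a b).1.2 == None) = (a == None).
Proof. by case: q a => [q|] [a|]. Qed.

Lemma onth_lcpl x y : (onth x (size (lcp x y)) == None) = prefix x y.
Proof.
have -> : (onth x (size (lcp x y)) == None) = ~~ onth x (size (lcp x y)) by case: onth.
rewrite onthNE; apply/idP/idP => [|/lcp_idPl -> //].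
move=> h; have /prefix_take_size := lcp_prefixl x y.
by rewrite take_oversize // => ->; apply: lcp_prefixr.
Qed.

(** [x] has no direction at the meet precisely when it is the meet, so a binary type determines the
    prefix order of its pair. *)
Lemma tp2_prefix s x y : ((tp2 s x y).1.2 == None) = prefix x y.
Proof. by rewrite norm2 onth_lcpl. Qed.

Lemma tp2_lab s x y : (tp2 s x y).1.1 = lab s (lcp x y).
Proof. exact: norm1. Qed.

Lemma tp2_eq_prefix s s' x y x' y' :
  tp2 s x y = tp2 s' x' y' -> prefix x y = prefix x' y'.
Proof. by move=> h; rewrite -(tp2_prefix s) h tp2_prefix. Qed.

Lemma tp2_eq_lab s s' x y x' y' :
  tp2 s x y = tp2 s' x' y' -> lab s (lcp x y) = lab s' (lcp x' y').
Proof. by move=> h; rewrite -!tp2_lab h. Qed.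

Lemma onth_rcons_prefix (z x : word) i : prefix (rcons z i) x -> onth x (size z) = Some i.
Proof.
by case/prefixP=> u ->; rewrite cat_rcons onth_cat ltnn subnn.
Qed.

Lemma tp2_rcons s z x y i j : prefix (rcons z i) x -> prefix (rcons z j) y -> i != j ->
  tp2 s x y = norm (lab s z) (Some i) (Some j).
Proof.
move=> zx zy nij; rewrite /tp2 (prefix_lcp_rcons zx zy nij).
by rewrite (onth_rcons_prefix zx) (onth_rcons_prefix zy).
Qed.

Lemma tp2_rcons_l s z y j : prefix (rcons z j) y ->
  tp2 s z y = norm (lab s z) None (Some j).
Proof.
move=> zy; have pz := prefix_trans (prefix_rcons z j) zy.
by rewrite /tp2 (lcp_idPl pz) onth_default // (onth_rcons_prefix zy).
Qed.

Lemma tp2_rcons_r s z y j : prefix (rcons z j) y ->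
  tp2 s y z = norm (lab s z) (Some j) None.
Proof.
move=> zy; have pz := prefix_trans (prefix_rcons z j) zy.
by rewrite /tp2 (lcp_idPr pz) (onth_rcons_prefix zy) [onth z _]onth_default.
Qed.

Lemma tp2_xx s x : tp2 s x x = norm (lab s x) None None.
Proof. by rewrite /tp2 lcpxx onth_default. Qed.

Lemma tp2_cons q s i x y : tp2 (q :: s) (i :: x) (i :: y) = tp2 s x y.
Proof. by rewrite /tp2 /= eqxx /=. Qed.

Lemma tp2_cat s z x y : tp2 s (z ++ x) (z ++ y) = tp2 (drop (size z) s) x y.
Proof.
rewrite /tp2 lcp_cat /lab size_cat nth_drop !onth_cat !ltnNge !leq_addr /=.
by rewrite addKn.
Qed.

Lemma node_prefix N s u w : prefix u w -> node N s w -> node N s u.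
Proof.
elim: s u w => [|q s IH] [|j u] [|i w] //= /andP[/eqP -> uw] /andP[-> ].
exact: IH.
Qed.

Lemma node_lcp N s x y : node N s x -> node N s (lcp x y).
Proof. exact/node_prefix/lcp_prefixl. Qed.

Lemma node_cat N s z x : node N s (z ++ x) -> node N (drop (size z) s) x.
Proof.
elim: z s => [|i z IH] [|q s] //= /andP[_]; exact: IH.
Qed.

Lemma node_nth N s z x : node N s x -> prefix z x -> z != x ->
  nth 0 x (size z) < width N (lab s z).
Proof.
elim: z s x => [|i z IH] [|q s] [|j x] //= /andP[lj nx].
  by rewrite /lab.
by rewrite eqseq_cons => /andP[/eqP -> zx]; rewrite eqxx /=; apply: IH.
Qed.

Lemma node_size N s x : node N s x -> size x < size s.
Proof. by elim: s x => [|q s IH] [|j x] //= /andP[_ /IH]. Qed.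

Lemma emb_prefix s N s' N' h x y : emb s N s' N' h -> node N s x -> node N s y ->
  prefix (h x) (h y) = prefix x y.
Proof. by move=> H nx ny; apply: tp2_eq_prefix (emb_tp2 H nx ny). Qed.

Lemma emb_inj s N s' N' h x y : emb s N s' N' h -> node N s x -> node N s y ->
  h x = h y -> x = y.
Proof.
move=> H nx ny e; apply: prefix_anti.
  by rewrite -(emb_prefix H nx ny) e prefix_refl.
by rewrite -(emb_prefix H ny nx) e prefix_refl.
Qed.

Lemma emb_lab s N s' N' h x : emb s N s' N' h -> node N s x -> lab s' (h x) = lab s x.
Proof. by move=> H nx; have := tp2_eq_lab (emb_tp2 H nx nx); rewrite !lcpxx. Qed.

Lemma emb_betw s N s' N' h x z y : emb s N s' N' h ->
  node N s x -> node N s z -> node N s y -> betw (h x) (h z) (h y) = betw x z y.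
Proof.
move=> H nx nz ny; rewrite /betw -(emb_lcp H) // !(emb_prefix H) //.
exact: node_lcp.
Qed.

Lemma emb_separated s N s' N' h x y z w : emb s N s' N' h ->
  node N s x -> node N s y -> node N s z -> node N s w ->
  separated (h x) (h y) (h z) (h w) = separated x y z w.
Proof.
move=> H nx ny nz nw; rewrite /separated -!(emb_lcp H) // !(emb_betw H) //;
exact: node_lcp.
Qed.

Lemma emb_id s N : emb s N s N id. Proof. by split. Qed.

Lemma emb_trans s N s1 N1 s2 N2 g h :
  emb s1 N1 s2 N2 g -> emb s N s1 N1 h -> emb s N s2 N2 (g \o h).
Proof.
move=> G H; split=> [x nx|x y nx ny|x y nx ny] /=.
- exact/(emb_node G)/(emb_node H).
- by rewrite (emb_lcp H) // (emb_lcp G) //; apply: (emb_node H).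
- by rewrite (emb_tp2 G) ?(emb_tp2 H) //; apply: (emb_node H).
Qed.

Lemma emb_ext s N s' N' g h : (forall x, node N s x -> g x = h x) ->
  emb s N s' N' g -> emb s N s' N' h.
Proof.
move=> gh G; split=> [x nx|x y nx ny|x y nx ny].
- by rewrite -gh //; apply: (emb_node G).
- by rewrite -!gh ?(emb_lcp G) //; apply: node_lcp.
- by rewrite -!gh ?(emb_tp2 G).
Qed.

Lemma emb_cons N q s i : i < width N q -> emb s N (q :: s) N (cons i).
Proof.
move=> li; split=> [x nx|x y nx ny|x y nx ny] /=; first by rewrite li.
  by rewrite eqxx.
exact: tp2_cons.
Qed.

Lemma width_le N N' q : N <= N' -> width N q <= width N' q.
Proof. by case: q. Qed.

Lemma node_widen N N' s x : N <= N' -> node N s x -> node N' s x.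
Proof.
move=> le; elim: s x => [|q s IH] [|i x] //= /andP[li /IH ->].
by rewrite (leq_trans li) // width_le.
Qed.

Lemma emb_widen N N' s : N <= N' -> emb s N s N' id.
Proof. by move=> le; split=> // x; apply: node_widen. Qed.

Lemma emb_catr N s s' : emb s N (s ++ s') N id.
Proof.
split=> // [x|x y nx ny].
  by elim: s x => [|q s IH] [|i x] //= /andP[-> /IH].
congr norm; rewrite /lab nth_cat; case: ltnP => // h.
by have := node_size (node_lcp y nx); lia.
Qed.

Lemma emb_pad N s1 s : {in s1, forall q, 0 < width N q} ->
  emb s N (s1 ++ s) N (cat (nseq (size s1) 0)).
Proof.
elim: s1 => [|q s1 IH] h /=; first exact: emb_id.
apply: (@emb_trans _ _ (s1 ++ s) N _ _ (cons 0)).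
  by apply: emb_cons; apply: h; rewrite mem_head.
by apply: IH => r hr; apply: h; rewrite in_cons hr orbT.
Qed.

(* The cone in direction [i] above a node [v] of [s1] receives any tree
   grafted above the last level of [s1]. *)
Lemma emb_graft N s1 s v i : {in s1, forall q, 0 < width N q} ->
  node N s1 v -> i < width N (lab s1 v) ->
  emb s N (s1 ++ s) N
    (fun x => v ++ i :: nseq (size s1 - (size v).+1) 0 ++ x).
Proof.
elim: s1 v => [|q s1 IH] [|j v] //= h.
  rewrite /lab /= subSS subn0 => _ li.
  apply: (@emb_trans _ _ (s1 ++ s) N _ _ (cons i)); first exact: emb_cons.
  by apply: emb_pad => r hr; apply: h; rewrite in_cons hr orbT.
move=> /andP[lj nv] li; rewrite subSS.
apply: (@emb_trans _ _ (s1 ++ s) N _ _ (cons j)); first exact: emb_cons.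
by apply: IH => // r hr; apply: h; rewrite in_cons hr orbT.
Qed.

(** The renamings of directions invisible to [norm]: the identity where directions are recorded,
    increasing maps where they are compared. *)
Definition dir_emb (q : option nat) (w : nat) (k : nat -> nat) : Prop :=
  if q is Some _ then forall i, i < w -> k i = i
  else forall i j, i < j < w -> k i < k j.

Lemma dir_emb_id q w : dir_emb q w id.
Proof. by case: q => //= i j /andP[]. Qed.

Lemma dir_emb_inj q w k i j : dir_emb q w k -> i < w -> j < w -> (k i == k j) = (i == j).
Proof.
case: q => [q|] /= H li lj; first by rewrite !H.
case: (ltngtP i j) => [h|h|->]; last by rewrite eqxx.
  by have := H i j; rewrite h lj => /(_ isT); lia.
by have := H j i; rewrite h li => /(_ isT); lia.
Qed.

Lemma norm_dir_emb q w k i j : dir_emb q w k -> i < w -> j < w ->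
  norm q (Some (k i)) (Some (k j)) = norm q (Some i) (Some j).
Proof.
case: q => [q|] /= H li lj; first by rewrite !H.
have e a b : a < w -> b < w -> (k a < k b) = (a < b).
  move=> la lb; case: (ltngtP a b) => [h|h|->]; last by rewrite ltnn.
    by apply: H; rewrite h.
  by have := H b a; rewrite h la => /(_ isT); lia.
by rewrite /rank_code /= !e.
Qed.

Lemma norm_dir_embl q w k i : dir_emb q w k -> i < w ->
  norm q (Some (k i)) None = norm q (Some i) None.
Proof. by case: q => [q|] //= H li; rewrite H. Qed.

Lemma norm_dir_embr q w k i : dir_emb q w k -> i < w ->
  norm q None (Some (k i)) = norm q None (Some i).
Proof. by case: q => [q|] //= H li; rewrite H. Qed.

(** The gluing principle for embeddings built by induction on levels: a place for the root, and each
    cone embedded into the cone in the renamed direction. Words of different cones meet at the root,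
    where [dir_emb] controls their type. *)
Lemma emb_root N q s N' s' h k :
  node N' s' (h [::]) -> lab s' (h [::]) = q -> dir_emb q (width N q) k ->
  (forall i, i < width N q -> emb s N s' N' (fun x => h (i :: x))) ->
  (forall i x, i < width N q -> node N s x ->
    prefix (rcons (h [::]) (k i)) (h (i :: x))) ->
  emb (q :: s) N s' N' h.
Proof.
move=> nz lz Hk Hi Hp.
have pre i x : i < width N q -> node N s x -> prefix (h [::]) (h (i :: x)).
  by move=> li nx; apply: prefix_trans (Hp _ _ li nx); apply: prefix_rcons.
split=> [[|i x] //|[|i x] [|j y]|[|i x] [|j y]] /=.
- by move=> /andP[li nx]; apply: (emb_node (Hi i li)).
- by rewrite lcpxx.
- by move=> _ /andP[lj ny]; rewrite lcp_idPl ?pre.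
- by move=> /andP[li nx] _; rewrite lcp_idPr ?pre.
- case: eqP => [<-|/eqP nij] /andP[li nx] /andP[lj ny].
    exact: (emb_lcp (Hi i li)).
  rewrite (prefix_lcp_rcons (Hp _ _ li nx) (Hp _ _ lj ny)) //.
  by rewrite (dir_emb_inj Hk).
- by rewrite !tp2_xx lz.
- move=> _ /andP[lj ny]; rewrite (tp2_rcons_l _ (Hp _ _ lj ny)) lz.
  rewrite (@tp2_rcons_l _ [::] _ j) /= ?eqxx ?prefix0s //.
  exact: norm_dir_embr Hk _.
- move=> /andP[li nx] _; rewrite (tp2_rcons_r _ (Hp _ _ li nx)) lz.
  rewrite (@tp2_rcons_r _ [::] _ i) /= ?eqxx ?prefix0s //.
  exact: norm_dir_embl Hk _.
- move=> /andP[li nx] /andP[lj ny]; case: (eqVneq i j) => [<-|nij].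
    by rewrite (emb_tp2 (Hi i li)) // tp2_cons.
  rewrite (tp2_rcons _ (Hp _ _ li nx) (Hp _ _ lj ny)) ?(dir_emb_inj Hk) //.
  rewrite lz (@tp2_rcons _ [::] _ _ i j) /= ?eqxx ?prefix0s //.
  exact: norm_dir_emb Hk _ _.
Qed.

Fixpoint words (N : nat) (s : levels) : seq word :=
  if s is q :: s' then
    [::] :: [seq i :: w | i <- iota 0 (width N q), w <- words N s']
  else [::].

Lemma mem_words N s w : (w \in words N s) = node N s w.
Proof.
elim: s w => [|q s IH] [|i w] //=; rewrite inE /=.
apply/allpairsP/andP => [[[j u] /= [hj hu [-> ->]]]|[hi hw]].
  by move: hj hu; rewrite mem_iota IH.
by exists (i, w); rewrite mem_iota IH.
Qed.

(** * Ramsey's theorem *)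

Definition incr (m : nat) (k : nat -> nat) : Prop := forall i j, i < j < m -> k i < k j.

Definition subset_code (k m : nat) (t : seq nat) : bool :=
  [&& sorted ltn t, size t == k & all (fun i => i < m) t].

Lemma incr_sorted m k t : incr m k -> all (fun i => i < m) t ->
  sorted ltn t -> sorted ltn [seq k i | i <- t].
Proof.
move=> Hk; case: t => // x t /=; elim: t x => //= y t IH x /and3P[lx ly lt] /andP[xy st].
by rewrite Hk ?xy //= IH //= ly.
Qed.

Lemma subset_code_map k m M f t : incr m f -> (forall i, i < m -> f i < M) ->
  subset_code k m t -> subset_code k M [seq f i | i <- t].
Proof.
move=> Hf lf /and3P[st /eqP zt at_]; apply/and3P; split.
- exact: incr_sorted Hf at_ st.
- by rewrite size_map zt.
- by rewrite all_map; apply: sub_all at_ => i /= /lf.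
Qed.

Lemma incr_comp m M f g : incr m f -> (forall i, i < m -> f i < M) -> incr M g ->
  incr m (g \o f).
Proof.
by move=> Hf lf Hg i j /andP[ij jm] /=; apply: Hg; rewrite lf // Hf // ij.
Qed.

Lemma pigeonhole (K : finType) (m : nat) (eta : nat -> K) :
  exists c k, [/\ incr m k, forall i, i < m -> k i < #|K| * m &
    forall i, i < m -> eta (k i) = c].
Proof.
case: m => [|m].
  by exists (eta 0), id; split=> [i j /andP[]|i|i].
pose L c := [seq i <- iota 0 (#|K| * m.+1) | eta i == c].
have [c hc] : exists c, m.+1 <= size (L c).
  apply: contrapT => nh.
  have h c : ~~ (m.+1 <= size (L c)) by apply/negP => hc; apply: nh; exists c.
  have : \sum_c size (L c) <= #|K| * m.
    rewrite -sum_nat_const; apply: leq_sum => c _.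
    by have := h c; rewrite -ltnNge ltnS.
  have -> : \sum_c size (L c) = #|K| * m.+1.
    rewrite -[RHS](size_iota 0) /L; elim: (iota _ _) => [|x l IH] /=.
      by rewrite big1.
    rewrite -IH (eq_bigr (fun c => (eta x == c) + size [seq i <- l | eta i == c])).
      by rewrite big_split /= -[in RHS]add1n; congr (_ + _);
         rewrite (bigD1 (eta x)) //= eqxx big1 // => c; rewrite eq_sym => /negbTE ->.
    by move=> c _; case: (eta x == c).
  have : 0 < #|K| by apply/card_gt0P; exists (eta 0).
  by rewrite mulnS; lia.
have mem i : i < m.+1 -> nth 0 (L c) i \in L c by move=> li; apply/mem_nth/(leq_trans li).
exists c, (nth 0 (L c)); split=> [i j /andP[ij jm]|i /mem|i /mem].
- have := @sorted_ltn_nth _ ltn ltn_trans 0 (L c).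
  apply; rewrite ?inE ?(leq_trans jm) //; last exact: (leq_trans (ltn_trans ij jm)).
  apply: sorted_filter; [exact: ltn_trans|exact: iota_ltn_sorted].
- by rewrite mem_filter mem_iota => /andP[_ /andP[]].
- by rewrite mem_filter => /andP[/eqP].
Qed.

(** Induction on [k]. The inner claim finds end-homogeneous sets, on which the colour of a
    [k.+1]-set depends on its least element only; a pigeonhole on least elements finishes. *)
Lemma finite_ramsey (K : finType) (k m : nat) :
  exists2 M, m <= M & forall chi : seq nat -> K, exists f c,
    [/\ incr m f, forall i, i < m -> f i < M &
      forall t, subset_code k m t -> chi [seq f i | i <- t] = c].
Proof.
elim: k m => [|k IHk] m.
  exists m => // chi; exists id, (chi [::]); split=> // [i j /andP[]//|t].
  by case/and3P=> _ /nilP -> _.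
have end_hom m' : exists2 M, m' <= M & forall chi : seq nat -> K, exists f eta,
    [/\ incr m' f, forall i, i < m' -> f i < M &
      forall i t, subset_code k.+1 m' (i :: t) ->
        chi [seq f i | i <- i :: t] = eta i].
  elim: m' => [|m' [M1 le1 IH]].
    exists 0 => // chi; exists id, (fun _ => chi [::]); split=> [i j /andP[]|i|i t] //.
    by case/and3P=> _ _ /andP[].
  have [M2 le2 H2] := IHk M1.
  (* The point [0] becomes the least element: the theorem for [k] makes all sets with least element
     [0] alike on [M1] further points, inside which the construction continues. *)
  exists M2.+1; first by rewrite ltnS (leq_trans le1).
  move=> chi; pose chi1 t := chi (0 :: [seq i.+1 | i <- t]).
  have [f2 [c [inc2 lt2 hc]]] := H2 chi1.
  pose chi2 t := chi [seq (f2 i).+1 | i <- t].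
  have [f1 [eta [inc1 lt1 heta]]] := IH chi2.
  have inc12 := incr_comp inc1 lt1 inc2.
  exists (fun i => if i is i'.+1 then (f2 (f1 i')).+1 else 0).
  exists (fun i => if i is i'.+1 then eta i' else c).
  split=> [[|i] [|j] //|[|i] //|[|i] t]; rewrite ?ltnS.
  - exact: inc12.
  - by move=> li; apply/lt2/lt1.
  - case/and3P=> st /= zt /= lt.
    have e : t = [seq i.+1 | i <- [seq i.-1 | i <- t]].
      rewrite -map_comp -[LHS]map_id; apply/eq_in_map => i hi /=.
      by move/(order_path_min ltn_trans)/allP/(_ _ hi): st; case: i {hi}.
    have st' : subset_code k m' [seq i.-1 | i <- t].
      apply/and3P; split; last 1 first.
      - rewrite all_map; apply/allP => i hi /=.
        have /allP/(_ _ hi) := lt.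
        by move/(order_path_min ltn_trans)/allP/(_ _ hi): st; case: i {hi}.
      - move/path_sorted: (st); rewrite e; move: [seq i.-1 | i <- t] => u.
        by rewrite (mono_sorted (e := ltn)) // -map_comp map_id.
      - by rewrite size_map.
    rewrite e -!map_comp.
    have := hc _ (subset_code_map inc1 lt1 st').
    by rewrite /chi1 -!map_comp.
  - case/and3P=> st /= zt /andP[li lt].
    have e : t = [seq i.+1 | i <- [seq i.-1 | i <- t]].
      rewrite -map_comp -[LHS]map_id; apply/eq_in_map => j hj /=.
      by move/(order_path_min ltn_trans)/allP/(_ _ hj): st; case: j {hj}.
    have st' : subset_code k.+1 m' (i :: [seq i.-1 | i <- t]).
      apply/and3P; split=> /=; last 1 first.
      - rewrite -ltnS li all_map; apply/allP => j hj /=.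
        have /allP/(_ _ hj) := lt.
        by move/(order_path_min ltn_trans)/allP/(_ _ hj): st; case: j {hj}.
      - move: (st); rewrite e; move: [seq i.-1 | i <- t] => u.
        rewrite -map_comp map_id => h.
        have : sorted ltn [seq j.+1 | j <- i :: u] by [].
        by rewrite (mono_sorted (e := ltn)).
      - by rewrite size_map.
    have := heta _ _ st'.
    rewrite /chi2 e /= -!map_comp => <-; congr chi; congr (_ :: _).
have [M leM H] := end_hom (#|K| * m).
(* The maximum secures the bound by [m] also when [K] is empty. *)
exists (maxn m M); first exact: leq_maxl.
move=> chi; have [f [eta [incf ltf heta]]] := H chi.
have [c [g [incg ltg hc]]] := pigeonhole m eta.
exists (f \o g), c; split.
- exact: incr_comp incf.
- by move=> i li /=; rewrite leq_max orbC ltf ?ltg.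
- case=> [|i t] ht; first by case/and3P: ht.
  have := heta (g i) [seq g j | j <- t] (subset_code_map incg ltg ht).
  rewrite hc; last by case/and3P: ht => _ _ /andP[].
  by rewrite /= -map_comp.
Qed.

(** * The Ramsey property of homogeneous trees *)

Section TreeRamsey.
Variables (Q : option nat -> Prop) (hQ : forall q, Q q -> le_bound 3 q).

Definition good (s : levels) : Prop := forall q, q \in s -> Q q.

Lemma good_cat s s' : good s -> good s' -> good (s ++ s').
Proof. by move=> h h' q; rewrite mem_cat => /orP[/h|/h']. Qed.

Lemma good_cons q s : Q q -> good s -> good (q :: s).
Proof. by move=> hq h r; rewrite inE => /orP[/eqP ->|/h]. Qed.

Lemma good_head q s : good (q :: s) -> Q q.
Proof. by apply; rewrite mem_head. Qed.

Lemma good_behead q s : good (q :: s) -> good s.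
Proof. by move=> h r hr; apply: h; rewrite inE hr orbT. Qed.

Lemma good_width N s q : 1 < N -> good s -> q \in s -> 1 < width N q.
Proof. by move=> lN h /h /hQ; case: q => //= -[|[|[]]]. Qed.

Lemma good_width0 N s : 1 < N -> good s -> {in s, forall q, 0 < width N q}.
Proof. by move=> lN h q /(good_width lN h) /ltnW. Qed.

(** Induction on the list [L] of colours in use: a tree [s1] that settles [L] serves as the
    alternative when [c] is added. *)
Lemma vertex_ramsey (K : finType) (s : levels) (N : nat) (p : option nat) :
  good s -> 1 < N ->
  exists2 s', good s' & forall chi : word -> K, exists h k,
    emb s N s' N h /\ forall v, node N s v -> lab s v = p -> chi (h v) = k.
Proof.
move=> gs lN.
suff H : forall L : seq K, exists2 s', good s' & forall chi : word -> K,
    (forall v, node N s' v -> lab s' v = p -> chi v \in L) -> exists h k,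
    emb s N s' N h /\ forall v, node N s v -> lab s v = p -> chi (h v) = k.
  have [s' gs' Hs'] := H (enum K).
  by exists s' => // chi; apply: Hs' => v _ _; rewrite mem_enum.
elim=> [|c L [s1 gs1 IH]].
  exists s => // chi h; exists id, (chi [::]); split; first exact: emb_id.
  by move=> v nv lv; have := h v nv lv.
(* Either the whole of [s] fits with every [p]-node coloured [c], or a copy of
   [s1] avoids the colour [c]. *)
have : exists2 s', good s' & forall chi : word -> K,
    (exists2 h, emb s N s' N h &
       forall v, node N s v -> lab s v = p -> chi (h v) = c) \/
    (exists2 h, emb s1 N s' N h &
       forall v, node N s1 v -> lab s1 v = p -> chi (h v) != c).
  elim: s gs {IH} => [|q s IHs] gs.
    by exists [::] => // chi; left; exists id => //; apply: emb_id.
  have [s2 gs2 H2] := IHs (good_behead gs).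
  have [eqp|nqp] := eqVneq q p.
    (* A [p]-vertex of colour [c] in the bottom part [s1] becomes the root of the copy of [s]; if
       there is none, [s1] avoids [c]. Each cone above it receives [s2], to which the dichotomy for
       the remaining levels applies. *)
    exists (s1 ++ s2); first exact: good_cat.
    move=> chi; case: (pselect (forall v, node N s1 v -> lab s1 v = p -> chi v != c)).
      by move=> h; right; exists id => //; apply: emb_catr.
    move=> /existsNP[v /not_implyP[nv /not_implyP[lv]]].
    move=> /negP/negPn/eqP chiv.
    pose e i x := v ++ i :: nseq (size s1 - (size v).+1) 0 ++ x.
    have He i : i < width N q -> emb s2 N (s1 ++ s2) N (e i).
      move=> li; apply: emb_graft => //; first exact: good_width0.
      by rewrite lv -eqp.
    have [[i li [h Hh hc]]|hl] := pselect (exists2 i, i < width N q &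
        (exists2 h, emb s1 N s2 N h &
          forall v, node N s1 v -> lab s1 v = p -> chi (e i (h v)) != c)).
      by right; exists (e i \o h) => //; apply: emb_trans (He i li) Hh.
    left.
    have /choice[h Hh] : forall i, exists h, i < width N q ->
        emb s N s2 N h /\ forall v, node N s v -> lab s v = p -> chi (e i (h v)) = c.
      move=> i; case: (ltnP i (width N q)) => li; last by exists id.
      have [[h Hh hc]|[h Hh hc]] := H2 (chi \o e i); first by exists h.
      by case: hl; exists i => //; exists h.
    exists (fun x => if x is i :: x' then e i (h i x') else v).
      apply: (@emb_root _ _ _ _ _ _ id) => [|||i li|i x li nx].
      - exact: (emb_node (emb_catr _ _ _)).
      - by rewrite eqp -lv; apply: (emb_lab (emb_catr _ _ _) nv).
      - exact: dir_emb_id.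
      - exact: emb_trans (He i li) (Hh i li).1.
      - by rewrite /e -cat_rcons prefix_prefix.
    by case=> [//|i x] /andP[li nx]; apply: (Hh i li).2.
  exists (q :: s2); first exact: good_cons (good_head gs) gs2.
  move=> chi.
  have [[i li [h Hh hc]]|hl] := pselect (exists2 i, i < width N q &
      (exists2 h, emb s1 N s2 N h &
        forall v, node N s1 v -> lab s1 v = p -> chi (i :: (h v)) != c)).
    by right; exists (cons i \o h) => //; apply: emb_trans (emb_cons _ li) Hh.
  left.
  have /choice[h Hh] : forall i, exists h, i < width N q ->
      emb s N s2 N h /\ forall v, node N s v -> lab s v = p -> chi (i :: (h v)) = c.
    move=> i; case: (ltnP i (width N q)) => li; last by exists id.
    have [[h Hh hc]|[h Hh hc]] := H2 (chi \o cons i); first by exists h.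
    by case: hl; exists i => //; exists h.
  exists (fun x => if x is i :: x' then i :: h i x' else [::]).
    apply: (@emb_root _ _ _ _ _ _ id) => [|||i li|i x li nx] //.
    - exact: dir_emb_id.
    - exact: emb_trans (emb_cons _ li) (Hh i li).1.
    - by rewrite /= eqxx prefix0s.
  case=> [_ qp|i x /andP[li nx]]; last exact: (Hh i li).2.
  by rewrite -[q]/(lab (q :: s) [::]) qp eqxx in nqp.
case=> s' gs' H; exists s' => // chi hL.
have [[h Hh hc]|[h Hh hc]] := H chi; first by exists h, c.
have [v nv lv|g [k [Hg hk]]] := IH (chi \o h).
  have := hL _ (emb_node Hh nv); rewrite (emb_lab Hh nv) => /(_ lv).
  by rewrite inE (negbTE (hc _ nv lv)).
by exists (h \o g), k; split=> //; apply: emb_trans Hg.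
Qed.

End TreeRamsey.

(** * Copies of a pattern in homogeneous trees *)

Section Copies.
Variables (Q : option nat -> Prop) (hQ : forall q, Q q -> le_bound 3 q).
Variables (A : finType) (sphi : levels) (phi : A -> word).

(** The last clause fixes the position of meets with respect to third elements, which binary types
    leave open. *)
Record cop (S : {set A}) (s : levels) (N : nat) (y : A -> word) : Prop := Cop {
  cop_node : forall a, a \in S -> node N s (y a);
  cop_tp2 : forall a b, a \in S -> b \in S ->
    tp2 s (y a) (y b) = tp2 sphi (phi a) (phi b);
  cop_prefix : forall a b c, a \in S -> b \in S -> c \in S ->
    prefix (lcp (y a) (y b)) (y c) = prefix (lcp (phi a) (phi b)) (phi c) }.

Lemma cop_ext (S : {set A}) s N y y' : {in S, y =1 y'} -> cop S s N y -> cop S s N y'.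
Proof.
move=> e H; split=> [a aS|a b aS bS|a b c aS bS cS]; rewrite -!e //.
- exact: cop_node H _ aS.
- exact: (cop_tp2 H).
- exact: (cop_prefix H).
Qed.

Lemma cop_emb (S : {set A}) s N s' N' h y :
  emb s N s' N' h -> cop S s N y -> cop S s' N' (h \o y).
Proof.
move=> E H; split=> [a aS|a b aS bS|a b c aS bS cS] /=.
- exact/(emb_node E)/(cop_node H).
- by rewrite (emb_tp2 E) ?(cop_tp2 H) //; apply: (cop_node H).
- rewrite -(emb_lcp E) ?(emb_prefix E) ?(cop_prefix H) //; try exact: (cop_node H).
  exact/node_lcp/(cop_node H).
Qed.

Definition depends_on (S : {set A}) (K : Type) (c : (A -> word) -> K) : Prop :=
  forall y y', {in S, y =1 y'} -> c y = c y'.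

(** The partition relation for copies of the pattern [S]. Besides the levels the cut-off may grow,
    since Ramsey's theorem at label omega uses up directions. *)
Definition arrow (S : {set A}) : Prop :=
  forall s N (K : finType), good Q s -> 1 < N ->
  exists s' N', [/\ good Q s', N <= N' &
    forall c : (A -> word) -> K, depends_on S c -> exists h k,
      emb s N s' N' h /\ forall y, cop S s N y -> c (h \o y) = k].

Section Product.
Variables (T : {set A}) (cls : A -> nat).

Definition part (j : nat) : {set A} := [set a in T | cls a == j].

(** One factor is homogenised at a time: copies of the part [j] are coloured by the function that
    gives their colours against all placements of the other parts in the tree found for those. As
    that tree is finite, this is again a finite colouring. *)
Lemma product_arrow (js : seq nat) : (forall j, j \in js -> arrow (part j)) ->
  forall s N (K : finType), good Q s -> 1 < N ->
  exists s' N', [/\ good Q s', N <= N' &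
    forall c : (A -> word) -> K, depends_on [set a in T | cls a \in js] c ->
    exists u k, (forall j, emb s N s' N' (u j)) /\
      forall z, (forall j, j \in js -> cop (part j) s N z) ->
        c (fun a => u (cls a) (z a)) = k].
Proof.
elim: js => [|j js IH] harr s N K gs lN.
  exists s, N; split=> // c hc; exists (fun _ => id), (c (fun _ => [::])).
  split=> [_|z _]; first exact: emb_id.
  by apply: hc => a; rewrite !inE andbF.
have [|s1 [N1 [gs1 le1 H1]]] := IH _ s N K gs lN.
  by move=> i hi; apply: harr; rewrite inE hi orbT.
(* The word [[::]] is added so that [W] is inhabited even if the tree has no vertex. *)
pose W := seq_sub ([::] :: words N1 s1).
pose w0 : W := SeqSub (mem_head [::] (words N1 s1)).
pose inW (x : word) : W := insubd w0 x.
have inWK x : node N1 s1 x -> val (inW x) = x.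
  by move=> nx; rewrite insubdK // inE mem_words nx orbT.
have [s2 [N2 [gs2 le2 H2]]] :=
  harr j (mem_head _ _) s N {ffun {ffun A -> W} -> K} gs lN.
pose N3 := maxn N1 N2.
have lN3 : 1 < N3 by rewrite (leq_trans lN) // (leq_trans le1) // leq_maxl.
exists (s1 ++ s2), N3; split.
- exact: good_cat.
- by rewrite (leq_trans le1) // leq_maxl.
have E1 : emb s1 N1 (s1 ++ s2) N3 id.
  exact: emb_trans (emb_catr _ _ _) (emb_widen _ (leq_maxl _ _)).
have E2 : emb s2 N2 (s1 ++ s2) N3 (cat (nseq (size s1) 0)).
  apply: emb_trans (emb_pad _ _) (emb_widen _ (leq_maxr _ _)).
  exact: (good_width0 hQ).
set e2 : word -> word := cat (nseq _ _) in E2.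
move=> c hc.
pose c2 x : {ffun {ffun A -> W} -> K} :=
  [ffun y : {ffun A -> W} => c (fun a => if cls a == j then e2 (x a) else val (y a))].
have [|h [k2 [Eh hk2]]] := H2 c2.
  move=> x x' e; apply/ffunP => y; rewrite !ffunE; apply: hc => a.
  rewrite !inE => /andP[aT _]; case: ifP => // ja.
  by rewrite e // inE aT.
pose code (y : A -> word) : {ffun A -> W} :=
  [ffun a => if (a \in T) && (cls a \in js) then inW (y a) else w0].
have [|u [k [Eu hk]]] := H1 (fun y => k2 (code y)).
  move=> y y' e; congr (k2 _); apply/ffunP => a; rewrite !ffunE.
  by case: ifP => // aT; rewrite e // inE.
exists (fun i => if i == j then e2 \o h else u i), k; split=> [i|z hz].
  case: eqP => _; first exact: emb_trans E2 Eh.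
  exact: emb_trans E1 (Eu i).
have hz' i : i \in js -> cop (part i) s N z.
  by move=> hi; apply: hz; rewrite inE hi orbT.
rewrite -(hk z hz') -(hk2 z (hz _ (mem_head _ _))) ffunE.
apply: hc => a; rewrite !inE => /andP[aT]; case: eqP => //= nj aj.
rewrite ffunE aT aj /= inWK //.
by apply: (emb_node (Eu _)); apply: (cop_node (hz' _ aj)); rewrite inE aT eqxx.
Qed.

(** Each list [t] of directions calls for its own use of the product theorem, and the embeddings
    found are composed. As the entries of [t] are distinct, a direction determines the part placed
    in it, so one embedding per direction suffices. *)
Lemma multi_product_arrow (k : nat) (TT : seq (seq nat)) :
  {in T, forall a, cls a < k} -> {in TT, forall t, uniq t /\ size t = k} ->
  (forall j, j < k -> arrow (part j)) ->
  forall s N (K : finType), good Q s -> 1 < N ->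
  exists s' N', [/\ good Q s', N <= N' &
    forall c : seq nat -> (A -> word) -> K, (forall t, depends_on T (c t)) ->
    exists g chi, (forall i, emb s N s' N' (g i)) /\
      forall t z, t \in TT -> (forall j, j < k -> cop (part j) s N z) ->
        c t (fun a => g (nth 0 t (cls a)) (z a)) = chi t].
Proof.
move=> hcls + harr; elim: TT => [|t TT IH] hTT s N K gs lN.
  exists s, N; split=> // c hc; exists (fun _ => id), (fun t => c t (fun _ => [::])).
  by split=> // _; apply: emb_id.
have [|s1 [N1 [gs1 le1 H1]]] := IH _ s N K gs lN.
  by move=> t' ht; apply: hTT; rewrite inE ht orbT.
have [] := @product_arrow (iota 0 k) _ s1 N1 K gs1 (leq_trans lN le1).
  by move=> j; rewrite mem_iota => /andP[_ /harr].
move=> s2 [N2 [gs2 le2 H2]].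
exists s2, N2; split=> //; first exact: leq_trans le2.
move=> c hc.
have [|u [k0 [Eu hu]]] := H2 (c t).
  move=> y y' e; apply: hc => a aT; apply: e.
  by rewrite inE aT mem_iota hcls.
(* A direction outside [t] has index [size t] and receives [u (size t)], an embedding like the
   others. *)
pose v i := u (index i t).
have Ev i : emb s1 N1 s2 N2 (v i) by apply: Eu.
have [|g [chi [Eg hchi]]] := H1 (fun t' y => c t' (fun a => v (nth 0 t' (cls a)) (y a))).
  by move=> t' y y' e; apply: hc => a aT; rewrite e.
exists (fun i => v i \o g i), (fun t' => if t' == t then k0 else chi t').
split=> [i|t' z]; first exact: emb_trans (Ev i) (Eg i).
rewrite inE; case: (eqVneq t' t) => [-> _|nt /= ht] hz; last exact: hchi.
have [ut zt] := hTT t (mem_head _ _).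
rewrite -(hu (fun a => g (nth 0 t (cls a)) (z a))).
  by apply: hc => a aT /=; rewrite /v index_uniq // zt hcls.
move=> j; rewrite mem_iota => /andP[_ lj].
apply: cop_ext (cop_emb (Eg (nth 0 t j)) (hz j lj)) => a.
by rewrite inE => /andP[_ /eqP ->].
Qed.

End Product.

Section Root.
Variables (S T : {set A}) (cls : A -> nat) (p : option nat) (ds : seq nat).
Hypothesis hcls : {in T, forall a, cls a < size ds}.
Hypothesis harr : forall j, j < size ds -> arrow (part T cls j).

Definition graft_copies (v : word) (t : seq nat) (z : A -> word) (a : A) : word :=
  if a \in T then v ++ nth 0 t (cls a) :: z a else v.

Definition rooted_copy (s : levels) (N : nat) v t z : Prop :=
  [/\ node N s v, lab s v = p, subset_code (size ds) (width N p) t,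
      (p <> None -> t = ds) &
      forall j, j < size ds -> cop (part T cls j) (drop (size v).+1 s) N z].

Definition all_codes (M : nat) : seq (seq nat) :=
  [seq t <- [seq mask (m : seq bool) (iota 0 M) | m : M.-tuple bool]
   | (size t == size ds)].

Lemma all_codesP M t : subset_code (size ds) M t -> t \in all_codes M.
Proof.
case/and3P=> st /eqP zt lt; rewrite mem_filter zt eqxx /=.
have -> : t = [seq i <- iota 0 M | i \in t].
  apply: (irr_sorted_eq ltn_trans ltnn st).
    by apply: sorted_filter; [exact: ltn_trans|exact: iota_ltn_sorted].
  move=> i; rewrite mem_filter mem_iota andbC /= add0n.
  by case: (boolP (i \in t)) => [/(allP lt)->|]; rewrite ?andbF.
rewrite filter_mask; apply/fintype.imageP.
have h : size (map (fun i => i \in t) (iota 0 M)) == M by rewrite size_map size_iota.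
by exists (Tuple h).
Qed.

Lemma all_codes_uniq M : {in all_codes M, forall t, uniq t /\ size t = size ds}.
Proof.
move=> t; rewrite mem_filter => /andP[/eqP zt ht]; split=> //.
by case/fintype.imageP: ht => m _ ->; rewrite mask_uniq // iota_uniq.
Qed.

(** At a finite label the identity works, [ds] being the only admissible list; at label omega this
    is Ramsey's theorem for sets of size [size ds]. *)
Lemma pattern_ramsey (K : finType) (N : nat) : exists M,
  forall chi : seq nat -> K, exists f c,
    [/\ dir_emb p (width N p) f, forall i, i < width N p -> f i < width M p &
      forall t, subset_code (size ds) (width N p) t -> (p <> None -> t = ds) ->
        subset_code (size ds) (width M p) [seq f i | i <- t] /\
        chi [seq f i | i <- t] = c].
Proof.
case hp: p => [q|] /=.
  exists N => // chi; exists id, (chi ds); split=> // t ct ht.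
  have e : t = ds by apply: ht.
  by rewrite map_id; split=> //; rewrite e.
have [M leM H] := finite_ramsey K (size ds) N.
exists M => // chi; have [f [c [incf ltf hc]]] := H chi.
exists f, c; split=> // t ct _; split; last exact: hc.
exact: subset_code_map ct.
Qed.

(** Induction on levels. Copies rooted at the bottom vertex are homogenised first; every other copy
    lies in a single cone and is left to the induction hypothesis there. *)
Lemma root_arrow s N (K : finType) : good Q s -> 1 < N ->
  exists s' N', [/\ good Q s', N <= N' &
    forall c : (A -> word) -> K, depends_on S c -> exists h chi,
      emb s N s' N' h /\
      forall v t z, rooted_copy s N v t z -> c (h \o graft_copies v t z) = chi v].
Proof.
elim: s => [|q s IH] gs lN.
  exists [::], N; split=> // c _; exists id, (fun v => c (fun _ => v)).
  by split=> [|v t z []]; first exact: emb_id.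
have [s1 [N1 [gs1 le1 H1]]] := IH (good_behead gs) lN.
have gq := good_head gs.
have wle : width N q <= width N1 q by apply: width_le.
have [eqp|nqp] := eqVneq q p; last first.
  exists (q :: s1), N1; split=> //; first exact: good_cons.
  move=> c hc.
  have /choice[h /choice[chi Hh]] : forall i, exists h, exists chi, i < width N q ->
      emb s N s1 N1 h /\ forall v t z, rooted_copy s N v t z ->
        c (fun a => i :: h (graft_copies v t z a)) = chi v.
    move=> i; have [|h [chi H]] := H1 (fun y => c (fun a => i :: y a)).
      by move=> y y' e; apply: hc => a aS; rewrite e.
    by exists h, chi.
  exists (fun x => if x is i :: x' then i :: h i x' else [::]).
  exists (fun v => if v is i :: v' then chi i v' else c (fun=> [::])); split.
    apply: (@emb_root _ _ _ _ _ _ id) => [|||i li|i x li nx] //.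
    - exact: dir_emb_id.
    - exact: emb_trans (emb_cons _ (leq_trans li wle)) (Hh i li).1.
    - by rewrite /= eqxx prefix0s.
  case=> [|i v] t z [/= nv lv ct ht hz].
    by rewrite -[q]/(lab (q :: s) [::]) lv eqxx in nqp.
  have /andP[li nv'] := nv.
  rewrite -((Hh i li).2 v t z) //; apply: hc => a aS /=.
  by rewrite /graft_copies; case: ifP.
have [M HM] := pattern_ramsey K N.
pose N1' := maxn N1 M.
have lN1' : 1 < N1' by rewrite (leq_trans lN) // (leq_trans le1) // leq_maxl.
(* The product theorem is applied to [s1], not to [s]: the uniform colour of copies rooted at the
   bottom then survives when the induction hypothesis shrinks each cone from [s1] to [s]. *)
have [s2 [N2 [gs2 le2 H2]]] :=
  multi_product_arrow hcls (@all_codes_uniq (width M p)) harr K gs1 lN1'.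
have leNN2 : N <= N2.
  by rewrite (leq_trans le1) // (leq_trans _ le2) // leq_maxl.
exists (p :: s2), N2; split=> //; first by rewrite -eqp; apply: good_cons.
move=> c hc.
have [|g [chi [Eg hg]]] :=
    H2 (fun t y => c (fun a => if a \in T then nth 0 t (cls a) :: y a else [::])).
  by move=> t y y' e; apply: hc => a aS; case: ifP => // aT; rewrite e.
have Eg' i : emb s1 N1 s2 N2 (g i).
  exact: emb_trans (Eg i) (emb_widen _ (leq_maxl _ _)).
have [f [k [Hf ltf hk]]] := HM chi.
have ltf2 i : i < width N p -> f i < width N2 p.
  move=> /ltf /leq_trans; apply; apply: width_le.
  by rewrite (leq_trans _ le2) // leq_maxr.
have /choice[h /choice[chi' Hh]] : forall i, exists h, exists chi', i < width N p ->
    emb s N s1 N1 h /\ forall v t z, rooted_copy s N v t z ->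
      c (fun a => f i :: g (f i) (h (graft_copies v t z a))) = chi' v.
  move=> i; have [|h [chi' H]] := H1 (fun y => c (fun a => f i :: g (f i) (y a))).
    by move=> y y' e; apply: hc => a aS; rewrite e.
  by exists h, chi'.
exists (fun x => if x is i :: x' then f i :: g (f i) (h i x') else [::]).
exists (fun v => if v is i :: v' then chi' i v' else k); split.
  rewrite eqp; apply: (@emb_root _ _ _ _ _ _ f) => [|||i li|i x li nx] //.
  - apply: (@emb_trans _ _ s2 N2 _ _ (cons (f i))); first exact/emb_cons/ltf2.
    exact: emb_trans (Eg' (f i)) (Hh i li).1.
  - by rewrite /= eqxx prefix0s.
case=> [|i v] t z [/= nv lv ct ht hz].
  have [ct' <-] := hk t ct ht; rewrite drop0 in hz.
  have lnth a : a \in T -> nth 0 t (cls a) < width N p.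
    move=> aT; case/and3P: ct => _ /eqP zt /allP; apply.
    by rewrite mem_nth // zt hcls.
  have nthf a : a \in T -> nth 0 [seq f i | i <- t] (cls a) = f (nth 0 t (cls a)).
    by move=> aT; rewrite (nth_map 0) //; case/and3P: ct => _ /eqP -> _; apply: hcls.
  rewrite -(hg _ (fun a => h (nth 0 t (cls a)) (z a)) (all_codesP ct')).
    apply: hc => a aS /=; rewrite /graft_copies; case: ifP => // aT /=.
    by rewrite nthf.
  move=> j lj; have ljw : nth 0 t j < width N p.
    by case/and3P: ct => _ /eqP zt /allP; apply; rewrite mem_nth // zt.
  have E := emb_trans (emb_widen s1 (leq_maxl N1 M)) (Hh _ ljw).1.
  apply: cop_ext (cop_emb E (hz j lj)) => a.
  by rewrite inE => /andP[_ /eqP ->].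
have /andP[li nv'] := nv; rewrite eqp in li.
rewrite -((Hh i li).2 v t z) //; apply: hc => a aS /=.
by rewrite /graft_copies; case: ifP.
Qed.

(** The colour first becomes a function [chi] of the root of the copy, a vertex of label [p] in
    [s1]; the tree [s1] was chosen so that [chi] is constant on such vertices of some copy of
    [s]. *)
Lemma arrow_of_root a0 b0 : a0 \in S -> b0 \in S ->
  (forall s N y, cop S s N y -> exists t z,
    rooted_copy s N (lcp (y a0) (y b0)) t z /\
    {in S, y =1 graft_copies (lcp (y a0) (y b0)) t z}) -> arrow S.
Proof.
move=> a0S b0S dec s N K gs lN.
have [s1 gs1 H1] := vertex_ramsey hQ K p gs lN.
have [s2 [N2 [gs2 le2 H2]]] := root_arrow K gs1 lN.
exists s2, N2; split=> // c hc.
have [h [chi [Eh hchi]]] := H2 c hc.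
have [g [k [Eg hk]]] := H1 chi.
exists (h \o g), k; split; first exact: emb_trans Eh Eg.
move=> y Hy.
have nv : node N s (lcp (y a0) (y b0)) by apply/node_lcp/(cop_node Hy).
have [t [z [C e]]] := dec _ _ _ (cop_emb Eg Hy).
rewrite -(hc (h \o graft_copies (lcp ((g \o y) a0) ((g \o y) b0)) t z)); last first.
  by move=> a aS /=; rewrite -(e a aS).
rewrite (hchi _ t z) //=.
have {C}[_ lv _ _ _] := C.
rewrite /= -(emb_lcp Eg) ?(cop_node Hy) // in lv *; apply: hk => //.
by rewrite -(emb_lab Eg).
Qed.

End Root.
End Copies.

(** The meets with [phi a0] are prefixes of one word, so a shortest one lies below all of them. *)
Lemma common_meet (A : finType) (S : {set A}) (phi : A -> word) a0 : a0 \in S ->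
  exists2 b0, b0 \in S & {in S, forall a, prefix (lcp (phi a0) (phi b0)) (phi a)}.
Proof.
move=> a0S.
case: (arg_minnP (fun b => size (lcp (phi a0) (phi b))) a0S) => b0 b0S hmin.
exists b0 => // a aS.
have := prefix_comparable (lcp_prefixl _ _) (lcp_prefixl _ _) (hmin a aS).
by move/prefix_trans; apply; apply: lcp_prefixr.
Qed.

Section Arrow.
Variables (Q : option nat -> Prop) (hQ : forall q, Q q -> le_bound 3 q).
Variables (A : finType) (sphi : levels) (phi : A -> word).

Lemma tp2_branch s (x y z : word) : prefix z x -> z != x -> prefix z y -> z != y ->
  nth 0 x (size z) != nth 0 y (size z) ->
  tp2 s x y = norm (lab s z) (Some (nth 0 x (size z))) (Some (nth 0 y (size z))).
Proof. by move=> *; apply: tp2_rcons => //; apply: prefix_rcons_nth. Qed.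

(** The pattern splits at its meet [r]: elements strictly above [r] are grouped by direction. No
    group is everything, because [a0] and [b0], whose meet is [r], do not share one. Every copy
    splits in the same way. *)
Lemma arrow_step (S : {set A}) :
  (forall S' : {set A}, #|S'| < #|S| -> arrow Q sphi phi S') -> arrow Q sphi phi S.
Proof.
move=> IH; have [->|/finset.set0Pn[a0 a0S]] := eqVneq S finset.set0.
  move=> s N K gs lN; exists s, N; split=> // c hc.
  exists id, (c (fun _ => [::])); split=> [|y _]; first exact: emb_id.
  by apply: hc => a; rewrite inE.
have [b0 b0S hr] := common_meet phi a0S.
set r := lcp (phi a0) (phi b0) in hr.
pose T := [set a in S | r != phi a].
have sTS : T \subset S by apply/fintype.subsetP => a; rewrite inE => /andP[].
pose dir a := nth 0 (phi a) (size r).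
pose ds := sort leq (undup [seq dir a | a <- enum T]).
pose cls a := index (dir a) ds.
have uds : uniq ds by rewrite sort_uniq undup_uniq.
have mds a : a \in T -> dir a \in ds.
  by move=> aT; rewrite mem_sort mem_undup map_f // mem_enum.
have sds : sorted ltn ds.
  by rewrite ltn_sorted_uniq_leq uds /=; apply: (sort_sorted leq_total).
have hcls : {in T, forall a, cls a < size ds} by move=> a aT; rewrite /cls index_mem mds.
have nthcls a : a \in T -> nth 0 ds (cls a) = dir a by move=> aT; rewrite /cls nth_index ?mds.
have rootE x : (r == x) = [&& prefix x (phi a0), prefix x (phi b0) & prefix r x].
  apply/eqP/and3P => [<-|[h1 h2 h3]]; first by rewrite /r lcp_prefixl lcp_prefixr prefix_refl.
  by apply: prefix_anti h3 _; rewrite prefix_lcp h1.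
have dirE a b : a \in T -> b \in T -> (lcp (phi a) (phi b) == r) = (dir a != dir b).
  rewrite !inE => /andP[aS ra] /andP[bS rb].
  by apply: lcp_eqE => //; apply: hr.
have part_lt j : #|part T cls j| < #|S|.
  apply: proper_card; apply/properP; split.
    by apply/fintype.subsetP => a; rewrite inE => /andP[/(fintype.subsetP sTS)].
  have [a0T|a0T] := boolP (a0 \in T); last by exists a0 => //; rewrite inE (negbTE a0T).
  have [b0T|b0T] := boolP (b0 \in T); last by exists b0 => //; rewrite inE (negbTE b0T).
  have [e|ne] := eqVneq (cls a0) j; last by exists a0 => //; rewrite inE (negbTE ne) andbF.
  exists b0 => //; rewrite inE b0T -e /= eq_sym; apply/eqP => ec.
  have := dirE _ _ a0T b0T; rewrite eqxx -[in RHS](nthcls a0) // ec nthcls //.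
  by rewrite eqxx.
apply: (@arrow_of_root Q hQ A sphi phi S T cls (lab sphi r) ds hcls _ a0 b0 a0S b0S).
  by move=> j _; apply/IH/part_lt.
move=> s N y Hy.
set v := lcp (y a0) (y b0).
have hv a : a \in S -> prefix v (y a).
  by move=> aS; rewrite (cop_prefix Hy) ?hr.
have ylep a b : a \in S -> b \in S -> prefix (y a) (y b) = prefix (phi a) (phi b).
  by move=> aS bS; apply: tp2_eq_prefix (cop_tp2 Hy aS bS).
have rootyE a : a \in S -> (v == y a) = (r == phi a).
  move=> aS; rewrite rootE -!ylep // hr // andbT.
  apply/eqP/andP => [<-|[h1 h2]]; first by rewrite /v lcp_prefixl lcp_prefixr.
  by apply: prefix_anti (hv a aS) _; rewrite prefix_lcp h1.
have lcpyE a b : a \in S -> b \in S ->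
    (lcp (y a) (y b) == v) = (lcp (phi a) (phi b) == r).
  move=> aS bS; rewrite [RHS]eq_sym rootE -!(cop_prefix Hy) //.
  rewrite prefix_lcp !hr // !andbT.
  apply/eqP/andP => [->|[h1 h2]]; first by rewrite /v lcp_prefixl lcp_prefixr.
  by apply: prefix_anti; rewrite prefix_lcp ?h1 ?hv.
have lv : lab s v = lab sphi r by apply: tp2_eq_lab (cop_tp2 Hy a0S b0S).
have Tr a : a \in T -> [/\ a \in S, v != y a & r != phi a].
  by rewrite inE => /andP[aS ra]; rewrite rootyE.
pose dy a := nth 0 (y a) (size v).
have dyE a b : a \in T -> b \in T -> (dy a == dy b) = (dir a == dir b).
  move=> aT bT; have [aS va _] := Tr a aT; have [bS vb _] := Tr b bT.
  apply: negb_inj; rewrite -dirE // -lcpyE //.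
  by rewrite lcp_eqE ?hv.
have dytp a b : a \in T -> b \in T -> dir a != dir b ->
    norm (lab sphi r) (Some (dy a)) (Some (dy b)) =
    norm (lab sphi r) (Some (dir a)) (Some (dir b)).
  move=> aT bT nab; have [aS va ra] := Tr a aT; have [bS vb rb] := Tr b bT.
  have := cop_tp2 Hy aS bS.
  rewrite (@tp2_branch _ _ _ v) ?hv ?lv ?dyE // -/(dy a) -/(dy b) => ->.
  by rewrite (@tp2_branch _ _ _ r) ?hr.
(* At a finite label types record the directions at [r], but only for pairs whose meet is [r]. Each
   [a] in [T] has such a partner: [a0] or [b0]. *)
have dyfin : lab sphi r <> None -> {in T, forall a, dy a = dir a}.
  move=> nN a aT; have [aS va ra] := Tr a aT.
  have [c cS /eqP hc] : exists2 c, c \in S & lcp (phi a) (phi c) = r.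
    have [a0T|a0T] := boolP (a0 \in T); last first.
      exists a0 => //; rewrite inE a0S /= negbK in a0T.
      by rewrite -(eqP a0T) lcp_idPr ?hr.
    have [b0T|b0T] := boolP (b0 \in T); last first.
      exists b0 => //; rewrite inE b0S /= negbK in b0T.
      by rewrite -(eqP b0T) lcp_idPr ?hr.
    have [e|ne] := eqVneq (dir a) (dir a0).
      by exists b0 => //; apply/eqP; rewrite dirE // e -dirE.
    by exists a0 => //; apply/eqP; rewrite dirE.
  have [cT|cT] := boolP (c \in T).
    have nac : dir a != dir c by rewrite -dirE.
    by have := dytp _ _ aT cT nac; case: (lab sphi r) nN => // q _ [].
  have rc : r = phi c by move: cT; rewrite inE cS /= negbK => /eqP.
  have vc : v = y c by apply/eqP; rewrite rootyE // rc.
  have := cop_tp2 Hy aS cS; rewrite -vc -rc.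
  rewrite (tp2_rcons_r _ (prefix_rcons_nth (hv a aS) va)) lv.
  rewrite (tp2_rcons_r _ (prefix_rcons_nth (hr a aS) ra)).
  by case: (lab sphi r) nN => // q _ [].
pose rep d := odflt a0 [pick a in T | dir a == d].
have repP a : a \in T -> rep (dir a) \in T /\ dir (rep (dir a)) = dir a.
  move=> aT; rewrite /rep; case: pickP => [b /andP[bT /eqP eb] //|/(_ a)].
  by rewrite aT eqxx.
have dsrep d : d \in ds -> rep d \in T /\ dir (rep d) = d.
  rewrite mem_sort mem_undup => /mapP[a]; rewrite mem_enum => aT ->.
  exact: repP.
pose t := [seq dy (rep d) | d <- ds].
have nthT a : a \in T -> nth 0 t (cls a) = dy a.
  move=> aT; rewrite (nth_map 0) ?nthcls ?hcls //.
  by have [h1 h2] := repP a aT; apply/eqP; rewrite dyE // h2.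
have tds : lab sphi r <> None -> t = ds.
  move=> nN; rewrite -[RHS]map_id; apply/eq_in_map => d /dsrep[h1 h2].
  by rewrite dyfin.
have hy a : a \in T -> y a = v ++ dy a :: drop (size v).+1 (y a).
  by move=> /Tr[aS va _]; apply: prefix_decomp => //; apply: hv.
exists t, (fun a => drop (size v).+1 (y a)); split; last first.
  move=> a aS; rewrite /graft_copies; case: (boolP (a \in T)) => aT.
    by rewrite nthT // -hy.
  by apply/eqP; rewrite eq_sym rootyE //; move: aT; rewrite inE aS negbK.
split=> //.
- exact/node_lcp/(cop_node Hy).
- apply/and3P; split.
  + have [eN|/eqP nN] := eqVneq (lab sphi r) None; last by rewrite tds.
    rewrite sorted_map; apply: (sub_in_sorted _ _ sds (P := mem ds)) => [d e hd he /= lde|].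
      have [h1 h2] := dsrep d hd; have [h3 h4] := dsrep e he.
      have := dytp _ _ h1 h3; rewrite h2 h4 neq_ltn lde => /(_ isT).
      by rewrite eN /norm /rank_code /= lde => -[_]; case: ltnP.
    by apply/allP.
  + by rewrite size_map.
  + rewrite all_map; apply/allP => d /dsrep[h1 _] /=; have [aS va _] := Tr _ h1.
    by rewrite -lv; apply: node_nth (hv _ aS) va; apply: (cop_node Hy).
move=> j lj; set z := fun a => _.
have hyj a : a \in part T cls j -> y a = rcons v (nth 0 t j) ++ z a.
  rewrite inE => /andP[aT /eqP ej]; rewrite cat_rcons -ej nthT //; exact: hy.
have inS a : a \in part T cls j -> a \in S by rewrite inE => /andP[/(fintype.subsetP sTS)].
have szv : (size v).+1 = size (rcons v (nth 0 t j)) by rewrite size_rcons.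
rewrite szv; split=> [a aj|a b aj bj|a b c aj bj cj].
- by have := cop_node Hy (inS _ aj); rewrite (hyj a aj) => /node_cat.
- rewrite -(cop_tp2 Hy) ?inS // (hyj a aj) (hyj b bj).
  by rewrite tp2_cat.
- rewrite -(cop_prefix Hy) ?inS // (hyj a aj) (hyj b bj) (hyj c cj).
  by rewrite lcp_cat prefix_catr // eqxx.
Qed.

Theorem tree_ramsey (S : {set A}) : arrow Q sphi phi S.
Proof.
have [n] := ubnP #|S|; elim: n S => // n IH S; rewrite ltnS => leS.
apply: arrow_step => S' lS'; apply: IH; exact: leq_trans leS.
Qed.

End Arrow.

(** * Trees as prefix-closed sets of words *)

Lemma med_betw x y z :
  [/\ betw x (med x y z) y, betw y (med x y z) z & betw x (med x y z) z].
Proof.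
rewrite /med; case: (boolP (prefix (lcp x y) z)) => [hz|nz].
  have lxy := lcp_prefixl x y; have rxy := lcp_prefixr x y.
  case: (boolP (prefix (lcp y z) x)) => [hx|nx].
    have lyz := lcp_prefixl y z; have ryz := lcp_prefixr y z.
    by split; rewrite /betw ?prefix_refl ?prefix_lcp ?lcp_prefixl ?lcp_prefixr
      ?lxy ?hz ?hx ?ryz ?orbT.
  split; rewrite /betw ?prefix_refl ?prefix_lcp ?lcp_prefixl ?lcp_prefixr ?rxy ?hz ?orbT //.
  have [h|h] := prefix_total (lcp_prefixr x z) (lcp_prefixr y z).
    by move: h; rewrite prefix_lcp => /andP[->].
  by case/negP: nx; apply: prefix_trans h (lcp_prefixl _ _).
split; rewrite /betw ?prefix_refl ?lcp_prefixl ?lcp_prefixr ?orbT //= andbT.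
  have [//|h] := prefix_total (lcp_prefixl y z) (lcp_prefixr x y).
  by case/negP: nz; apply: prefix_trans h (lcp_prefixr _ _).
have [//|h] := prefix_total (lcp_prefixl x z) (lcp_prefixl x y).
by case/negP: nz; apply: prefix_trans h (lcp_prefixr _ _).
Qed.

Lemma med_prefix x y z :
  prefix (med x y z) x \/ prefix (med x y z) y.
Proof. by have [/andP[_ /orP]] := med_betw x y z. Qed.

Definition adj (u v : word) : bool :=
  ((u != [::]) && (par u == v)) || ((v != [::]) && (par v == u)).

Lemma adjC u v : adj u v = adj v u. Proof. exact: orbC. Qed.

Lemma adj_cases u v : adj u v -> (exists i, u = rcons v i) \/ (exists i, v = rcons u i).
Proof.
by case/orP=> /andP[h /eqP <-]; [left; exists (last 0 u)|right; exists (last 0 v)];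
  apply: rcons_par.
Qed.

Lemma adj_rcons u i : adj u (rcons u i).
Proof.
rewrite /adj par_rcons eqxx andbT orbC.
by case: u.
Qed.

Section WordTree.
Variables (T : finType) (b : T -> word).
Hypothesis b_inj : injective b.
Hypothesis b_closed : forall x u, prefix u (b x) -> exists x', b x' = u.

Definition word_rel : rel T := fun x y => adj (b x) (b y).

Lemma prefix_rconsP (u v : word) i : prefix u (rcons v i) -> prefix u v \/ u = rcons v i.
Proof.
move=> h; have [h'|h'] := prefix_total h (prefix_rcons v i); first by left.
have := size_prefix h; rewrite size_rcons leq_eqVlt => /orP[/eqP e|].
  by right; rewrite -[LHS](prefix_take_size h) e -(size_rcons v i) take_size.
by rewrite ltnS => e; left; apply: prefix_comparable h (prefix_rcons v i) e.
Qed.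

(** Only the edge from [u] to its parent connects the cone above [u] with the rest. *)
Lemma path_leaves_cone x p u : path word_rel x p -> prefix u (b x) ->
  ~~ prefix u (b (last x p)) ->
  (exists2 z, z \in x :: p & b z = u) /\ (exists2 z, z \in x :: p & b z = par u).
Proof.
elim: p x => [|y p IH] x /=; first by move=> _ ->.
move=> /andP[exy py] ux nu; case: (boolP (prefix u (b y))) => uy.
  by have [[z zp ez] [z' zp' ez']] := IH _ py uy nu;
    split; [exists z|exists z'] => //; rewrite inE ?zp ?zp' orbT.
have [[i e]|[i e]] := adj_cases exy; last first.
  by case/negP: uy; rewrite e (prefix_trans ux) // prefix_rcons.
rewrite e in ux; have [h|h] := prefix_rconsP ux; first by case/negP: uy.
split; first by exists x; rewrite ?mem_head // h.
by exists y; rewrite ?inE ?eqxx ?orbT // h par_rcons.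
Qed.

Lemma path_enters_cone x p u : path word_rel x p -> ~~ prefix u (b x) ->
  prefix u (b (last x p)) -> exists2 z, z \in x :: p & b z = u.
Proof.
elim: p x => [|y p IH] x /=; first by move=> _ /negbTE ->.
move=> /andP[exy py] ux nu; case: (boolP (prefix u (b y))) => uy; last first.
  by have [z zp ez] := IH _ py uy nu; exists z => //; rewrite inE zp orbT.
exists y; first by rewrite !inE eqxx orbT.
have [[i e]|[i e]] := adj_cases exy.
  by case/negP: ux; rewrite e (prefix_trans uy) // prefix_rcons.
by rewrite e in uy *; have [h|//] := prefix_rconsP uy; case/negP: ux.
Qed.

Lemma path_betw x p v : path word_rel x p ->
  betw (b x) (b v) (b (last x p)) -> v \in x :: p.
Proof.
move=> xp /andP[hm].
case: (boolP (prefix (b v) (b x))) => [vx _|nvx /= vy]; last first.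
  by have [z zp /b_inj <-] := path_enters_cone xp nvx vy.
case: (boolP (prefix (b v) (b (last x p)))) => [vy|nvy]; last first.
  by have [[z zp /b_inj <-] _] := path_leaves_cone xp vx nvy.
have em : lcp (b x) (b (last x p)) = b v.
  by apply: prefix_anti => //; rewrite prefix_lcp vx.
have [/b_inj ->|nx] := eqVneq (b v) (b x); first exact: mem_head.
(* Here [b v] is the meet of the ends. The path leaves the cone above the child of [b v] that is a
   prefix of [b x], and does so through the parent of this child. *)
have ux := prefix_rcons_nth vx nx.
have [|_ [z zp]] := path_leaves_cone xp ux.
  apply/negP => uy; have := prefix_refl (rcons (b v) (nth 0 (b x) (size (b v)))).
  have : prefix (rcons (b v) (nth 0 (b x) (size (b v)))) (b v).
    by rewrite -{3}em prefix_lcp ux.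
  by move/size_prefix; rewrite size_rcons ltnn.
by rewrite par_rcons => /b_inj <-.
Qed.

Lemma word_rel_sym : symmetric word_rel.
Proof. by move=> x y; apply: adjC. Qed.

Lemma word_rel_connect x y : connect word_rel x y.
Proof.
have root z : b z = [::] -> forall x, connect word_rel x z.
  move=> bz w; have [n] := ubnP (size (b w)); elim: n w => // n IH w.
  rewrite ltnS => lw; have [e|ne] := eqVneq (b w) [::].
    by have -> : w = z by [apply: b_inj; rewrite e]; rewrite connect0.
  have [w' ew] := b_closed (prefix_par (b w)).
  apply: connect_trans (connect1 _) (IH w' _).
    by rewrite /word_rel /adj ne ew eqxx.
  by rewrite ew size_par; case: (b w) ne lw.
have [z bz] := b_closed (prefix0s (b x)).
apply: connect_trans (root z bz x) _.
by rewrite (sym_connect_sym word_rel_sym) root.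
Qed.

(** Both neighbours of a longest word on the cycle are its parent, hence equal. *)
Lemma word_rel_acyclic c : 2 < size c -> ~ ucycle word_rel c.
Proof.
move=> hs /andP[cyc un].
have [u0 u0c] : exists u, u \in c by case: c hs {cyc un} => // u c; exists u; rewrite mem_head.
have [u uc hmax] := arg_maxnP (fun v => size (b v)) u0c.
have [i s es] := rot_to uc.
rewrite -(rot_uniq i) es in un; rewrite -(rot_cycle i) es in cyc.
have mem v : v \in s -> v \in c by move=> vs; rewrite -(mem_rot i) es inE vs orbT.
have down v : v \in s -> word_rel u v -> b v = par (b u).
  move=> /mem/hmax hv /adj_cases[[j e]|[j e]]; first by rewrite e par_rcons.
  by rewrite e size_rcons /= in hv; lia.
case: s es un cyc mem down => [|a s] es un cyc mem down.
  by move: hs; rewrite -(size_rot i) es.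
have ea : b a = par (b u).
  by apply: down; [rewrite mem_head|case/andP: cyc].
case: (lastP s) es un cyc mem down => [|s' z] es un cyc mem down.
  by move: hs; rewrite -(size_rot i) es.
have ez : b z = par (b u).
  apply: down; first by rewrite inE mem_rcons mem_head orbT.
  move: cyc; rewrite /= rcons_path last_rcons => /andP[_ /andP[_]].
  by rewrite word_rel_sym.
have eaz : a = z by apply: b_inj; rewrite ea.
by move: un; rewrite /= eaz mem_rcons mem_head /= andbF.
Qed.

Lemma word_rel_tree : 0 < #|T| -> is_tree word_rel.
Proof.
move=> T0; split=> //; first exact: word_rel_sym.
- move=> x; rewrite /word_rel /adj orbb; apply/negbTE/nandP.
  case: (b x) => [|i u] /=; [by left|right].
  by apply/eqP => /(congr1 size); rewrite size_par /=; lia.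
- exact: word_rel_connect.
- exact: word_rel_acyclic.
Qed.

(** On a simple path through [v], the median of [v] and both ends is visited in the part before [v]
    and in the part after it; simplicity forces it to be [v]. *)
Lemma word_on_path x y v : on_path word_rel x y v <-> betw (b x) (b v) (b y).
Proof.
split=> [[p [xp ly un]]|hv]; last first.
  have /connectP[p xp ey] := word_rel_connect x y.
  move: ey; case: (shortenP xp) => q xq uq _ ey.
  exists q; split=> //; apply: path_betw => //.
  by rewrite -ey.
move: xp ly un => + + + vp; case/splitPl: vp => p1 p2 lv.
rewrite cat_path last_cat lv => /andP[xp1 vp2] ly un.
have [h1 h2 h3] := med_betw (b x) (b y) (b v).
set m := med _ _ _ in h1 h2 h3.
have [u eu] : exists u, b u = m.
  by have [/b_closed|/b_closed] := med_prefix (b x) (b y) (b v).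
have [<-|nuv] := eqVneq u v; first by rewrite eu.
have up1 : u \in x :: p1 by apply: path_betw; rewrite ?lv ?eu.
have up2 : u \in v :: p2 by apply: path_betw; rewrite ?ly ?eu // betwC.
move: up2; rewrite inE (negbTE nuv) /= => up2.
by move: un; rewrite -cat_cons cat_uniq => /and3P[_ /hasPn /(_ _ up2) /negP[]].
Qed.

Lemma word_separated x y z w :
  ~ (exists v, on_path word_rel x y v /\ on_path word_rel z w v) <->
  separated (b x) (b y) (b z) (b w).
Proof.
split=> [hn|hs [v [/word_on_path h1 /word_on_path h2]]]; last first.
  have : ~~ separated (b x) (b y) (b z) (b w) by apply/separatedP; exists (b v).
  by rewrite hs.
apply: contrapT => /negP; rewrite /separated negbK => /orP[h|h]; apply: hn.
  have [v ev] := b_closed (lcp_prefixl (b x) (b y)).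
  exists v; split; apply/word_on_path; rewrite ev //.
  by rewrite /betw prefix_refl lcp_prefixl.
have [v ev] := b_closed (lcp_prefixl (b z) (b w)).
exists v; split; apply/word_on_path; rewrite ev //.
by rewrite /betw prefix_refl lcp_prefixl.
Qed.

End WordTree.

Section TreeWords.
Variables (T : finType) (e : rel T).
Hypothesis e_tree : is_tree e.

(** If the first steps [a] and [c] differ, following one path and returning along the other leads
    from [a] to [c] without meeting [x]; made simple and closed through [x], this is a cycle. *)
Lemma simple_path_uniq x p q : path e x p -> path e x q ->
  uniq (x :: p) -> uniq (x :: q) -> last x p = last x q -> p = q.
Proof.
elim: p x q => [|a p IH] x [|c q] //=.
- by move=> _ _ _ /andP[nx _] ex; rewrite ex mem_last in nx.
- by move=> _ _ /andP[nx _] _ ex; rewrite -ex mem_last in nx.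
move=> /andP[xa ap] /andP[xc cq] /andP[nxa ua] /andP[nxc uc] el.
have [eac|nac] := eqVneq a c; first by rewrite -eac in cq uc el *; rewrite (IH a q).
have er : last a p :: rev (belast c q) = rev (c :: q).
  by rewrite [c :: q]lastI rev_rcons el.
have pr : path e a (p ++ rev (belast c q)).
  rewrite cat_path ap el rev_path /=.
  by rewrite (eq_path (e' := e)) // => u v; apply: (tree_sym e_tree).
have lr : last a (p ++ rev (belast c q)) = c.
  by rewrite last_cat -[LHS]/(last a (last a p :: rev (belast c q))) er rev_cons last_rcons.
case: (shortenP pr) lr => w aw uw sub lw.
exfalso; apply: (tree_acyclic e_tree (c := x :: a :: w)).
  by case: w lw {aw uw sub} => //= eac; rewrite eac eqxx in nac.
rewrite /ucycle /= xa rcons_path aw lw (tree_sym e_tree) xc /=.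
move: uw => /= ->; rewrite andbT; apply/negP => hx.
have : x \in a :: p ++ rev (c :: q).
  move: hx; rewrite !inE => /orP[->//|/sub]; rewrite mem_cat -er => /orP[h|h].
    by rewrite mem_cat h orbT.
  by rewrite mem_cat inE h !orbT.
by rewrite inE mem_cat mem_rev orbA -in_cons (negbTE nxa) (negbTE nxc).
Qed.

(** A vertex becomes the list of the ranks of the vertices on the simple path to it from [r];
    initial segments of simple paths are simple, whence closure under prefixes. *)
Lemma tree_words (r : T) : exists b : T -> word,
  [/\ injective b, b r = [::],
      forall x u, prefix u (b x) -> exists x', b x' = u &
      e = word_rel b].
Proof.
have /choice[sp Hsp] : forall x, exists p,
    [/\ path e r p, last r p = x & uniq (r :: p)].
  move=> x; have /connectP[p rp ex] := tree_connected e_tree r x.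
  by move: ex; case: (shortenP rp) => q rq uq _ ex; exists q.
have spE x p : path e r p -> last r p = x -> uniq (r :: p) -> sp x = p.
  move=> rp lp up; have [h1 h2 h3] := Hsp x.
  by apply: simple_path_uniq h1 rp h3 up _; rewrite h2.
pose code (y : T) : nat := enum_rank y.
have code_inj : injective code by move=> x y /ord_inj/enum_rank_inj.
pose b x := map code (sp x).
have b_inj : injective b.
  move=> x y /(inj_map code_inj) exy.
  by have [_ <- _] := Hsp x; have [_ <- _] := Hsp y; rewrite exy.
have sp_cat x p1 p2 : sp x = p1 ++ p2 -> sp (last r p1) = p1.
  move=> ex; have [] := Hsp x; rewrite ex cat_path -cat_cons cat_uniq.
  by move=> /andP[h1 _] _ /andP[h2 _]; apply: spE.
exists b; split=> //.
- by rewrite /b (spE r [::]).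
- move=> x u /prefix_take_size; rewrite /b -map_take => <-.
  exists (last r (take (size u) (sp x))); rewrite /b; congr map.
  by apply: (sp_cat x _ (drop (size u) (sp x))); rewrite cat_take_drop.
have adj_e x y i : b y = rcons (b x) i -> e x y.
  move=> exy; have [] := Hsp y.
  move ep: (sp y) => q; case/lastP: q ep => [|p z] ep.
    by move: exy; rewrite /b ep /=; case: map.
  rewrite rcons_path last_rcons => /andP[_ epz] ez _.
  suff -> : x = last r p by rewrite -ez.
  apply: b_inj; move: (exy); rewrite /b ep map_rcons => /rcons_inj[<- _].
  congr map; apply/esym/(sp_cat y p [:: z]); by rewrite ep cats1.
apply/funext => x; apply/funext => y; apply/idP/idP; last first.
  case/adj_cases=> -[i]; last exact: adj_e.
  by rewrite (tree_sym e_tree); apply: adj_e.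
move=> exy; have [rx lx ux] := Hsp x.
have [yx|nyx] := boolP (y \in r :: sp x); last first.
  rewrite /word_rel (_ : b y = rcons (b x) (code y)); first exact: adj_rcons.
  rewrite /b -map_rcons; congr map; apply: spE; first by rewrite rcons_path rx lx.
    by rewrite last_rcons.
  by rewrite -rcons_cons rcons_uniq nyx.
move ex: (sp x) yx rx lx ux => q yx; case/splitPl: yx ex => p1 p2 ly ex.
have := sp_cat x p1 p2 ex; rewrite ly => sy.
rewrite cat_path last_cat ly => /andP[rp1 yp2] lx.
rewrite -cat_cons cat_uniq lastI ly rcons_uniq => /and3P[_ nh u2].
have uy2 : uniq (y :: p2).
  rewrite /= u2 andbT; apply/negP => yp; case/hasP: nh.
  by exists y => //=; rewrite mem_rcons mem_head.
have e2 : p2 = [:: x].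
  apply: (simple_path_uniq yp2 _ uy2) => //=.
    by rewrite (tree_sym e_tree) exy.
  rewrite inE andbT; apply/eqP => eyx; move: exy.
  by rewrite eyx (tree_irr e_tree).
rewrite /word_rel adjC (_ : b x = rcons (b y) (code x)); first exact: adj_rcons.
by rewrite /b sy ex e2 map_cat cats1.
Qed.

End TreeWords.

(** * The expanded class *)

(** One symbol for each conceivable value of [tp2]; the language is countable and the same for all
    [P]. *)
Definition type_language : language :=
  @Language (option nat * option nat * option nat)%type (fun _ => 2) (fun _ => isT).

Section Expansion.
Variables (P : set (option nat)) (hP : forall p, P p -> le_bound 3 p).

Let LPs := lang_union (LP P) type_language.

Definition wint (s : levels) (R : sym LPs) (t : seq word) : Prop :=
  match R with
  | inl symD =>
      separated (nth [::] t 0) (nth [::] t 1) (nth [::] t 2) (nth [::] t 3)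
  | inl (symK p) => lab s (nth [::] t 0) = val p
  | inr tau => tp2 s (nth [::] t 0) (nth [::] t 1) = tau
  end.

Definition realized (As : structure LPs) (s : levels) (N : nat) (phi : As -> word) :
    Prop :=
  [/\ good P s, 1 < N, injective phi, forall a, node N s (phi a) &
      forall (R : sym LPs) (t : (arity R).-tuple As), interp t <-> wint s R (map phi t)].

(** Any homogeneous tree may serve, and the image need neither be prefix-closed nor contain its
    meets. A realisation therefore restricts to substructures, whence the relative hereditary
    property. *)
Definition FPs : class LPs := fun As =>
  FP (reduct As) /\ exists s N phi, @realized As s N phi.

Definition word_structure (s : levels) (W : seq word) : structure LPs :=
  @Structure LPs (seq_sub W) (fun R t => wint s R (map val t)).

Lemma wint_emb s N s' N' h (R : sym LPs) (t : seq word) :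
  emb s N s' N' h -> all (node N s) t -> size t = arity R ->
  wint s' R (map h t) <-> wint s R t.
Proof.
move=> E /allP nt zt.
have nn i : i < arity R -> node N s (nth [::] t i).
  by move=> li; apply: nt; rewrite mem_nth // zt.
have nm i : i < arity R -> nth [::] (map h t) i = h (nth [::] t i).
  by move=> li; rewrite (nth_map [::]) // zt.
case: R zt nn nm => [[|p]|tau] /= zt nn nm; rewrite !nm //.
- by rewrite (emb_separated E) ?nn.
- by rewrite (emb_lab E) ?nn.
- by rewrite (emb_tp2 E) ?nn.
Qed.

Lemma realized_words s N W : good P s -> 1 < N -> {in W, forall w, node N s w} ->
  @realized (word_structure s W) s N val.
Proof.
move=> gs lN nW; split=> // a.
exact/nW/(valP a).
Qed.

Lemma realized_embedding (A B : structure LPs) s N phi s' N' psi h (f : A -> B) :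
  @realized A s N phi -> @realized B s' N' psi -> emb s N s' N' h ->
  (forall a, psi (f a) = h (phi a)) -> is_embedding f.
Proof.
move=> [gs lN iphi nphi Hphi] [gs' lN' ipsi npsi Hpsi] E e; split.
  move=> a b eab; apply: iphi; apply: (emb_inj E) => //.
  by rewrite -!e eab.
move=> R t; rewrite Hphi Hpsi.
have -> : map psi (map_tuple f t) = map h (map phi t).
  by rewrite /= -!map_comp; apply: eq_map => a /=; apply: e.
rewrite (wint_emb E) ?size_map ?size_tuple //.
by apply/allP => w /mapP[a _ ->].
Qed.

Lemma realized_tp2 (A : structure LPs) s N phi a b tau : @realized A s N phi ->
  @interp LPs A (inr tau) [tuple a; b] <-> tp2 s (phi a) (phi b) = tau.
Proof. by case=> _ _ _ _ /(_ (inr tau) [tuple a; b]). Qed.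

Lemma realized_relD (A : structure LPs) s N phi a b c d : @realized A s N phi ->
  relD (A := reduct A) a b c d <-> separated (phi a) (phi b) (phi c) (phi d).
Proof. by case=> _ _ _ _ /(_ (inl symD) [tuple a; b; c; d]). Qed.

Lemma realized_relK (A : structure LPs) s N phi p a : @realized A s N phi ->
  relK (A := reduct A) p a <-> lab s (phi a) = val p.
Proof. by case=> _ _ _ _ /(_ (inl (symK p)) [tuple a]). Qed.

Lemma degree_le (T : finType) (b : T -> word) a (l : seq word) : injective b ->
  (forall x, adj (b a) (b x) -> b x \in l) -> degree (word_rel b) a <= size l.
Proof.
move=> b_inj h; rewrite /degree cardE -(size_map b); apply: uniq_leq_size.
  by rewrite map_inj_uniq ?enum_uniq.
by move=> w /mapP[x]; rewrite mem_enum => hx ->; apply: h.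
Qed.

Lemma degree_ge (T : finType) (b : T -> word) a (l : seq word) : injective b -> uniq l ->
  {in l, forall w, exists2 x, adj (b a) (b x) & b x = w} ->
  size l <= degree (word_rel b) a.
Proof.
move=> b_inj ul h; rewrite /degree cardE -(size_map b); apply: uniq_leq_size => //.
by move=> w /h[x ax <-]; rewrite map_f // mem_enum.
Qed.

(** A tree of the class named by words, rooted at one of its own vertices. In contrast to
    [realized], every prefix is a vertex and letters only tell siblings apart. *)
Record word_model (A : structure (LP P)) (b : A -> word) : Prop := WordModel {
  model_inj : injective b;
  model_closed : forall x u, prefix u (b x) -> exists x', b x' = u;
  model_relD : forall x y z w,
    relD x y z w <-> separated (b x) (b y) (b z) (b w);
  model_degree2 : forall a, degree (word_rel b) a <> 2;
  model_relK : forall a, exists p : set_type P,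
    [/\ relK p a, forall q : set_type P, relK q a -> q = p &
        le_bound (degree (word_rel b) a) (val p)] }.

Lemma FP_of_model (A : structure (LP P)) (b : A -> word) :
  0 < #|A| -> word_model b -> FP A.
Proof.
move=> A0 [inj clos hD h2 hK]; exists (word_rel b); split=> //.
  exact: word_rel_tree.
by move=> x y z w; rewrite hD; split=> /(word_separated inj clos).
Qed.

Lemma FP_model (A : structure (LP P)) (r : A) : FP A ->
  exists2 b : A -> word, word_model b & b r = [::].
Proof.
move=> [e [te h2 hD hK]].
have [b [inj br clos ee]] := tree_words te r.
exists b => //; split=> // [x y z w|a|a]; last 2 first.
- by rewrite -ee.
- by rewrite -ee.
by rewrite hD ee; split=> /(word_separated inj clos).
Qed.

Lemma FP_card (A : structure (LP P)) : FP A -> 0 < #|A|.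
Proof. by move=> [e [/tree_nonempty]]. Qed.

Lemma FP_iso (A B : structure (LP P)) : isomorphic A B -> FP A -> FP B.
Proof.
move=> [f [[f_inj fP] [g fK gK]]] hA.
have /card_gt0P[r _] := FP_card hA.
have [b [inj clos hD h2 hK] _] := FP_model r hA.
have fD x y z w : relD (f x) (f y) (f z) (f w) <-> relD x y z w.
  have := fP symD [tuple x; y; z; w]; rewrite /relD => ->.
  by rewrite (_ : map_tuple f _ = [tuple f x; f y; f z; f w]) //; apply: val_inj.
have fK' p x : relK p (f x) <-> relK p x.
  have := fP (symK p) [tuple x]; rewrite /relK => ->.
  by rewrite (_ : map_tuple f _ = [tuple f x]) //; apply: val_inj.
have degE y : degree (word_rel (b \o g)) y = degree (word_rel b) (g y).
  rewrite /degree -(fintype.card_image f_inj); apply: eq_card => z.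
  apply/idP/fintype.imageP => [hz|[x hx ->]]; last by rewrite inE /word_rel /= fK.
  by exists (g z); rewrite ?gK.
apply: (@FP_of_model _ (b \o g)); first by apply/card_gt0P; exists (f r).
split=> [|x u /clos[x' <-]|x y z w|a|a].
- exact: inj_comp inj (can_inj gK).
- by exists (f x'); rewrite /= fK.
- by rewrite -hD -fD !gK.
- by rewrite degE.
- have [p [h1 h2' h3]] := hK (g a); exists p; rewrite degE -[a]gK.
  split; [exact/fK'|by move=> q /fK'; apply: h2'|by rewrite fK].
Qed.

(** The median of three words is a prefix of one of them, hence the word of a vertex. *)
Lemma FP_median (A : structure (LP P)) : FP A -> forall x y z, exists m : A,
  [/\ ~ relD x y m m, ~ relD y z m m & ~ relD x z m m].
Proof.
move=> hA x y z; have [b [inj clos hD _ _] _] := FP_model x hA.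
have [m em] : exists m, b m = med (b x) (b y) (b z).
  by have [/clos|/clos] := med_prefix (b x) (b y) (b z).
have [h1 h2 h3] := med_betw (b x) (b y) (b z).
by exists m; split; rewrite hD separated_cc em ?h1 ?h2 ?h3.
Qed.

Lemma FP_word_structure s N (A : structure LPs) (b : A -> word) :
  @realized A s N b -> 0 < #|A| ->
  (forall x u, prefix u (b x) -> exists x', b x' = u) ->
  (forall a, degree (word_rel b) a <> 2) ->
  (forall a, le_bound (degree (word_rel b) a) (lab s (b a))) ->
  FP (reduct A).
Proof.
move=> H A0 clos deg2 degle.
have [gs lN binj nb _] := H.
apply: (@FP_of_model (reduct A) b) => //; split=> // [x y z w|a].
  exact: realized_relD H.
have pl : P (lab s (b a)) by apply/gs/mem_nth/(node_size (nb a)).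
exists (SigSub (mem_set pl)); split; rewrite ?(realized_relK _ _ H) //.
by move=> q /(realized_relK _ _ H) e; apply: val_inj; rewrite -e.
Qed.

(** The bottom vertex of a homogeneous tree lacks the edge towards the root, so with label 3 its
    degree could be 2. One more vertex below it, of degree at most 1, supplies this edge. *)
Definition planted (N : nat) (s : levels) : seq word :=
  [::] :: [seq 0 :: w | w <- words N s].

Lemma mem_planted N s w : (w \in planted N s) =
  if w is i :: w' then (i == 0) && node N s w' else true.
Proof.
case: w => [|i w]; first by rewrite mem_head.
rewrite inE /=; apply/mapP/andP => [[w' hw [-> ->]]|[/eqP -> hw]].
  by rewrite -mem_words.
by exists w => //; rewrite mem_words.
Qed.

Lemma node_rcons N s v i :
  node N s (rcons v i) =
  [&& node N s v, i < width N (lab s v) & (size v).+1 < size s].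
Proof.
elim: v s => [|j v IH] [|q s] //=; last first.
  by rewrite IH ltnS -andbA.
by rewrite /lab /= ltnS lt0n; case: s => //=; rewrite ?andbT ?andbF.
Qed.

Lemma planted_node N q s w : 1 < N -> good P (q :: s) -> w \in planted N s ->
  node N (q :: s) w.
Proof.
rewrite mem_planted; case: w => [//|i w] lN gs /andP[/eqP -> nw] /=.
by rewrite nw andbT (good_width0 hP lN gs) // mem_head.
Qed.

Lemma realized_planted N q s : 1 < N -> good P (q :: s) ->
  @realized (word_structure (q :: s) (planted N s)) (q :: s) N val.
Proof. by move=> lN gs; apply: realized_words => // w; apply: planted_node. Qed.

Lemma planted_closed N s (x : seq_sub (planted N s)) u : prefix u (val x) ->
  exists x' : seq_sub (planted N s), val x' = u.
Proof.
move=> ux; have := valP x; rewrite /= in ux *; move: (ssval x) ux => w ux hw.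
suff hu : u \in planted N s by exists (SeqSub hu).
move: ux hw; rewrite !mem_planted; case: u => [//|i u]; case: w => [//|j w] /=.
by case/andP=> /eqP -> uw /andP[-> /node_prefix ->].
Qed.

Lemma FP_planted N q s : 1 < N -> good P (q :: s) ->
  FP (reduct (word_structure (q :: s) (planted N s))).
Proof.
move=> lN gs.
pose W := planted N s.
have ge3 w : w \in W -> le_bound 3 (lab (q :: s) w).
  by move=> /(planted_node lN gs) nw; apply/hP/gs/mem_nth/(node_size nw).
have mem (w : word) : w \in W -> exists x : seq_sub W, val x = w.
  by move=> hw; exists (SeqSub hw).
have bound1 d w : d <= 1 -> w \in W -> d <> 2 /\ le_bound d (lab (q :: s) w).
  by move=> ld /ge3; case: (lab _ _) => [p|] /=; split=> //; lia.
have main (a : seq_sub W) : degree (word_rel (val : seq_sub W -> word)) a <> 2 /\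
    le_bound (degree (word_rel (val : seq_sub W -> word)) a) (lab (q :: s) (val a)).
  have inj := @val_inj _ _ (seq_sub W).
  have := valP a; rewrite /= -/W; case ea: (ssval a) => [|i v].
    apply: bound1; apply: (degree_le (l := [:: [:: 0]])) inj _ => x.
    rewrite /= ea => /adj_cases[[i]|[i e]]; first by move/(congr1 size); rewrite size_rcons.
    by have := valP x; rewrite /= e mem_planted /= inE => /andP[/eqP ->].
  move=> hw; have := hw; rewrite mem_planted => /andP[/eqP i0 nv].
  rewrite i0 in ea hw *.
  have nbr (x : seq_sub W) : adj (val a) (val x) ->
      val x = par (0 :: v) \/ exists2 i, val x = 0 :: rcons v i & node N s (rcons v i).
    rewrite /= ea => /adj_cases[[j ->]|[j e]]; first by left; rewrite par_rcons.
    by right; exists j => //; have := valP x; rewrite /= e mem_planted /=.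
  have [lsz|lsz] := ltnP (size v).+1 (size s); last first.
    apply: bound1 => //; apply: (degree_le (l := [:: par (0 :: v)])) inj _ => x.
    move=> /nbr[->|[j _]]; first exact: mem_head.
    by rewrite node_rcons => /and3P[_ _]; rewrite ltnNge lsz.
  have nc j : j < width N (lab s v) -> node N s (rcons v j).
    by move=> lj; rewrite node_rcons nv lj.
  have w2 : 1 < width N (lab s v).
    apply: (good_width hP lN (good_behead gs)); exact/mem_nth/ltnW.
  split.
    suff h : 3 <= degree (word_rel (val : seq_sub W -> word)) a by move=> e; rewrite e in h.
    apply: (@degree_ge _ _ _ [:: par (0 :: v); 0 :: rcons v 0; 0 :: rcons v 1] inj).
      rewrite /= !inE !negb_or andbT; apply/andP; split.
        by apply/andP; split; apply/eqP => /(congr1 size);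
          rewrite size_par /= size_rcons; lia.
      by apply/eqP => -[/rcons_inj[]].
    have child j : j < 2 -> exists2 x : seq_sub W,
        adj (val a) (val x) & val x = 0 :: rcons v j.
      move=> lj; have [|x ex] := mem (0 :: rcons v j).
        by rewrite mem_planted /= nc // (leq_trans lj).
      by exists x => //; rewrite ex /= ea -rcons_cons adj_rcons.
    move=> w; rewrite !inE => /or3P[]/eqP ->; [|exact: child|exact: child].
    have [|x ex] := planted_closed (x := a) (u := par (0 :: v)).
      by rewrite /= ea prefix_par.
    by exists x => //; rewrite ex /= ea /adj eqxx.
  have -> : lab (q :: s) (0 :: v) = lab s v by [].
  case el: (lab s v) => [p|] //=; rewrite el /= in nc w2.
  have -> : p = size (par (0 :: v) :: [seq 0 :: rcons v i | i <- iota 0 p.-1]).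
    by rewrite /= size_map size_iota; lia.
  apply: degree_le inj _ => x /nbr[->|[j -> ]]; first exact: mem_head.
  rewrite node_rcons el /= => /and3P[_ lj _].
  by rewrite inE orbC; apply/orP; left; apply/mapP; exists j; rewrite ?mem_iota.
apply: FP_word_structure (realized_planted lN gs) _ _ _ _.
- by apply/card_gt0P; have [x _] := mem [::] (mem_head _ _); exists x.
- exact: planted_closed.
- by move=> a; case: (main a).
- by move=> a; case: (main a).
Qed.

Lemma FPs_planted N q s : 1 < N -> good P (q :: s) ->
  FPs (word_structure (q :: s) (planted N s)).
Proof.
move=> lN gs; split; first exact: FP_planted.
by exists (q :: s), N, val; apply: realized_planted.
Qed.

Lemma embeds_planted (A : structure LPs) s N phi s' N' h q :
  @realized A s N phi -> emb s N s' N' h -> 1 < N' -> good P (q :: s') ->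
  exists2 f : A -> word_structure (q :: s') (planted N' s'), is_embedding f &
    forall a, val (f a) = 0 :: h (phi a).
Proof.
move=> H E lN gs.
have [_ _ _ nphi _] := H.
have mem a : 0 :: h (phi a) \in planted N' s'.
  by rewrite mem_planted /=; apply: (emb_node E).
exists (fun a => SeqSub (mem a)) => //.
apply: (realized_embedding H (realized_planted lN gs) (h := cons 0 \o h)) => //.
apply: emb_trans E; apply: emb_cons.
by apply: (good_width0 hP lN gs); rewrite mem_head.
Qed.

End Expansion.

(** * Ramsey property, joint embedding and amalgamation of the expanded class *)

Lemma embedding_ext (L : language) (A B : structure L) (f g : embedding A B) :
  f =1 g -> f = g.
Proof.
case: f g => [f Hf] [g Hg] /= /funext e.
by subst g; congr Embedding; apply: Prop_irrelevance.
Qed.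

(* Colour an embedding of [A] according to whether it factors through [f]. *)
Lemma Ramsey_amalgamation (L : language) (G : class L) :
  Ramsey_class G -> joint_embedding G -> amalgamation G.
Proof.
move=> hR hJ A B C f g GA GB GC.
have [E [GE [i Hi] [j Hj]]] := hJ B C GB GC.
pose i' := Embedding Hi; pose j' := Embedding Hj.
have AE : embeds A E by exists (emb_comp i' f); apply: emb_funP.
have [D GD HD] := hR A E GA GE AE 2 isT.
pose extends (e : embedding A D) := exists r : embedding B D, forall a, r (f a) = e a.
pose c e : 'I_2 := if `[< extends e >] then ord0 else ord_max.
have [h [k hk]] := HD c.
have : c (emb_comp h (emb_comp j' g)) = ord0.
  rewrite hk -(hk (emb_comp i' f)) /c; case: asboolP => // nx.
  by case: nx; exists (emb_comp h i').
rewrite /c; case: asboolP => // [[r hr] _].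
by exists D, r, (emb_comp h j'); split.
Qed.

(** The meet of [x] and [y] may be no element, but when it is not below [z] it equals the median
    [m]. So prefix relations between elements decide the question. *)
Lemma betw_med_prefix x y z m : betw x m y -> betw y m z -> betw x m z ->
  prefix (lcp x y) z = ~~ [&& prefix m x, prefix m y & ~~ prefix m z].
Proof.
move=> /andP[lm _] /andP[_ h2] /andP[_ h3].
have [mz|nmz] := boolP (prefix m z).
  by rewrite !andbF (prefix_trans lm mz).
move: h2 h3; rewrite (negbTE nmz) !orbF => my mx; rewrite mx my /=.
by apply: contraNF nmz => /(prefix_trans _); apply; rewrite prefix_lcp mx.
Qed.

Section Expansion.
Variables (P : set (option nat)) (hP : forall p, P p -> le_bound 3 p).
Let LPs := lang_union (LP P) type_language.

(** Binary types are symbols of the language; the ternary clause follows from a median in [A], which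
    [D] exhibits as a median in both realisations. *)
Lemma cop_embedding (A B : structure LPs) s N phi s' N' psi (f : A -> B) :
  FP (reduct A) -> @realized P A s N phi -> @realized P B s' N' psi ->
  is_embedding f -> cop s phi [set: A] s' N' (psi \o f).
Proof.
move=> hA HA HB [f_inj fP].
have tpE a b : tp2 s' (psi (f a)) (psi (f b)) = tp2 s (phi a) (phi b).
  apply/(realized_tp2 _ _ _ HB).
  have := fP (inr (tp2 s (phi a) (phi b))) [tuple a; b].
  rewrite (_ : map_tuple f _ = [tuple f a; f b]); last exact: val_inj.
  by move=> <-; apply/(realized_tp2 _ _ _ HA).
have preE a b : prefix (psi (f a)) (psi (f b)) = prefix (phi a) (phi b).
  exact: tp2_eq_prefix (tpE a b).
have nD (a b m : A) : ~ relD (A := reduct A) a b m m ->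
    betw (phi a) (phi m) (phi b) /\ betw (psi (f a)) (psi (f m)) (psi (f b)).
  move=> h; split; apply: contra_notT h; rewrite -separated_cc.
    by move/(realized_relD _ _ _ _ HA).
  move/(realized_relD _ _ _ _ HB); rewrite /relD.
  have := fP (inl symD) [tuple a; b; m; m].
  rewrite (_ : map_tuple f _ = [tuple f a; f b; f m; f m]); last exact: val_inj.
  by move=> e /e.
have [_ _ _ nB _] := HB.
split=> [a _|a b _ _|a b c _ _ _] /=; [exact: nB|exact: tpE|].
have [m [/nD[h1 k1] /nD[h2 k2] /nD[h3 k3]]] := FP_median hA a b c.
by rewrite (betw_med_prefix h1 h2 h3) (betw_med_prefix k1 k2 k3) !preE.
Qed.

Lemma realized_label (A : structure LPs) s N phi (a : A) :
  @realized P A s N phi -> P (lab s (phi a)).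
Proof. by case=> gs _ _ na _; apply/gs/mem_nth/(node_size (na a)). Qed.

Lemma FPs_Ramsey : Ramsey_class (@FPs P).
Proof.
move=> A B [hA [sA [NA [phi HA]]]] [hB [s [N [psi HB]]]] [f0 _] r r2.
have /card_gt0P[a0 _] := FP_card hA.
(* The additional vertex of the planted tree needs a label from [P]; one that occurs in [B] will
   do. *)
have Pq := realized_label (f0 a0) HB; set q := lab s _ in Pq.
have [gs lN _ _ _] := HB.
have [s' [N' [gs' le' HR]]] := tree_ramsey hP sA phi [set: A] 'I_r gs lN.
have lN' : 1 < N' by apply: leq_trans le'.
have gqs' := good_cons Pq gs'.
pose C := @word_structure P (q :: s') (planted N' s').
exists C; first exact: FPs_planted.
move=> c.
pose codes (y : A -> word) (g : embedding A C) := forall a, val (g a) = 0 :: y a.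
pose k0 : 'I_r := Ordinal (ltnW r2).
(* Placements which do not come from an embedding into [C] get the default colour [k0]. *)
pose c' y : 'I_r :=
  if pselect (exists g, codes y g) is left e then c (projT1 (cid e)) else k0.
have c'E y g : codes y g -> c' y = c g.
  move=> hg; rewrite /c'; case: pselect => [e|[]]; last by exists g.
  case: (cid e) => g' hg' /=; congr c; apply: embedding_ext => a.
  by apply: val_inj; rewrite hg' hg.
have [|h [k [Eh hk]]] := HR c'.
  by move=> y y' e; congr (c' _); apply/funext => a; apply: e; rewrite inE.
have [hB' HhB' hv] := embeds_planted hP HB Eh lN' gqs'.
exists (Embedding HhB'), k => f.
rewrite -(hk (psi \o f)); last exact: (cop_embedding hA HA HB (emb_funP f)).
by apply/esym/c'E => a /=; rewrite hv.
Qed.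

Lemma FPs_joint_embedding : joint_embedding (@FPs P).
Proof.
move=> A B [hA [s1 [N1 [phi HA]]]] [hB [s2 [N2 [psi HB]]]].
have /card_gt0P[a0 _] := FP_card hA.
have Pq := realized_label a0 HA; set q := lab s1 _ in Pq.
have [gs1 lN1 _ _ _] := HA; have [gs2 lN2 _ _ _] := HB.
pose N := maxn N1 N2.
have lN : 1 < N by rewrite (leq_trans lN1) // leq_maxl.
have gs := good_cat gs1 gs2; have gqs := good_cons Pq gs.
have E1 : emb s1 N1 (s1 ++ s2) N id.
  exact: emb_trans (emb_catr _ _ _) (emb_widen _ (leq_maxl _ _)).
have E2 : emb s2 N2 (s1 ++ s2) N (cat (nseq (size s1) 0)).
  apply: emb_trans (emb_pad _ _) (emb_widen _ (leq_maxr _ _)).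
  exact: (good_width0 hP).
exists (@word_structure P (q :: s1 ++ s2) (planted N (s1 ++ s2))); split.
- exact: FPs_planted.
- by have [f Hf _] := embeds_planted hP HA E1 lN gqs; exists f.
- by have [f Hf _] := embeds_planted hP HB E2 lN gqs; exists f.
Qed.

Lemma FPs_iso (A B : structure LPs) : isomorphic A B -> FPs A -> FPs B.
Proof.
move=> [f [[f_inj fP] [g fK gK]]] [hA [s [N [phi [gs lN iphi nphi HA]]]]]; split.
  by apply: FP_iso hA; exists f; split; [split=> // R t; apply: (fP (inl R))|exists g].
exists s, N, (phi \o g); split=> // [|b|R t]; [exact: inj_comp iphi (can_inj gK)|exact: nphi|].
have -> : t = map_tuple f (map_tuple g t).
  by apply: val_inj; rewrite /= -map_comp map_id_in // => b _ /=; rewrite gK.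
rewrite -fP HA; have -> // : map (phi \o g) (map_tuple f (map_tuple g t)) =
  map phi (map_tuple g t).
by rewrite /= -!map_comp; apply: eq_map => b /=; rewrite fK.
Qed.

Lemma FPs_countable : exists E : nat -> structure LPs,
  forall A, FPs A -> exists n, isomorphic A (E n).
Proof.
pose decode n : structure LPs :=
  if unpickle n is Some (s, W) then @word_structure P s W else @word_structure P [::] [::].
exists decode => A [_ [s [N [phi H]]]]; have [gs lN iphi nphi _] := H.
exists (pickle (s, codom phi)); rewrite /decode pickleK.
have HW : @realized P (word_structure P s (codom phi)) s N val.
  by apply: realized_words => // w /codomP[a ->].
exists (fun a => SeqSub (codom_f phi a)); split.
  exact: (realized_embedding H HW (emb_id s N)).
exists (fun x : seq_sub (codom phi) => iinv (valP x)) => [a|x].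
  by apply: iphi; rewrite f_iinv.
by apply: val_inj => /=; rewrite f_iinv.
Qed.

Lemma countable_symbols : countable [set: sym LPs].
Proof.
pose code (R : sym LPs) : option (option nat) + (option nat * option nat * option nat) :=
  match R with
  | inl symD => inl None
  | inl (symK p) => inl (Some (val p))
  | inr tau => inr tau
  end.
apply/countable_injP; exists (pickle \o code) => R R' _ _ /= /(pcan_inj pickleK).
by case: R R' => [[|p]|tau] [[|p']|tau'] //= [] => [/val_inj ->|->].
Qed.

Lemma FPs_Fraisse : Fraisse_HP (@FPs P).
Proof.
split.
- exact: countable_symbols.
- exact: FPs_iso.
- exact: FPs_countable.
- exact: FPs_joint_embedding.
- exact: Ramsey_amalgamation FPs_Ramsey FPs_joint_embedding.
Qed.

Lemma FPs_relative_HP : relative_HP (@FP P) (@FPs P).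
Proof.
move=> B S hB hS j [_ [s [N [phi [gs lN iphi nphi H]]]]]; split; first exact: hS.
exists s, N, (phi \o val); split=> // [|a|R t]; [exact: inj_comp iphi val_inj|exact: nphi|].
by have := H R (map_tuple val t); rewrite /= -map_comp.
Qed.

End Expansion.

(** * Realising a tree in a homogeneous tree *)

(** Counting: in the second alternative, the values of [d0] leave at least as many free values below
    [n] as there are new arguments; in the first there are no new ones. *)
Lemma extend_injection (C : seq nat) (D : pred nat) (d0 : nat -> nat) n :
  uniq C -> {in [pred i in C | D i] &, injective d0} ->
  {in [pred i in C | D i], forall i, d0 i < n} ->
  all D C \/ size C <= n ->
  exists d, [/\ {in C &, injective d}, {in C, forall i, d i < n} &
    {in [pred i in C | D i], d =1 d0}].
Proof.
move=> uC inj0 lt0 [/allP hD|szC].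
  exists d0; split=> // [i j iC jC|i iC]; last by apply: lt0; rewrite inE iC hD.
  by apply: inj0; rewrite inE ?iC ?jC hD.
pose CD := [seq i <- C | D i]; pose CN := [seq i <- C | ~~ D i].
pose V := [seq i <- iota 0 n | i \notin map d0 CD].
have memCD i : (i \in CD) = (i \in [pred i in C | D i]) by rewrite mem_filter inE andbC.
have uV : uniq V by rewrite filter_uniq // iota_uniq.
have szV : size CN <= size V.
  have szCD : size CD + size CN = size C by rewrite !size_filter count_predC.
  have : size [seq i <- iota 0 n | i \in map d0 CD] <= size CD.
    rewrite -(size_map d0); apply: uniq_leq_size; first by rewrite filter_uniq ?iota_uniq.
    by move=> i; rewrite mem_filter => /andP[].
  have : size [seq i <- iota 0 n | i \in map d0 CD] + size V = n.
    by rewrite !size_filter count_predC size_iota.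
  lia.
have memV i : i \in C -> ~~ D i -> nth 0 V (index i CN) \in V.
  by move=> iC nD; rewrite mem_nth // (leq_trans _ szV) // index_mem mem_filter nD.
exists (fun i => if D i then d0 i else nth 0 V (index i CN)); split=> [i j iC jC|i iC|i].
- case: (boolP (D i)) => Di; case: (boolP (D j)) => Dj.
  + by apply: inj0; rewrite inE ?iC ?jC.
  + move=> e; have := memV j jC Dj; rewrite -e mem_filter => /andP[/negP[]].
    by rewrite map_f // memCD inE iC.
  + move=> e; have := memV i iC Di; rewrite e mem_filter => /andP[/negP[]].
    by rewrite map_f // memCD inE jC.
  + have iN : i \in CN by rewrite mem_filter Di.
    have jN : j \in CN by rewrite mem_filter Dj.
    move=> /eqP; rewrite nth_uniq ?(leq_trans _ szV) ?index_mem // => /eqP e.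
    by rewrite -(nth_index 0 iN) e nth_index.
- case: (boolP (D i)) => Di; first by apply: lt0; rewrite inE iC.
  by have := memV i iC Di; rewrite mem_filter mem_iota => /and3P[].
- by rewrite inE => /andP[_ ->].
Qed.

Section Realize.
Variables (N : nat) (ls : levels) (label : word -> option nat).
Variables (dir : word -> nat -> nat) (U : word -> Prop).
Hypothesis ls_width : {in ls, forall q, 0 < width N q}.
Hypothesis U_prefix : forall u v, prefix u v -> U v -> U u.
Hypothesis U_label : forall u, U u -> label u \in ls.
Hypothesis U_dir : forall u i, U (rcons u i) -> dir u i < width N (label u).
Hypothesis U_inj : forall u i j, U (rcons u i) -> U (rcons u j) ->
  dir u i = dir u j -> i = j.

(* Each letter of a word is realised inside one block [ls], at the level of the
   block which carries the required label. *)
Fixpoint realize (u w : word) : word :=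
  nseq (index (label u) ls) 0 ++
  if w is i :: w' then
    dir u i :: nseq (size ls - (index (label u) ls).+1) 0 ++ realize (rcons u i) w'
  else [::].

Definition blocks (M : nat) : levels := flatten (nseq M ls).

Lemma node_index q s : q \in ls -> node N (ls ++ s) (nseq (index q ls) 0).
Proof.
move=> qls; rewrite -{1}(cat_take_drop (index q ls) ls) -catA.
have szt : size (take (index q ls) ls) = index q ls by rewrite size_takel // index_size.
have wt : {in take (index q ls) ls, forall r, 0 < width N r}.
  by move=> r /mem_take; apply: ls_width.
have := emb_node (emb_pad (drop (index q ls) ls ++ s) wt) (x := [::]).
by rewrite szt cats0; apply; rewrite (drop_nth None) // index_mem.
Qed.

Lemma realize_node u w M : U (u ++ w) -> size w < M ->
  node N (blocks M) (realize u w).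
Proof.
elim: w u M => [|i w IH] u [|M] //= Uw lM; have Uu := U_prefix (prefix_prefix u _) Uw.
  by rewrite cats0; apply/node_index/U_label.
have Uui : U (rcons u i) by apply: U_prefix Uw; rewrite -cat_rcons prefix_prefix.
rewrite -cat_rcons in Uw.
have lu := U_label Uu.
have nz : node N ls (nseq (index (label u) ls) 0) by rewrite -[ls in node _ ls]cats0 node_index.
have := emb_node (emb_graft (i := dir u i) (blocks M) ls_width nz _) (IH _ _ Uw lM).
by rewrite /lab size_nseq nth_index //; apply; apply: U_dir.
Qed.

Lemma realize_lab u w M : U (u ++ w) -> size w < M ->
  lab (blocks M) (realize u w) = label (u ++ w).
Proof.
elim: w u M => [|i w IH] u [|M] //= Uw lM; have Uu := U_prefix (prefix_prefix u _) Uw.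
  by rewrite /lab !cats0 size_nseq nth_cat index_mem U_label // nth_index // U_label.
have Uui : U (rcons u i) by apply: U_prefix Uw; rewrite -cat_rcons prefix_prefix.
rewrite -cat_rcons in Uw *; rewrite -(IH _ _ Uw lM) {IH Uw}.
have := U_label Uu; rewrite -index_mem /lab !size_cat /= size_cat !size_nseq nth_cat => h.
by rewrite ifF; [congr nth|]; lia.
Qed.

Lemma realize_dir u v i w :
  prefix (rcons (realize u v) (dir (u ++ v) i)) (realize u (v ++ i :: w)).
Proof.
elim: v u => [|j v IH] u /=.
  by rewrite !cats0 -[X in prefix _ X]cat_rcons prefix_prefix.
rewrite rcons_cat rcons_cons rcons_cat.
rewrite prefix_catr // eqxx /= eqxx prefix_catr // eqxx /=.
by rewrite -cat_rcons; apply: IH.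
Qed.

Lemma realize_lcp u w w' : U (u ++ w) -> U (u ++ w') ->
  lcp (realize u w) (realize u w') = realize u (lcp w w').
Proof.
have pre v : prefix (realize u [::]) (realize u v) by rewrite /= cats0; case: v => [|i v] /=;
  rewrite ?cats0 ?prefix_refl ?prefix_prefix.
elim: w u w' pre => [|i w IH] u [|j w'] pre Uw Uw'.
- by rewrite lcpxx.
- by rewrite (lcp_idPl (pre _)).
- by rewrite (lcp_idPr (pre _)).
have Ui : U (rcons u i) by apply: U_prefix Uw; rewrite -cat_rcons prefix_prefix.
have Uj : U (rcons u j) by apply: U_prefix Uw'; rewrite -cat_rcons prefix_prefix.
rewrite [lcp (i :: w) _]/=; case: eqP => [eij|/eqP nij].
  subst j; rewrite /= lcp_cat /= eqxx lcp_cat IH //; rewrite ?cat_rcons //.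
  move=> v /=; rewrite cats0; case: v => [|k v] /=;
  by rewrite ?cats0 ?prefix_refl ?prefix_prefix.
apply: (prefix_lcp_rcons (realize_dir u [::] i w) (realize_dir u [::] j w')).
by rewrite cats0; apply: contra nij => /eqP /(U_inj Ui Uj) ->.
Qed.

Lemma realize_prefix w w' : U w -> U w' ->
  prefix (realize [::] w) (realize [::] w') = prefix w w'.
Proof.
move=> Uw Uw'; apply/idP/idP => [|h]; last first.
  by rewrite -(lcp_idPl h) -(@realize_lcp [::]) // lcp_prefixr.
move/lcp_idPl; rewrite realize_lcp //.
have [<- _|ne e] := eqVneq (lcp w w') w; first exact: lcp_prefixr.
have ew := prefix_decomp (lcp_prefixl w w') ne.
have := @realize_dir [::] (lcp w w') (nth 0 w (size (lcp w w')))
  (drop (size (lcp w w')).+1 w); rewrite cat0s -ew.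
by rewrite e => /size_prefix; rewrite size_rcons ltnn.
Qed.

Lemma realize_separated x y z w : U x -> U y -> U z -> U w ->
  separated (realize [::] x) (realize [::] y) (realize [::] z) (realize [::] w) =
  separated x y z w.
Proof.
move=> Ux Uy Uz Uw; rewrite /separated /betw !realize_lcp // !realize_prefix //;
apply: U_prefix (lcp_prefixl _ _) _ => //; apply: U_prefix (lcp_prefixl _ _) _ => //.
Qed.

End Realize.

(** * Extending a partial placement to a whole tree *)

Section Frame.
Variables (P : set (option nat)) (hP : forall p, P p -> le_bound 3 p).
Variables (B : finType) (gam : B -> word) (label : word -> option nat).
Variables (J : Type) (X Y : J -> word) (s : levels) (N : nat).
Hypothesis lN : 1 < N.
Hypothesis gam_inj : injective gam.
Hypothesis label_P : forall u, u = [::] \/ (exists x, gam x = u) -> P (label u).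
Hypothesis gam_closed : forall x u, prefix u (gam x) -> u = [::] \/ exists x', gam x' = u.
Hypothesis X_node : forall j, X j = [::] \/ exists x, gam x = X j.
Hypothesis Y_node : forall j, node N s (Y j).
Hypothesis XY_label : forall j, label (X j) = lab s (Y j).
Hypothesis XY_prefix : forall j k, prefix (X j) (X k) = prefix (Y j) (Y k).
Hypothesis XY_lcp : forall j k, exists m, X m = lcp (X j) (X k) /\ Y m = lcp (Y j) (Y k).
(* At a node the directions of [Y] suffice, or the label leaves enough room for
   an arbitrary choice of the remaining ones. *)
Hypothesis room : forall u, u = [::] \/ (exists x, gam x = u) ->
  ((exists j, X j = u) /\
   forall i x, prefix (rcons u i) (gam x) -> exists k, prefix (rcons u i) (X k)) \/
  (forall l, uniq l -> (forall i, i \in l -> exists x, gam x = rcons u i) ->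
   forall n, label u = Some n -> size l <= n.-1).

Let N' := N + #|B|.
Let U u := u = [::] \/ exists x, gam x = u.

Let U_prefix u v : prefix u v -> U v -> U u.
Proof.
move=> uv [ev|[x ex]]; first by left; move: uv; rewrite ev prefixs0 => /eqP.
by apply: (gam_closed (x := x)); rewrite ex.
Qed.

Let U_rcons u i : U (rcons u i) -> exists x, gam x = rcons u i.
Proof. by case=> [/(congr1 size)|//]; rewrite size_rcons. Qed.

(** The vertices [X j] have prescribed types, those of [Y j], which forces the directions at [X j]
    towards other prescribed vertices. Preservation of meets makes the forced values well defined
    and distinct; the others are filled in injectively. *)
Lemma frame_directions u : U u -> exists d,
  [/\ forall i j, U (rcons u i) -> U (rcons u j) -> d i = d j -> i = j,
      forall i, U (rcons u i) -> d i < width N' (label u) &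
      forall i j k, X j = u -> prefix (rcons u i) (X k) -> d i = nth 0 (Y k) (size (Y j))].
Proof.
move=> Uu.
pose kids := [seq x <- enum B | prefix u (gam x) && (u != gam x)].
pose C := undup [seq nth 0 (gam x) (size u) | x <- kids].
have memC i : i \in C <-> exists x, prefix (rcons u i) (gam x).
  rewrite mem_undup; split=> [/mapP[x]|[x ux]].
    rewrite mem_filter => /andP[/andP[ux nx] _] ->; exists x.
    exact: prefix_rcons_nth.
  move: (ux); rewrite prefix_rconsE => /and3P[ux' nx /eqP ei].
  by apply/mapP; exists x; rewrite // mem_filter ux' nx mem_enum.
have UC i : U (rcons u i) -> i \in C.
  by move=> /U_rcons[x ex]; apply/memC; exists x; rewrite ex prefix_refl.
have CU i : i \in C -> exists x, gam x = rcons u i.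
  by move=> /memC[x /gam_closed]; apply: U_rcons.
have XC i k : prefix (rcons u i) (X k) -> i \in C.
  have [->|[x <-] ux] := X_node k; first by rewrite prefixs0 -size_eq0 size_rcons.
  by apply/memC; exists x.
have XY_eq j k : (X j == X k) = (Y j == Y k).
  apply/eqP/eqP => e; apply: prefix_anti.
  - by rewrite -XY_prefix e prefix_refl.
  - by rewrite -XY_prefix e prefix_refl.
  - by rewrite XY_prefix e prefix_refl.
  - by rewrite XY_prefix e prefix_refl.
have dirE j i k i' k' : X j = u -> prefix (rcons u i) (X k) -> prefix (rcons u i') (X k') ->
    (nth 0 (Y k) (size (Y j)) == nth 0 (Y k') (size (Y j))) = (i == i').
  rewrite !prefix_rconsE => ej /and3P[uk nk /eqP <-] /and3P[uk' nk' /eqP <-].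
  apply: negb_inj; rewrite -!lcp_eqE //; try (by rewrite -XY_prefix ej);
    try (by rewrite -XY_eq ej).
  by have [m [<- <-]] := XY_lcp k k'; rewrite -ej XY_eq.
pose D i := `[< exists j k, X j = u /\ prefix (rcons u i) (X k) >].
have /choice[d0 Hd0] : forall i, exists d, forall j k, X j = u -> prefix (rcons u i) (X k) ->
    d = nth 0 (Y k) (size (Y j)).
  move=> i; case: (pselect (exists j k, X j = u /\ prefix (rcons u i) (X k))) => [|nD].
    case=> j [k [ej uk]]; exists (nth 0 (Y k) (size (Y j))) => j' k' ej' uk'.
    have -> : Y j' = Y j by apply/eqP; rewrite -XY_eq ej' ej.
    by apply/eqP; rewrite (dirE _ _ _ _ _ ej uk uk').
  by exists 0 => j k ej uk; case: nD; exists j, k.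
have [||||d [d_inj d_lt dE]] := @extend_injection C D d0 (width N' (label u)).
- exact: undup_uniq.
- move=> i i'; rewrite !inE => /andP[_ /asboolP[j [k [ej uk]]]].
  case/andP=> _ /asboolP[j' [k' [ej' uk']]].
  rewrite (Hd0 i _ _ ej uk) (Hd0 i' _ _ ej uk') => /eqP.
  by rewrite (dirE _ _ _ _ _ ej uk uk') => /eqP.
- move=> i; rewrite inE => /andP[_ /asboolP[j [k [ej uk]]]].
  rewrite (Hd0 i _ _ ej uk) -ej XY_label.
  apply: leq_trans (width_le (lab s (Y j)) (leq_addr _ _)).
  move: uk; rewrite prefix_rconsE -ej XY_prefix XY_eq => /and3P[h1 h2 _].
  exact: node_nth.
- have [[[j ej] hcov]|hroom] := room Uu.
    left; apply/allP => i /memC[x /hcov[k uk]]; apply/asboolP.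
    by exists j, k.
  right; case el: (label u) => [n|] /=.
    by apply: hroom el => //; apply: undup_uniq.
  (* At label omega the summand [#|B|] of the cut-off suffices, as [u] has at most that many
     children. *)
  apply: leq_trans (leq_addl _ _); apply: (leq_trans (size_undup _)).
  by rewrite size_map cardE size_filter count_size.
exists d; split=> [i j Ui Uj|i Ui|i j k ej uk].
- by apply: d_inj; apply: UC.
- by apply: d_lt; apply: UC.
- rewrite dE; first exact: Hd0.
  by rewrite inE (XC _ _ uk) /=; apply/asboolP; exists j, k.
Qed.

(** [psi] only has to reproduce the types of [Y], not its words: the tree is laid out anew in
    blocks, which offer every required label at every stage. *)
Lemma realize_frame : exists s' N' (psi : B -> word),
  [/\ [/\ good P s', 1 < N' & injective psi],
      forall x, node N' s' (psi x),
      forall x y z w, separated (psi x) (psi y) (psi z) (psi w) =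
        separated (gam x) (gam y) (gam z) (gam w),
      forall x, lab s' (psi x) = label (gam x) &
      forall j k x y, gam x = X j -> gam y = X k ->
        tp2 s' (psi x) (psi y) = tp2 s (Y j) (Y k)].
Proof.
have lN' : 1 < N' by apply: leq_trans lN (leq_addr _ _).
have /choice[dir Hdir] : forall u, exists d, U u ->
  [/\ forall i j, U (rcons u i) -> U (rcons u j) -> d i = d j -> i = j,
      forall i, U (rcons u i) -> d i < width N' (label u) &
      forall i j k, X j = u -> prefix (rcons u i) (X k) -> d i = nth 0 (Y k) (size (Y j))].
  move=> u; case: (pselect (U u)) => [/frame_directions[d Hd]|nU]; first by exists d.
  by exists id.
pose ls := label [::] :: [seq label (gam x) | x <- enum B].
have gls : good P ls.
  move=> q; rewrite inE => /orP[/eqP ->|/mapP[x _ ->]]; apply: label_P; first by left.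
  by right; exists x.
have wls := good_width0 hP lN' gls.
have Uls u : U u -> label u \in ls.
  by case=> [->|[x <-]]; rewrite inE ?eqxx // map_f ?orbT // mem_enum.
have Ur u i : U (rcons u i) -> U u by apply/U_prefix/prefix_rcons.
have Udir u i : U (rcons u i) -> dir u i < width N' (label u).
  by move=> Ui; have [_ h _] := Hdir u (Ur _ _ Ui); apply: h.
have Uinj u i j : U (rcons u i) -> U (rcons u j) -> dir u i = dir u j -> i = j.
  by move=> Ui Uj; have [h _ _] := Hdir u (Ur _ _ Ui); apply: h.
have Ugam x : U (gam x) by right; exists x.
(* A word takes up one block for each letter and one for its end. *)
pose M := \max_(x : B) (size (gam x)).+1.
have lM x : size (gam x) < M by apply: (leq_bigmax x).
pose rl := realize ls label dir [::].
have rl_prefix := realize_prefix ls label U_prefix Uinj.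
have rl_lcp u v (Uu : U u) (Uv : U v) := realize_lcp ls label U_prefix Uinj (u := [::]) Uu Uv.
exists (blocks ls M), N', (rl \o gam); split.
- split=> //.
    move=> q /flattenP[l]; rewrite mem_nseq => /andP[_ /eqP ->]; exact: gls.
  move=> x y /= e; apply: gam_inj; apply: prefix_anti.
    by rewrite -rl_prefix // -/rl e prefix_refl.
  by rewrite -rl_prefix // -/rl e prefix_refl.
- by move=> x; apply: (realize_node wls U_prefix Uls Udir (u := [::])) => //=.
- move=> x y z w; exact: (realize_separated ls label U_prefix Uinj).
- by move=> x; rewrite (realize_lab dir U_prefix Uls (u := [::])) //=.
move=> j k x y ej ek /=.
have [m [eX eY]] := XY_lcp j k.
have Um : U (X m) by apply: X_node.
have lm : size (X m) < M.
  by rewrite eX -ej (leq_ltn_trans _ (lM x)) // size_prefix // lcp_prefixl.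
have onthE j' x' : gam x' = X j' -> prefix (X m) (X j') ->
    onth (rl (gam x')) (size (rl (X m))) = onth (Y j') (size (Y m)).
  move=> ex' mj; have [e|ne] := eqVneq (X m) (X j').
    rewrite ex' -e !onth_default //.
    by have /size_prefix -> : prefix (Y j') (Y m) by rewrite -XY_prefix e prefix_refl.
  have ne' : Y m != Y j'.
    apply: contra ne => /eqP e; apply/eqP; apply: prefix_anti => //.
    by rewrite XY_prefix e prefix_refl.
  have mj' : prefix (Y m) (Y j') by rewrite -XY_prefix.
  have [_ _ Hd] := Hdir _ Um.
  rewrite (onth_rcons_prefix (prefix_rcons_nth mj' ne')).
  rewrite -(Hd _ _ _ (erefl _) (prefix_rcons_nth mj ne)).
  apply: onth_rcons_prefix.
  have := @realize_dir ls label dir [::] (X m) (nth 0 (X j') (size (X m)))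
    (drop (size (X m)).+1 (X j')).
  by rewrite cat0s -prefix_decomp // -ex'.
have e : lcp (rl (gam x)) (rl (gam y)) = rl (X m) by rewrite rl_lcp // ej ek -eX.
rewrite /tp2 e -eY (onthE j x ej) ?eX ?lcp_prefixl //.
rewrite -eX (onthE k y ek) ?eX ?lcp_prefixr // -eX.
congr norm; rewrite -XY_label.
by rewrite (realize_lab dir U_prefix Uls (u := [::])) //=.
Qed.

End Frame.

(** * Reasonability *)

Lemma betw_refl_eq x y : betw x y x -> y = x.
Proof. by rewrite /betw lcpxx orbb => /andP[h1 h2]; apply: prefix_anti. Qed.

Lemma betw_above z x y : prefix z x -> prefix z y -> betw z x y = prefix x y.
Proof.
move=> zx zy; rewrite /betw lcp_idPl // zx /=; apply/orP/idP => [[|//]|->]; last by right.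
by move/prefix_trans; apply.
Qed.

Lemma med_lcp x y z m : betw x m y -> betw y m z -> betw x m z ->
  ~~ prefix m z \/ (prefix z x /\ prefix z y) -> m = lcp x y.
Proof.
move=> /andP[lm _] /andP[_ h2] /andP[_ h3] hz; apply: prefix_anti => //.
rewrite prefix_lcp; case: hz => [/negbTE nmz|[zx zy]].
  by move: h2 h3; rewrite nmz !orbF => -> ->.
by apply/andP; split; [case/orP: h3|case/orP: h2] => // /prefix_trans; apply.
Qed.

(* Subdivide the edge from the root [[::]] to its child [[:: j]] and take the new
   vertex as the root. *)
Section Reroot.
Variable j : nat.

Definition reroot (w : word) : word :=
  if w is i :: w' then (if i == j then 1 :: w' else 0 :: w) else [:: 0].

Definition inside (w : word) : bool := prefix [:: j] w.

Lemma insideP w : reflect (exists v, w = j :: v) (inside w).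
Proof.
rewrite /inside; case: w => [|i w] /=; first by constructor; case.
rewrite prefix0s andbT; apply: (iffP eqP) => [->|[v [->]] //]; by exists w.
Qed.

Lemma reroot_in v : reroot (j :: v) = 1 :: v. Proof. by rewrite /= eqxx. Qed.

Lemma reroot_out w : ~~ inside w -> reroot w = 0 :: w.
Proof.
case: w => //= i w; rewrite /inside /= prefix0s andbT eq_sym.
by case: eqP.
Qed.

Lemma reroot_nil w : reroot w != [::].
Proof. by case: w => //= i w; case: ifP. Qed.

Lemma reroot_inj : injective reroot.
Proof.
move=> x y; case: (boolP (inside x)) => [/insideP[x' ->]|/reroot_out ->];
case: (boolP (inside y)) => [/insideP[y' ->]|/reroot_out ->]; rewrite ?reroot_in //.
  by case=> ->.
by case.
Qed.

Lemma reroot_lcp x y :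
  lcp (reroot x) (reroot y) = if inside x == inside y then reroot (lcp x y) else [::].
Proof.
case: (boolP (inside x)) => [/insideP[x' ->]|nx];
case: (boolP (inside y)) => [/insideP[y' ->]|ny].
- by rewrite !reroot_in /= eqxx /= eqxx.
- by rewrite reroot_in reroot_out.
- by rewrite reroot_in reroot_out.
rewrite !reroot_out //=; apply: contra nx => h.
exact: prefix_trans h (lcp_prefixl _ _).
Qed.

Lemma reroot_prefix x y :
  prefix (reroot x) (reroot y) = (inside x == inside y) && prefix x y.
Proof.
case: (boolP (inside x)) => [/insideP[x' ->]|nx];
case: (boolP (inside y)) => [/insideP[y' ->]|ny].
- by rewrite !reroot_in /= eqxx.
- by rewrite reroot_in reroot_out.
- by rewrite reroot_in reroot_out.
by rewrite !reroot_out.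
Qed.

Lemma inside_prefix x y : prefix x y -> inside x -> inside y.
Proof. by move=> xy h; apply: prefix_trans h xy. Qed.

Lemma inside_prefix_out x y : prefix x y -> ~~ inside x -> inside y -> x = [::].
Proof.
move=> xy nx /insideP[v ey]; move: xy nx; rewrite ey; case: x => //= i x.
by rewrite /inside /= prefix0s andbT eq_sym => /andP[/eqP ->]; rewrite eqxx.
Qed.

Lemma lcp_inside_out x y : inside x -> ~~ inside y -> lcp x y = [::].
Proof.
move=> ix ny; apply: (inside_prefix_out (lcp_prefixl x y)) ix.
by apply: contra ny; apply/inside_prefix/lcp_prefixr.
Qed.

Lemma reroot_betw x v y : betw (reroot x) (reroot v) (reroot y) = betw x v y.
Proof.
wlog hxy : x y / inside y ==> inside x.
  move=> H; case: (boolP (inside y ==> inside x)) => h; first exact: H.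
  rewrite betwC (betwC x); apply: H; move: h; by case: (inside x); case: (inside y).
rewrite /betw reroot_lcp.
case ix: (inside x) hxy; case iy: (inside y) => //= _; rewrite !reroot_prefix ix iy.
- have il : inside (lcp x y) by rewrite /inside prefix_lcp -!/(inside _) ix iy.
  rewrite il; case iv: (inside v) => //=.
  by apply/esym/negbTE; apply: contraFN iv => /andP[/inside_prefix/(_ il)].
- rewrite (lcp_inside_out ix) ?iy // !prefix0s /=; case iv: (inside v) => /=.
    rewrite orbF; case vy: (prefix v y); last by rewrite orbF.
    by rewrite (inside_prefix vy iv) in iy.
  case vx: (prefix v x) => //=.
  by rewrite (inside_prefix_out vx) ?iv ?ix // prefix0s.
have il : inside (lcp x y) = false.
  by apply: contraFF ix; apply/inside_prefix/lcp_prefixl.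
rewrite il; case iv: (inside v) => //=.
apply/esym/negbTE; apply: contraFN ix => /andP[_ /orP[|]] /inside_prefix/(_ iv) //.
by rewrite iy.
Qed.

Lemma prefix_reroot u w : prefix u (reroot w) ->
  u = [::] \/ exists2 u', u = reroot u' & prefix u' w.
Proof.
case: u => [|i u]; first by left.
case: (boolP (inside w)) => [/insideP[v ->]|nw].
  rewrite reroot_in /= => /andP[/eqP -> uv]; right; exists (j :: u).
    by rewrite reroot_in.
  by rewrite /= eqxx.
rewrite reroot_out //= => /andP[/eqP -> uw]; right; exists u => //.
by rewrite reroot_out //; apply: contra nw; apply: inside_prefix.
Qed.

Lemma reroot_separated x y z w :
  separated (reroot x) (reroot y) (reroot z) (reroot w) = separated x y z w.
Proof.
apply: negb_inj; apply/separatedP/separatedP => [[v [h1 h2]]|[v [h1 h2]]]; last first.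
  by exists (reroot v); rewrite !reroot_betw.
have hv : v = [::] \/ exists v', v = reroot v'.
  by case/andP: (h1) => _ /orP[]/prefix_reroot[->|[v' -> _]]; by [left|right; exists v'].
case: hv => [e|[v' e]]; last by exists v'; rewrite -(reroot_betw x) -(reroot_betw z) -e.
(* A path through the new root joins the two sides of the subdivided edge, hence also passes the old
   root. *)
have out a c : betw (reroot a) [::] (reroot c) -> betw a [::] c.
  rewrite /betw reroot_lcp !prefix0s !andbT.
  case: ifP => [_|]; first by rewrite prefixs0 (negbTE (reroot_nil _)).
  case ia: (inside a); case ic: (inside c) => // _ _.
    by rewrite lcp_inside_out ?ia ?ic.
  by rewrite lcpC lcp_inside_out ?ia ?ic.
by exists [::]; rewrite e in h1 h2; split; apply: out.
Qed.

Lemma reroot_rcons w i : w != [::] -> reroot (rcons w i) = rcons (reroot w) i.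
Proof. by case: w => //= k w _; case: ifP. Qed.

End Reroot.

(** * Placing the root of an extension *)

Section Core.
Variables (P : set (option nat)) (hP : forall p, P p -> le_bound 3 p).
Variables (B : structure (LP P)) (hB : FP B).
Variables (I : finType) (alpha : I -> B).

Lemma FP_labels : exists kap : B -> option nat,
  forall x, P (kap x) /\ forall p, relK p x <-> kap x = val p.
Proof.
have /card_gt0P[r _] := FP_card hB.
have [b [_ _ _ _ hK] _] := FP_model r hB.
have H (x : B) : exists q, P q /\ forall p : set_type P, relK p x <-> q = val p.
  have [p [px pu _]] := hK x.
  exists (val p); split; first exact: set_valP.
  by move=> p'; split=> [/pu ->|/val_inj <-].
by have [kap Hk] := choice H; exists kap.
Qed.

Variables (kap : B -> option nat)
  (Hkap : forall x, P (kap x) /\ forall p, relK p x <-> kap x = val p).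

(** Of the at most [n] neighbours of [x], the vertex [w] is set aside as the one on the way to the
    root. *)
Lemma model_room (b : B -> word) x w (l : seq nat) n : word_model b ->
  uniq (w :: [seq rcons (b x) i | i <- l]) -> adj (b x) w -> (exists y, b y = w) ->
  (forall i, i \in l -> exists y, b y = rcons (b x) i) ->
  kap x = Some n -> size l <= n.-1.
Proof.
move=> [binj _ _ _ hK] ul aw [y ey] hl kx.
have [p [px _ dle]] := hK x.
have ep : val p = Some n by rewrite -kx; apply/esym/(Hkap x).2.
rewrite ep /= in dle.
have : size (w :: [seq rcons (b x) i | i <- l]) <= degree (word_rel b) x.
  apply: degree_ge => // u; rewrite inE => /orP[/eqP ->|/mapP[i /hl[z ez] ->]].
    by exists y; rewrite ?ey.
  by exists z => //; rewrite ez adj_rcons.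
by rewrite /= size_map => /leq_trans/(_ dle); case: n {kx ep dle}.
Qed.

Lemma model_room_par (b : B -> word) x (l : seq nat) n : word_model b ->
  b x != [::] -> uniq l -> (forall i, i \in l -> exists y, b y = rcons (b x) i) ->
  kap x = Some n -> size l <= n.-1.
Proof.
move=> hb nx ul; apply: (model_room (w := par (b x))) => //.
- rewrite /= map_inj_uniq ?ul ?andbT; last by move=> i i' /rcons_inj[].
  apply/mapP => -[i _ /(congr1 size)]; rewrite size_par size_rcons => e.
  by have := leq_pred (size (b x)); rewrite e ltnn.
- by rewrite /adj nx eqxx.
- exact: (model_closed hb (prefix_par (b x))).
Qed.

(** What the extension argument keeps of a realised substructure. The index type [I] carries no
    structure, so a single base point is an instance too; this later yields the existence of
    expansions. *)
Definition compatible (s : levels) (N : nat) (phi : I -> word) : Prop :=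
  [/\ good P s /\ 1 < N, forall a, node N s (phi a),
      forall a b c, ~ relD (alpha a) (alpha b) (alpha c) (alpha c) <->
        betw (phi a) (phi c) (phi b),
      forall a b c, exists m, [/\ betw (phi a) (phi m) (phi b),
        betw (phi b) (phi m) (phi c) & betw (phi a) (phi m) (phi c)] &
      forall a, kap (alpha a) = lab s (phi a)].

Definition extendable (s : levels) (phi : I -> word) : Prop :=
  exists s' N' (psi : B -> word),
  [/\ [/\ good P s', 1 < N' & injective psi],
      forall x, node N' s' (psi x),
      forall x y z w, relD x y z w <-> separated (psi x) (psi y) (psi z) (psi w),
      forall x, lab s' (psi x) = kap x &
      forall a c, tp2 s' (psi (alpha a)) (psi (alpha c)) = tp2 s (phi a) (phi c)].

Section Rooted.
Variables (s : levels) (N : nat) (phi : I -> word).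
Hypothesis Hphi : compatible s N phi.
Variables (a0 : I) (b : B -> word) (Hb : word_model b) (root_b : b (alpha a0) = [::]).

Lemma betw_model a c d :
  betw (b (alpha a)) (b (alpha c)) (b (alpha d)) = betw (phi a) (phi c) (phi d).
Proof.
have [_ _ h _ _] := Hphi.
apply/idP/idP => [h'|/h].
  by apply/h; rewrite (model_relD Hb) separated_cc h'.
rewrite (model_relD Hb) separated_cc; by case: betw => // /(_ isT).
Qed.

(** In a model rooted at [alpha a0] a meet is a median with the root, and [I] has medians. *)
Lemma model_lcp a c : exists m,
  [/\ b (alpha m) = lcp (b (alpha a)) (b (alpha c)),
      betw (phi a) (phi m) (phi c), betw (phi c) (phi m) (phi a0) &
      betw (phi a) (phi m) (phi a0)].
Proof.
have [_ _ _ h _] := Hphi; have [m [h1 h2 h3]] := h a c a0.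
exists m; split=> //; rewrite -!betw_model in h1 h2 h3.
by apply: med_lcp h1 h2 h3 _; right; rewrite root_b !prefix0s.
Qed.

(** No edge is reserved for the root here: all edges at [alpha a0] lead upwards in [b] and may
    exceed the available directions by one. Hence [cover], by which [phi] already prescribes every
    direction there. *)
Lemma real_core :
  (forall a, prefix (phi a0) (phi a)) ->
  (forall x i, prefix [:: i] (b x) -> exists a, prefix [:: i] (b (alpha a))) ->
  extendable s phi.
Proof.
move=> min0 cover; have [[gs lN] nphi _ _ hlab] := Hphi.
have [binj bclos bD _ _] := Hb.
pose label u := if [pick x | b x == u] is Some x then kap x else None.
have labE x : label (b x) = kap x.
  by rewrite /label; case: pickP => [y /eqP/binj -> //|/(_ x)]; rewrite eqxx.
have [] := @realize_frame P hP B b label I (b \o alpha) phi s N lN binj.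
- move=> u hu; have [x <-] : exists x, b x = u.
    by case: hu => // ->; exists (alpha a0).
  by rewrite labE; case: (Hkap x).
- by move=> x u /bclos; right.
- by move=> a; right; exists (alpha a).
- exact: nphi.
- by move=> a; rewrite /= labE.
- move=> a c /=; rewrite -(@betw_above (b (alpha a0))) ?root_b ?prefix0s // -root_b.
  by rewrite betw_model betw_above.
- move=> a c; have [m [h1 h2 h3 h4]] := model_lcp a c; exists m; split=> //.
  by apply: med_lcp h2 h3 h4 _; right.
- move=> u hu; have [->|nu] := eqVneq u [::].
    by left; split; [exists a0|move=> i x; apply: cover].
  right; case: hu => [e|[x ex]]; first by rewrite e eqxx in nu.
  move=> l ul hl n; rewrite -ex labE; apply: (@model_room_par b x) => //; first by rewrite ex.
  by rewrite ex.
move=> s' [N' [psi [h1 h2 h3 h4 h5]]]; exists s', N', psi; split=> //.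
- by move=> x y z w; rewrite h3 bD.
- by move=> x; rewrite h4.
- by move=> a c; apply: h5.
Qed.

(** The root goes into the edge from [alpha a0] to [[:: j]], and [c] is its prescribed position. The
    assumptions say that the elements of different sides of this edge part at [c], while those of
    one side stay together there. *)
Lemma reroot_core j c :
  let side a := inside j (b (alpha a)) in
  (exists y, b y = [:: j]) -> node N s c ->
  (forall a, prefix c (phi a) /\ c != phi a) ->
  (forall a, ~~ side a -> prefix (phi a0) (phi a)) ->
  (forall a d, side a -> ~~ side d -> lcp (phi a) (phi d) = c) ->
  (forall a d, side a -> side d -> lcp (phi a) (phi d) != c) ->
  extendable s phi.
Proof.
move=> side [y0 ey0] nc cphi min0 lcpIO lcpII; have [[gs lN] nphi _ _ hlab] := Hphi.
have [binj bclos bD _ _] := Hb.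
pose gam x := reroot j (b x).
pose label u := if [pick x | gam x == u] is Some x then kap x else lab s c.
have ginj : injective gam by apply: inj_comp (@reroot_inj j) binj.
have labE x : label (gam x) = kap x.
  by rewrite /label; case: pickP => [y /eqP/ginj -> //|/(_ x)]; rewrite eqxx.
have lab0 : label [::] = lab s c.
  by rewrite /label; case: pickP => // y; rewrite (negbTE (reroot_nil _ _)).
have Pc : P (lab s c) by apply/gs/mem_nth/(node_size nc).
(* [None] stands for the new root, which is prescribed although it is no vertex of [B]. *)
pose X (o : option I) := if o is Some a then gam (alpha a) else [::].
pose Y (o : option I) := if o is Some a then phi a else c.
have side0 : ~~ side a0 by rewrite /side root_b.
have preE a d : prefix (b (alpha a)) (b (alpha d)) = betw (phi a0) (phi a) (phi d).
  by rewrite -betw_model betw_above // root_b prefix0s.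
have phiNc a : prefix (phi a) c = false.
  apply/negP => h; have [h' /eqP] := cphi a; apply.
  exact: prefix_anti.
have [] := @realize_frame P hP B gam label (option I) X Y s N lN ginj.
- by move=> u [->|[x <-]]; rewrite ?lab0 // labE; case: (Hkap x).
- move=> x u /prefix_reroot[->|[u' -> /bclos[x' <-]]]; first by left.
  by right; exists x'.
- by case=> [a|]; [right; exists (alpha a)|left].
- by case.
- by case=> [a|] /=; rewrite ?lab0 // labE.
- move=> [a|] [d|] /=; rewrite ?prefix0s ?prefix_refl //; last 1 first.
  + by case: (cphi d).
  + rewrite reroot_prefix preE -!/(side _).
    case sa: (side a); case sd: (side d) => /=.
    * rewrite /betw (lcpC (phi a0)) lcpIO ?sd // (cphi a).1 /=.
      case h: (prefix (phi a) (phi a0)) => //=.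
      have := lcpIO a a0 sa side0; rewrite lcp_idPl // => e.
      by have := phiNc a; rewrite e prefix_refl.
    * apply/esym/negbTE/negP => h; have := lcpIO a d; rewrite sa sd lcp_idPl //.
      by move=> /(_ isT isT) e; have := phiNc a; rewrite e prefix_refl.
    * apply/esym/negbTE/negP => h; have := lcpIO d a; rewrite sa sd lcp_idPr //.
      by move=> /(_ isT isT) e; have := phiNc a; rewrite e prefix_refl.
    * by rewrite betw_above // min0 ?sa ?sd.
  + by rewrite phiNc; have := reroot_nil j (b (alpha a)); rewrite /gam; case: reroot.
- move=> [a|] [d|] /=; last 1 first.
  + by exists None; rewrite lcpxx.
  + have [ne|/negPn/eqP e] := boolP (side a != side d).
      exists None; rewrite reroot_lcp -!/(side _) (negbTE ne); split=> //=.
      move: ne; case sa: (side a); case sd: (side d) => // _.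
        by rewrite lcpIO ?sa ?sd.
      by rewrite lcpC lcpIO ?sa ?sd.
    have [m [h1 h2 h3 h4]] := model_lcp a d; exists (Some m).
    rewrite reroot_lcp -!/(side _) e eqxx /= /gam h1; split=> //.
    apply: (med_lcp h2 h3 h4).
    case sa: (side a); last by right; rewrite !min0 -?e ?sa.
    left; apply/negP => h; have sd : side d by rewrite -e.
    have /eqP := lcpII a d sa sd; apply; apply: prefix_anti; last first.
      by rewrite prefix_lcp (cphi a).1 (cphi d).1.
    rewrite -(lcpIO a a0 sa side0) prefix_lcp lcp_prefixl /=.
    by case/andP: h2 => lm _; apply: prefix_trans lm h.
  + by exists None; rewrite lcps0 (lcp_idPr (cphi a).1).
  + by exists None; rewrite (lcp_idPl (cphi d).1).
- move=> u hu; right; have [->|nu] := eqVneq u [::].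
    (* The new root has the two directions [0] and [1] only, and a label of at least 3 admits
       them. *)
    move=> l ul hl n; rewrite lab0 => en.
    have : size l <= size [:: 0; 1].
      apply: uniq_leq_size => // i /hl[x]; rewrite /gam.
      case: (boolP (inside j (b x))) => [/insideP[v ->]|nx].
        by rewrite reroot_in => -[<- _].
      by rewrite reroot_out // => -[<- _].
    by move=> /leq_trans; apply; have := hP Pc; rewrite en /=; case: n {en} => [|[|[]]].
  case: hu => [e|[x ex]]; first by rewrite e eqxx in nu.
  move=> l ul hl n; rewrite -ex labE.
  have [bx|nbx] := eqVneq (b x) [::]; last first.
    apply: (@model_room_par b x) => // i /hl[y].
    rewrite -ex /gam -reroot_rcons // => /reroot_inj e.
    by exists y.
  have hl' i : i \in l -> i != j /\ exists y, b y = [:: i].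
    move=> /hl[y]; rewrite -ex /gam bx /=.
    case: (boolP (inside j (b y))) => [/insideP[v ->]|ny]; first by rewrite reroot_in.
    rewrite reroot_out // => -[ey]; rewrite ey /inside /= andbT in ny.
    by split; [rewrite eq_sym|exists y].
  (* At the old root the edge to [[:: j]] now leads to the root and plays the part of the parent. *)
  apply: (model_room (w := [:: j])) Hb _ _ _ _ => //.
  + rewrite /= map_inj_uniq ?ul ?andbT; last by move=> i i' /rcons_inj[].
    by apply/mapP => -[i /hl'[/eqP nij _]]; rewrite bx => -[/esym].
  + by rewrite bx.
  + by exists y0.
  + by move=> i /hl'[_]; rewrite bx.
move=> s' [N' [psi [h1 h2 h3 h4 h5]]]; exists s', N', psi; split=> //.
- by move=> x y z w; rewrite h3 reroot_separated bD.
- by move=> x; rewrite h4.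
- by move=> a d; apply: (h5 (Some a) (Some d)).
Qed.

End Rooted.
End Core.

Lemma tuple1E (T : Type) (t : 1.-tuple T) : exists x, t = [tuple x].
Proof. by case: t => -[|x []] //= h; exists x; apply: val_inj. Qed.

Lemma tuple2E (T : Type) (t : 2.-tuple T) : exists x y, t = [tuple x; y].
Proof. by case: t => -[|x [|y []]] //= h; exists x, y; apply: val_inj. Qed.

Lemma tuple4E (T : Type) (t : 4.-tuple T) : exists x y z w, t = [tuple x; y; z; w].
Proof. by case: t => -[|x [|y [|z [|w []]]]] //= h; exists x, y, z, w; apply: val_inj. Qed.

Section Reasonable.
Variables (P : set (option nat)) (hP : forall p, P p -> le_bound 3 p).
Let LPs := lang_union (LP P) type_language.

Section Extend.
Variables (B : structure (LP P)) (hB : FP B).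
Variables (I : finType) (alpha : I -> B) (kap : B -> option nat)
  (Hkap : forall x, P (kap x) /\ forall p, relK p x <-> kap x = val p).

(** The meet [c] of all elements is no element. Medians exclude three directions at [c], since the
    median of three elements parting there would be [c]. So there are two sides, and the root is put
    into an edge of [B] on the way from one to the other. *)
Lemma extend_virtual s N phi c :
  compatible alpha kap s N phi -> node N s c ->
  (forall a, prefix c (phi a) /\ c != phi a) ->
  (exists a1 b1, lcp (phi a1) (phi b1) = c) ->
  extendable alpha kap s phi.
Proof.
move=> Hphi nc cphi [a1 [b1 e1]]; have [_ _ _ hmed _] := Hphi.
pose dir a := nth 0 (phi a) (size c).
have dirE a d : (lcp (phi a) (phi d) == c) = (dir a != dir d).
  by have [h1 h2] := cphi a; have [h3 h4] := cphi d; apply: lcp_eqE.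
have dirEP a d : dir a != dir d -> lcp (phi a) (phi d) = c by rewrite -dirE => /eqP.
have phiNc a : prefix (phi a) c = false.
  apply/negP => h; have [h' /eqP] := cphi a; apply.
  exact: prefix_anti.
(* A vertex sitting at a meet of elements with different directions would lie
   below both, hence below [c]. *)
have not_below a d m : dir a != dir d -> prefix (phi m) (phi a) -> ~~ prefix (phi m) (phi d).
  move=> /dirEP e ha; apply/negP => hd; have := phiNc m.
  by rewrite -e prefix_lcp ha hd.
have two a : dir a = dir a1 \/ dir a = dir b1.
  have n1 : dir a1 != dir b1 by rewrite -dirE e1.
  have [->|n2] := eqVneq (dir a) (dir a1); first by left.
  have [->|n3] := eqVneq (dir a) (dir b1); first by right.
  have [m [/andP[_ h1] /andP[_ h2] /andP[_ h3]]] := hmed a a1 b1.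
  case/orP: h1 => h1.
    move: h2; rewrite (negbTE (not_below _ _ _ n2 h1)) /=.
    by rewrite (negbTE (not_below _ _ _ n3 h1)).
  move: h3; rewrite (negbTE (not_below _ _ _ n1 h1)) orbF.
  by rewrite eq_sym in n2; rewrite (negbTE (not_below _ _ _ n2 h1)).
have n1 : dir a1 != dir b1 by rewrite -dirE e1.
have meet a d e m : dir a = dir d -> dir a != dir e ->
    betw (phi a) (phi m) (phi d) -> betw (phi d) (phi m) (phi e) ->
    betw (phi a) (phi m) (phi e) -> phi m = lcp (phi a) (phi d).
  move=> ead nae h1 h2 h3; apply: (med_lcp h1 h2 h3); left.
  have := h1; rewrite /betw => /andP[_ /orP[]]; first exact: not_below.
  by apply: not_below; rewrite -ead.
(* A shortest element of a side is its least one, because medians with [b1] make the side closed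
   under meets. *)
case: (arg_minnP (fun a => size (phi a)) (P := [pred a | dir a == dir a1]) (i0 := a1)).
  by rewrite inE.
move=> a0 /eqP d0 hmin.
have nb1 : dir a0 != dir b1 by rewrite d0.
have min0 a : dir a = dir a1 -> prefix (phi a0) (phi a).
  move=> da; have [m [h1 h2 h3]] := hmed a0 a b1.
  have em : phi m = lcp (phi a0) (phi a) by apply: meet h1 h2 h3; rewrite // d0.
  have m0 : prefix (phi m) (phi a0) by rewrite em lcp_prefixl.
  have dm : dir m == dir a1.
    case: (two m) => [->//|em']; move: (not_below a0 m m); rewrite em' => /(_ nb1 m0).
    by rewrite prefix_refl.
  have := hmin m dm => sz.
  have -> : phi a0 = phi m.
    by apply: (prefix_anti _ m0); apply: prefix_comparable (prefix_refl _) m0 sz.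
  by rewrite em lcp_prefixr.
have [b Hb rb] := FP_model (alpha a0) hB.
have bE := betw_model Hphi Hb.
have root_eq m : b (alpha m) = [::] -> phi m = phi a0.
  move=> e; apply: betw_refl_eq; rewrite -bE e rb; by [].
have nb : b (alpha b1) != [::].
  by apply: contra nb1 => /eqP/root_eq e; rewrite /dir e.
(* The first step [j] from [alpha a0] towards the other side is the edge that receives the root. *)
case eb: (b (alpha b1)) nb => [//|j v] _.
have sideE a : inside j (b (alpha a)) = (dir a == dir b1).
  apply/idP/eqP => [ia|da].
    case: (two a) => // da.
    have h : betw (phi a) (phi a0) (phi b1).
      by rewrite /betw dirEP ?da // (cphi a0).1 min0.
    have /insideP[w ew] := ia.
    by move: h; rewrite -bE rb eb ew /betw /= eqxx.
  have [m [h1 h2 h3 h4]] := model_lcp Hphi Hb rb a b1.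
  have em : phi m = lcp (phi a) (phi b1).
    by apply: meet h2 h3 h4 => //; rewrite da eq_sym.
  have nm : b (alpha m) != [::].
    apply: contra nb1 => /eqP/root_eq e0.
    have h : prefix (phi a0) (phi b1) by rewrite -e0 em lcp_prefixr.
    have [//|ne] := eqVneq (dir a0) (dir b1).
    by have := not_below _ _ a0 ne (prefix_refl _); rewrite h.
  rewrite /inside; move: nm; rewrite h1 eb.
  case: (b (alpha a)) => //= i w; rewrite prefix0s andbT eq_sym.
  by case: (eqVneq j i).
have side1 a : dir a != dir b1 -> dir a = dir a1 by case: (two a) => // ->; rewrite eqxx.
apply: (reroot_core hP Hkap Hphi Hb rb (j := j) (c := c)) => //.
- have jb1 : prefix [:: j] (b (alpha b1)) by rewrite eb /= eqxx prefix0s.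
  have [y ey] := model_closed Hb jb1.
  by exists y.
- by move=> a; rewrite sideE => /side1/min0.
- by move=> a d; rewrite !sideE => /eqP da dd; apply: dirEP; rewrite da eq_sym.
- by move=> a d; rewrite !sideE dirE => /eqP -> /eqP ->; rewrite eqxx.
Qed.

Lemma compatible_cons s N phi q : P q -> compatible alpha kap s N phi ->
  compatible alpha kap (q :: s) N (fun a => 0 :: phi a).
Proof.
move=> Pq [[gs lN] np hb hm hl].
have bc x y z : betw (0 :: x) (0 :: y) (0 :: z) = betw x y z by [].
split.
- by split=> //; apply: good_cons.
- move=> a; rewrite /= np andbT; apply: (good_width0 hP lN (good_cons Pq gs)).
  by rewrite mem_head.
- by move=> a d e; rewrite bc.
- by move=> a d e; have [m hm'] := hm a d e; exists m; rewrite !bc.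
- by move=> a; rewrite hl.
Qed.

(** Either the meet [c] is no element, or it is some [a0] with every edge of [B] there leading
    towards elements, or an edge at [a0] is new. In the last case the directions might not suffice
    for all edges, and the root moves into the new one. *)
Lemma compatible_extendable s N phi : compatible alpha kap s N phi ->
  (exists a : I, True) -> extendable alpha kap s phi.
Proof.
move=> Hphi [i0 _]; have [[gs lN] np _ _ _] := Hphi.
have [i1 _ hmin] := common_meet phi (finset.in_setT i0).
set c := lcp (phi i0) (phi i1) in hmin.
have cmin a : prefix c (phi a) by apply: hmin; rewrite inE.
have [[a0 e0]|nc] := pselect (exists a, phi a = c); last first.
  apply: (extend_virtual (c := c)) Hphi _ _ _.
  - exact/node_lcp/np.
  - by move=> a; split=> //; apply: contra_notN nc => /eqP ->; exists a.
  - by exists i0, i1.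
have min0 a : prefix (phi a0) (phi a) by rewrite e0.
have [b Hb rb] := FP_model (alpha a0) hB.
have [cover|] := pselect (forall x i, prefix [:: i] (b x) ->
    exists a, prefix [:: i] (b (alpha a))).
  exact: (real_core hP Hkap Hphi Hb rb).
move=> /existsNP[x /existsNP[j /not_implyP[jx hj]]].
have Pq : P (lab s (phi a0)) by apply/gs/mem_nth/(node_size (np a0)).
(* An added bottom level makes room for the new root strictly below [phi a0]. *)
have H1 := compatible_cons Pq Hphi.
have out a : inside j (b (alpha a)) = false by apply/negP => ha; apply: hj; exists a.
have : extendable alpha kap (lab s (phi a0) :: s) (fun a => 0 :: phi a).
  apply: (reroot_core hP Hkap H1 Hb rb (j := j) (c := [::])) => //.
  - by have [y ey] := model_closed Hb jx; exists y.
  - by move=> a _; rewrite /= min0.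
  - by move=> a d; rewrite out.
move=> [s' [N' [psi [h1 h2 h3 h4 h5]]]].
by exists s', N', psi; split=> // a d; rewrite h5 tp2_cons.
Qed.

End Extend.

Lemma realized_expand (B : structure (LP P)) s N (psi : B -> word) :
  good P s -> 1 < N -> injective psi -> (forall x, node N s (psi x)) ->
  (forall x y z w, relD x y z w <-> separated (psi x) (psi y) (psi z) (psi w)) ->
  (forall p x, relK p x <-> lab s (psi x) = val p) ->
  exists i : interpretation type_language B,
    @realized P (expand i) s N psi.
Proof.
move=> gs lN ipsi npsi hD hK.
exists (fun R t => @wint P s (inr R) (map psi t)); split=> // -[[|p]|tau] t //=.
  by have [x [y [z [w ->]]]] := tuple4E t; apply: hD.
by have [x ->] := tuple1E t; apply: hK.
Qed.

Lemma reduct_expand (L L' : language) (A : structure L) (i : interpretation L' A) :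
  reduct (expand i) = A.
Proof. by case: A i. Qed.

Lemma extendable_expand (B : structure (LP P)) (hB : FP B) (I : finType)
    (alpha : I -> B) kap (Hkap : forall x, P (kap x) /\ forall p, relK p x <-> kap x = val p)
    s phi :
  extendable alpha kap s phi -> exists2 i : interpretation type_language B,
    FPs (expand i) & forall a d tau,
      @interp _ (expand i) (inr tau) [tuple alpha a; alpha d] <->
      tp2 s (phi a) (phi d) = tau.
Proof.
move=> [s' [N' [psi [[gs lN ipsi] np hD hl htp]]]].
have [|i Hi] := realized_expand gs lN ipsi np hD.
  by move=> p x; rewrite hl; apply: (Hkap x).2.
exists i.
  by split; [rewrite reduct_expand|exists s', N', psi].
by move=> a d tau; rewrite (realized_tp2 _ _ _ Hi) htp.
Qed.

Lemma FPs_reasonable : reasonable (@FP P) (@FPs P).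
Proof.
move=> [TA iA] B alpha; set A := Structure iA in alpha *.
move=> hA hB i [_ [s [N [phi Hphi]]]].
have [gs lN iphi np _] := Hphi.
have hDA (a b c d : A) : relD (A := A) a b c d <->
    separated (phi a) (phi b) (phi c) (phi d) by exact: (realized_relD (A := expand i) a b c d Hphi).
have hKA p (a : A) : relK (A := A) p a <-> lab s (phi a) = val p.
  exact: (realized_relK (A := expand i) p a Hphi).
have [_ fP] := emb_funP alpha.
have hDB (a b c d : A) : relD (alpha a) (alpha b) (alpha c) (alpha d) <-> relD a b c d.
  have := fP symD [tuple a; b; c; d]; rewrite /relD => ->.
  rewrite (_ : map_tuple _ _ = [tuple alpha a; alpha b; alpha c; alpha d]) //.
  exact: val_inj.
have hKB p (a : A) : relK p (alpha a) <-> relK p a.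
  have := fP (symK p) [tuple a]; rewrite /relK => ->.
  by rewrite (_ : map_tuple _ _ = [tuple alpha a]) //; apply: val_inj.
have [kap Hkap] := FP_labels hB.
have nb a b c : ~ relD (A := A) a b c c <-> betw (phi a) (phi c) (phi b).
  by rewrite hDA separated_cc; split; [move/negP/negPn|move=> ->].
have comp : compatible alpha kap s N phi.
  split=> // [a b c|a b c|a]; first by rewrite hDB nb.
    by have [m [/nb h1 /nb h2 /nb h3]] := FP_median hA a b c; exists m.
  have Pl : P (lab s (phi a)) by apply/gs/mem_nth/(node_size (np a)).
  have := (Hkap (alpha a)).2 (SigSub (mem_set Pl)) => /= <-.
  by apply/hKB/hKA.
have /card_gt0P[a0 _] := FP_card hA.
have [|j Gj hj] := extendable_expand hB Hkap (compatible_extendable hB Hkap comp _).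
  by exists a0.
exists j => //; split; first by case: (emb_funP alpha).
case=> [R|tau] t; first exact: fP.
have [a [b ->]] := tuple2E t.
have -> : map_tuple alpha [tuple a; b] = [tuple alpha a; alpha b] by apply: val_inj.
have := hj a b tau => ->.
exact: (realized_tp2 (A := expand i) a b tau Hphi).
Qed.

(** Existence of an expansion is the extension problem for one base point, placed in a tree with a
    single vertex. *)
Lemma FPs_is_expansion : is_expansion (@FP P) (@FPs P).
Proof.
split=> [As []//|B hB].
have [kap Hkap] := FP_labels hB.
have /card_gt0P[x0 _] := FP_card hB.
have [b Hb _] := FP_model x0 hB.
have comp : compatible (fun _ : unit => x0) kap [:: kap x0] 2 (fun _ => [::]).
  split.
  - by split=> // q; rewrite inE => /eqP ->; case: (Hkap x0).
  - by [].
  - by move=> a c d; rewrite (model_relD Hb) separated_cc /betw lcpxx prefix_refl.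
  - by exists tt.
  - by [].
have [|i Gi _] := extendable_expand hB Hkap (compatible_extendable hB Hkap comp _).
  by exists tt.
by exists i.
Qed.

End Reasonable.

(** * The expansion property and precompactness *)

(** The values of [d] are sorted. At a finite label they fill the range below [w], so the sorted
    list is the identity; at label omega increasing order is enough. *)
Lemma sorted_directions q w (d : nat -> nat) :
  {in [pred i | i < w] &, injective d} -> (forall p, q = Some p -> w = p.-1) ->
  (forall p i, q = Some p -> i < w -> d i < w) ->
  exists pi, [/\ forall i, i < w -> pi i < w & dir_emb q w (d \o pi)].
Proof.
move=> dinj wp dw; pose D := [seq d i | i <- iota 0 w].
have uD : uniq D.
  rewrite map_inj_in_uniq ?iota_uniq // => i j; rewrite !mem_iota /= => li lj.
  by apply: dinj; rewrite inE.
have szD : size D = w by rewrite size_map size_iota.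
pose kap i := nth 0 (sort leq D) i.
have sD : sorted ltn (sort leq D).
  by rewrite ltn_sorted_uniq_leq sort_uniq uD /=; apply: (sort_sorted leq_total).
have kapD i : i < w -> kap i \in D.
  by move=> li; rewrite -(mem_sort leq) mem_nth // size_sort szD.
have piw i : i < w -> index (kap i) D < w by move=> /kapD; rewrite -index_mem szD.
have dpi i : i < w -> d (index (kap i) D) = kap i.
  move=> li; rewrite -[RHS](nth_index 0 (kapD i li)) (nth_map 0) ?size_iota ?piw //.
  by rewrite nth_iota ?piw.
exists (fun i => index (kap i) D); split=> //.
case: q wp dw => [p|] wp dw /=; last first.
  move=> i j /andP[ij jw]; rewrite !dpi //; last exact: ltn_trans jw.
  apply: (sorted_ltn_nth ltn_trans 0 sD) => //; rewrite inE size_sort szD //.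
  exact: ltn_trans jw.
move=> i li; rewrite dpi // /kap.
have -> : sort leq D = iota 0 w; last by rewrite nth_iota.
apply: (irr_sorted_eq ltn_trans ltnn sD (iota_ltn_sorted _ _)) => k.
rewrite mem_sort; have [||_ -> //] := uniq_min_size uD (s2 := iota 0 w).
  move=> k' /mapP[i']; rewrite mem_iota => /andP[_ li'] ->.
  by rewrite mem_iota /= (dw p).
by rewrite szD size_iota.
Qed.

Section Homogeneous.
Variables (W : word -> Prop) (Psi : word -> word).
Variables (N : nat) (s' : levels) (N' : nat).
Hypothesis Psi_node : forall w, W w -> node N' s' (Psi w).
Hypothesis Psi_inj : forall w w', W w -> W w' -> Psi w = Psi w' -> w = w'.
Hypothesis Psi_betw : forall x y z, W x -> W y -> W z ->
  betw (Psi x) (Psi y) (Psi z) = betw x y z.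

(* However a homogeneous cone is realised, permuting the children of every
   vertex puts the directions back in their standard position. *)
Lemma homogeneous_cone sg v :
  (forall x, node N sg x -> W (v ++ x)) ->
  (forall x, node N sg x -> lab s' (Psi (v ++ x)) = lab sg x) ->
  (forall x, node N sg x -> prefix (Psi v) (Psi (v ++ x))) ->
  exists tau, (forall x, node N sg x -> node N sg (tau x)) /\
    emb sg N s' N' (fun x => Psi (v ++ tau x)).
Proof.
elim: sg v => [|q sg IH] v hW hlab hpre.
  by exists id; split=> //; split.
have Wv : W v by have := hW [::] isT; rewrite cats0.
have lv : lab s' (Psi v) = q by have := hlab [::] isT; rewrite cats0.
(* The last level is treated apart, as its vertices have no children to permute. *)
case: sg IH hW hlab hpre => [|r sg] IH hW hlab hpre.
  exists id; split=> //; apply: (@emb_root _ _ _ _ _ _ id) => [|||i _|i x _ //].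
  - by rewrite cats0; apply: Psi_node.
  - by rewrite cats0.
  - exact: dir_emb_id.
  - by split.
set w := width N q.
have Wk i : i < w -> W (rcons v i).
  by move=> li; rewrite -cats1; apply: hW; rewrite /= andbT.
have prek i : i < w -> prefix (Psi v) (Psi (rcons v i)).
  by move=> li; rewrite -cats1; apply: hpre; rewrite /= andbT.
have nek i : i < w -> Psi v != Psi (rcons v i).
  move=> li; apply/eqP => /(Psi_inj Wv (Wk _ li)) /(congr1 size).
  by rewrite size_rcons; lia.
have Wkx i x : i < w -> node N (r :: sg) x -> W (rcons v i ++ x).
  by move=> li nx; rewrite cat_rcons; apply: hW; rewrite /= -/w li.
have prekx i x : i < w -> node N (r :: sg) x ->
    prefix (Psi (rcons v i)) (Psi (rcons v i ++ x)).
  move=> li nx; rewrite -(@betw_above (Psi v)) ?prek //.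
    rewrite Psi_betw //; [|exact: Wk|exact: Wkx].
    by rewrite betw_above ?prefix_prefix ?prefix_rcons ?cat_rcons ?prefix_prefix.
  by rewrite cat_rcons; apply: hpre; rewrite /= -/w li.
pose d i := nth 0 (Psi (rcons v i)) (size (Psi v)).
have dinj : {in [pred i | i < w] &, injective d}.
  move=> i j; rewrite !inE => li lj; have [//|ne] := eqVneq i j.
  have := lcp_eqE (prek i li) (nek i li) (prek j lj) (nek j lj).
  rewrite -/(d i) -/(d j) => h e; move: h; rewrite e eqxx /= => /eqP; case.
  apply: prefix_anti; last by rewrite prefix_lcp !prek.
  (* Since [v] lies between two of its children, [Psi v] lies between their images and is their
     meet, so these leave it in different directions. *)
  have : betw (rcons v i) v (rcons v j).
    rewrite /betw (prefix_lcp_rcons (prefix_refl _) (prefix_refl _) ne).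
    by rewrite prefix_refl prefix_rcons.
  rewrite -Psi_betw //; [|exact: Wk|exact: Wk].
  by case/andP.
have [||pi [piw Hpi]] := sorted_directions (q := q) dinj.
- by move=> p ep; rewrite /w ep.
- move=> p i ep li; have := node_nth (Psi_node (Wk i li)) (prek i li) (nek i li).
  by rewrite lv /w ep.
have /choice[tau Htau] : forall k, exists tau, k < w ->
    (forall x, node N (r :: sg) x -> node N (r :: sg) (tau x)) /\
    emb (r :: sg) N s' N' (fun x => Psi (rcons v k ++ tau x)).
  move=> k; case: (ltnP k w) => lk; last by exists id.
  have [x nx|x nx|x nx|tau Htau] := IH (rcons v k); last by exists tau.
  - exact: Wkx.
  - by rewrite cat_rcons hlab // /= -/w lk.
  - exact: prekx.
exists (fun x => if x is i :: x' then pi i :: tau (pi i) x' else [::]); split.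
  case=> [//|i x] /= /andP[li nx]; rewrite -/w piw //=.
  exact: (Htau _ (piw _ li)).1.
apply: (@emb_root _ _ _ _ _ _ (d \o pi)) => //.
- by rewrite cats0; apply: Psi_node.
- by rewrite cats0.
- move=> i li; apply: emb_ext (Htau _ (piw _ li)).2 => x _.
  by rewrite cat_rcons.
- move=> i x li nx; rewrite cats0 -cat_rcons.
  apply: prefix_trans (prefix_rcons_nth (prek _ (piw _ li)) (nek _ (piw _ li))) _.
  by apply: prekx; [exact: piw|exact: (Htau _ (piw _ li)).1].
Qed.

End Homogeneous.

Section Main.
Variables (P : set (option nat)) (hP : forall p, P p -> le_bound 3 p).
Let LPs := lang_union (LP P) type_language.

(** Below the levels [s] that realise [As] comes one more vertex [[:: 0]], with at least two
    directions, each carrying a complete copy of [s]. [D] fixes betweenness in every expansion, so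
    the root cannot interfere with both copies. *)
Lemma FPs_expansion_property : expansion_property (@FP P) (@FPs P).
Proof.
move=> As [hA [s [N [phi Hphi]]]].
have /card_gt0P[a0 _] := FP_card hA.
have Pq := realized_label a0 Hphi; set q := lab s _ in Pq.
have [gs lN _ nphi _] := Hphi.
have gq := good_cons Pq gs; have gqq := good_cons Pq gq.
pose Wl := planted N (q :: s).
pose Bs := word_structure P (q :: q :: s) Wl.
have HB : @realized P Bs (q :: q :: s) N val := realized_planted hP lN gqq.
exists (reduct Bs); first exact: FP_planted.
move=> j [_ [s' [N' [psi Hpsi]]]].
have [gs' lN' ipsi npsi _] := Hpsi.
pose Psi w := if insub w is Some a then psi a else [::].
pose W w := w \in Wl.
have PsiE w (hw : W w) : Psi w = psi (SeqSub hw).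
  rewrite /Psi insubT; congr psi; exact: val_inj.
have Psi_node w : W w -> node N' s' (Psi w) by move=> hw; rewrite (PsiE _ hw).
have Psi_inj w w' : W w -> W w' -> Psi w = Psi w' -> w = w'.
  by move=> hw hw'; rewrite (PsiE _ hw) (PsiE _ hw') => /ipsi[].
have Psi_betw x y z : W x -> W y -> W z -> betw (Psi x) (Psi y) (Psi z) = betw x y z.
  move=> hx hy hz; rewrite !PsiE; apply: negb_inj; rewrite -!separated_cc.
  have e1 := realized_relD (A := Bs) (SeqSub hx) (SeqSub hz) (SeqSub hy) (SeqSub hy) HB.
  have e2 := realized_relD (A := expand j)
    (SeqSub hx) (SeqSub hz) (SeqSub hy) (SeqSub hy) Hpsi.
  by apply/idP/idP => [/e2/e1|/e1/e2].
have Psi_lab w : W w -> lab s' (Psi w) = lab (q :: q :: s) w.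
  move=> hw; rewrite PsiE.
  have Pl : P (lab (q :: q :: s) w) := realized_label (SeqSub hw : Bs) HB.
  apply/(realized_relK (A := expand j) (SigSub (mem_set Pl)) (SeqSub hw) Hpsi).
  by apply/(realized_relK (A := Bs) (SigSub (mem_set Pl)) (SeqSub hw) HB).
have w2 : 1 < width N q by apply: (good_width hP lN gq); rewrite mem_head.
have W1 : W [:: 0] by rewrite /W mem_planted.
have W2 t x : t < 2 -> node N s x -> W (0 :: t :: x).
  by move=> lt nx; rewrite /W mem_planted /= nx andbT; apply: leq_trans w2.
(* The root of the realisation avoids one of the two cones above [[:: 0]]. *)
have [t lt up] : exists2 t, t < 2 &
    forall x, node N s x -> prefix (Psi [:: 0]) (Psi (0 :: t :: x)).
  have [h|] := pselect (forall x, node N s x -> prefix (Psi [:: 0]) (Psi (0 :: 0 :: x))).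
    by exists 0.
  move=> /existsNP[x /not_implyP[nx hx]]; exists 1 => // y ny.
  have : betw (0 :: 0 :: x) [:: 0] (0 :: 1 :: y) by [].
  rewrite -Psi_betw //; [|exact: W2|exact: W2].
  by case/andP=> _ /orP[/hx|].
have s_node : node N s [::] by have := nphi a0; case: (s).
have [|||tau [ntau Etau]] := homogeneous_cone Psi_node Psi_inj Psi_betw
    (N := N) (sg := s) (v := [:: 0; t]).
- by move=> x nx; apply: W2.
- by move=> x nx; rewrite Psi_lab //; apply: W2.
- move=> x nx; rewrite -(@betw_above (Psi [:: 0])) ?up //.
  rewrite Psi_betw //; [|exact: W2|exact: W2].
  by rewrite betw_above //= ?eqxx ?prefix0s.
have Wa a : W ([:: 0; t] ++ tau (phi a)) by apply/W2/ntau.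
exists (fun a => SeqSub (Wa a)).
by apply: (realized_embedding Hphi Hpsi Etau) => a; rewrite (PsiE _ (Wa a)).
Qed.

(** An expansion is determined by the types of pairs, of which finitely many are possible: labels
    lie in [P], directions at a finite label are bounded, and label omega has two codes besides
    [None]. *)
Lemma FPs_precompact : finite_set P -> precompact (@FP P) (@FPs P).
Proof.
move=> /finite_seqP[ps eP] A hA.
(* Omega counts as [0] in the maximum; the two successors make room for the rank codes [0] and [1]
   in any case. *)
pose M := (\max_(p <- ps) odflt 0 p).+2.
pose ds : seq (option nat) := None :: [seq Some i | i <- iota 0 M].
pose V := [seq (t, d) | t <- [seq (p, d) | p <- ps, d <- ds], d <- ds].
have memds o : (forall i, o = Some i -> i < M) -> o \in ds.
  case: o => [i|_]; last by rewrite mem_head.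
  by move=> /(_ i erefl) li; rewrite inE map_f // mem_iota.
have memV3 p x y : p \in ps -> x \in ds -> y \in ds -> (p, x, y) \in V.
  by move=> hp hx hy; apply: (allpairs_f pair) hy; apply: (allpairs_f pair).
pose g (f : {ffun A * A -> seq_sub V}) : interpretation type_language A :=
  fun R t => val (f (tnth t ord0, tnth t (lift ord0 ord0))) = R.
apply: (sub_finite_set (B := range g)); last exact/finite_image/finite_finset.
move=> i [_ [s [N [phi Hphi]]]].
have [gs lN _ nphi _] := Hphi.
have memV a b : tp2 s (phi a) (phi b) \in V.
  rewrite /tp2; set m := lcp _ _.
  have Pm : P (lab s m).
    by apply/gs/mem_nth/(node_size (node_lcp (phi b) (nphi a))).
  have mps : lab s m \in ps by move: Pm; rewrite eP.
  have dirlt c k : prefix m (phi c) -> onth (phi c) (size m) = Some k ->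
      k < width N (lab s m).
    move=> mc ek; have ne : m != phi c.
      by apply/eqP => e; move: ek; rewrite e onth_default.
    have := onth_rcons_prefix (prefix_rcons_nth mc ne); rewrite ek => -[->].
    exact: node_nth.
  have M2 : 1 < M by [].
  case el: (lab s m) mps dirlt => [p|] mps dirlt.
    have leM : p.-1 <= M.
      rewrite -ltnS; apply: leq_trans (leq_pred _) _; apply: leqW; apply: leqW.
      exact: (@leq_bigmax_seq _ ps xpredT (odflt 0) (Some p) mps).
    by apply: memV3 => //; apply: memds => k /dirlt h; apply: leq_trans leM; apply: h;
      rewrite ?lcp_prefixl ?lcp_prefixr.
  have code x y k : rank_code x y = Some k -> k < M.
    by case: y => //= y' [<-]; case: x => [x'|] //; case: (x' < y').
  by apply: memV3 => //; apply: memds => k; apply: code.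
exists [ffun ab => SeqSub (memV ab.1 ab.2)] => //.
apply/functional_extensionality_dep => R; apply/funext => t; apply/propext.
rewrite /g ffunE /=; have [a [b ->]] := tuple2E t.
exact: (iff_sym (realized_tp2 (A := expand i) a b R Hphi)).
Qed.

End Main.

Theorem theorem3p1 (P : set (option nat))
    (hP : forall p : option nat, P p -> le_bound 3 p) :
  exists (L' : language) (FPs : class (lang_union (LP P) L')),
    [/\ Fraisse_HP FPs,
        is_expansion (@FP P) FPs,
        reasonable (@FP P) FPs,
        relative_HP (@FP P) FPs &
        expansion_property (@FP P) FPs] /\
    Ramsey_class FPs /\
    (finite_set P -> precompact (@FP P) FPs).
Proof.
exists type_language, (@FPs P); split; last split.
- split.
  + exact: FPs_Fraisse.
  + exact: FPs_is_expansion.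
  + exact: FPs_reasonable.
  + exact: FPs_relative_HP.
  + exact: FPs_expansion_property.
- exact: FPs_Ramsey.
- exact: FPs_precompact.
Qed.
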